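(* Let $d\ge 1$, $2<p<\infty$ and $1\leqslant q<\infty$, and let $q'$ be the dual exponent ($\frac1q+\frac1{q'}=1$, so $q'=\infty$ if $q=1$). Let $S\subset\mathbb{R}^d$ be a compact set which is $\sigma$-finite with respect to $\mathcal{H}_{\frac{2d}{p},\frac{q'}{2}}$, i.e. $S$ is a countable union of sets $S_i$ with $\mathcal{H}_{\frac{2d}{p},\frac{q'}{2}}(S_i)<\infty$. Let $\zeta$ be a tempered distribution on $\mathbb{R}^d$ such that $\hat{\zeta}\in L_{p,q}(\mathbb{R}^d)$ and $\operatorname{supp}\zeta\subset S$. Then $\zeta=0$.
   Context: Lorentz spaces: for a measure space $(X,\mu)$ and $p,q\in(0,\infty)$, $\|f\|^q_{L_{p,q}}=q\int_0^\infty (m_f(t)t^p)^{q/p}\frac{dt}{t}$, where $m_f(t)=\mu(\{x: |f(x)|\geqslant t\})$; $L_{p,q}(\mathbb{R}^d)$ is taken with Lebesgue measure. Netrusov--Hausdorff capacity: let $\Delta_k=[2^{-k-1},2^{-k})$ for $k\in\mathbb{Z}$. For $F\subset\mathbb{R}^d$, $\alpha>0$, $\delta>0$ and $0<\beta<\infty$ set $\mathcal{H}_{\alpha,\beta}(F,\delta)=\inf\big\{\sum_{k}\big(\sum_{j:\,\operatorname{diam}B_j\in\Delta_k}(\operatorname{diam}B_j)^\alpha\big)^\beta : F\subset\bigcup_j B_j,\ \operatorname{diam}B_j<\delta\big\}$ (infimum over countable covers by sets $B_j$), and for $\beta=\infty$ replace $\sum_k(\cdot)^\beta$ by $\sup_k(\cdot)$.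 Then $\mathcal{H}_{\alpha,\beta}(F)=\lim_{\delta\to0}\mathcal{H}_{\alpha,\beta}(F,\delta)$. *)

(* Defs.v *)
From HB Require Import structures.
From mathcomp Require Import all_boot all_order all_algebra.
From mathcomp Require Import all_classical all_reals all_analysis.

Set Implicit Arguments.
Unset Strict Implicit.
Unset Printing Implicit Defensive.

Import Order.TTheory GRing.Theory Num.Theory.
Import numFieldNormedType.Exports.

Local Open Scope classical_set_scope.
Local Open Scope ring_scope.

Section Defs.
Variables (R : realType) (d : nat).

Definition eucl_dist (x y : 'rV[R]_d) : R :=
  Num.sqrt (\sum_(i < d) (x 0 i - y 0 i) ^+ 2).

Definition dotp (x y : 'rV[R]_d) : R := \sum_(i < d) x 0 i * y 0 i.

Definition box (a b : 'rV[R]_d) : set 'rV[R]_d :=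
  [set x | forall i, a 0 i <= x 0 i < b 0 i].

Definition boxes : set (set 'rV[R]_d) :=
  [set B | exists a b, B = box a b].

End Defs.

(** R^d equipped with its Borel sigma-algebra (generated by the half-open boxes). *)
Notation Rd R d := (g_sigma_algebraType (@boxes R d)).

Section Defs2.
Variables (R : realType) (d : nat).


(** Characterisation of the Lebesgue measure on R^d (it is the unique measure
    on the Borel sets giving each box its volume). *)
Definition is_lebesgue_measure (mu : {measure set (Rd R d) -> \bar R}) : Prop :=
  forall a b : 'rV[R]_d, (forall i, a 0 i <= b 0 i) ->
    mu (box a b : set (Rd R d)) = (\prod_(i < d) (b 0 i - a 0 i))%:E.

(** A complex valued function is represented by its real and imaginary parts. *)
Definition cabs (g1 g2 : Rd R d -> R) (x : Rd R d) : R := Num.sqrt (g1 x ^+ 2 + g2 x ^+ 2).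

Definition distrib_fun (mu : {measure set (Rd R d) -> \bar R}) (f : Rd R d -> R) (t : R) : \bar R :=
  mu [set x | t <= f x].

Definition lorentz_norm_q (mu : {measure set (Rd R d) -> \bar R}) (p q : R) (f : Rd R d -> R) : \bar R :=
  (q%:E * \int[@lebesgue_measure R]_(t in `]0%R, +oo[)
     (poweR (distrib_fun mu f t * (t `^ p)%:E) (q / p) * (t^-1)%:E))%E.

Definition in_lorentz (mu : {measure set (Rd R d) -> \bar R}) (p q : R) (g1 g2 : Rd R d -> R) : Prop :=
  measurable_fun setT g1 /\ measurable_fun setT g2 /\
  (lorentz_norm_q mu p q (cabs g1 g2) < +oo)%E.

Definition diam (A : set 'rV[R]_d) : \bar R :=
  ereal_sup [set (eucl_dist x y)%:E | x in A & y in A].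

Definition diam_in_Delta (k : int) (A : set 'rV[R]_d) : Prop :=
  (((2%:R : R) `^ (- (k%:~R + 1)))%:E <= diam A < ((2%:R : R) `^ (- k%:~R))%:E)%E.

Definition NH_cost (alpha : R) (beta : \bar R) (B : nat -> set 'rV[R]_d) : \bar R :=
  let inner k := (\esum_(j in [set j | diam_in_Delta k (B j)]) poweR (diam (B j)) alpha)%E in
  match beta with
  | (b%:E)%E => (\esum_(k in [set: int]) poweR (inner k) b)%E
  | _ => ereal_sup [set inner k | k in [set: int]]
  end.

Definition NH_delta (alpha : R) (beta : \bar R) (F : set 'rV[R]_d) (delta : R) : \bar R :=
  ereal_inf [set NH_cost alpha beta B | B in
    [set B : nat -> set 'rV[R]_d |
       F `<=` \bigcup_j B j /\ forall j, (diam (B j) < delta%:E)%E]].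

(** H_{alpha,beta}(F) = lim_{delta -> 0} H_{alpha,beta}(F, delta); the quantity
    H(F,delta) is nonincreasing in delta so the limit is the supremum. *)
Definition NH_capacity (alpha : R) (beta : \bar R) (F : set 'rV[R]_d) : \bar R :=
  ereal_sup [set NH_delta alpha beta F delta | delta in [set delta : R | 0 < delta]].

Definition sigma_finite_NH (alpha : R) (beta : \bar R) (S : set 'rV[R]_d) : Prop :=
  exists Si : nat -> set 'rV[R]_d,
    S = \bigcup_i Si i /\ forall i, (NH_capacity alpha beta (Si i) < +oo)%E.

Definition unit_vec (i : 'I_d) : 'rV[R]_d := delta_mx 0 i.

Fixpoint iter_partial (l : seq 'I_d) (f : 'rV[R]_d -> R) : 'rV[R]_d -> R :=
  match l with
  | [::] => f
  | i :: l' => fun x => 'D_(unit_vec i) (iter_partial l' f) x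
  end.

Definition smooth (f : 'rV[R]_d -> R) : Prop :=
  forall l : seq 'I_d, continuous (iter_partial l f) /\
    forall (i : 'I_d) (x : 'rV[R]_d), derivable (iter_partial l f) x (unit_vec i).

Definition fsupport (f : 'rV[R]_d -> R) : set 'rV[R]_d := closure [set x | f x != 0].

Definition test_fun_off (S : set 'rV[R]_d) (phi : 'rV[R]_d -> R) : Prop :=
  smooth phi /\ compact (fsupport phi) /\ fsupport phi `&` S = set0.

Definition invF_re (mu : {measure set (Rd R d) -> \bar R}) (phi : 'rV[R]_d -> R) (xi : Rd R d) : R :=
  Rintegral mu setT (fun x : Rd R d => phi x * cos (2 * pi * dotp x xi)).
Definition invF_im (mu : {measure set (Rd R d) -> \bar R}) (phi : 'rV[R]_d -> R) (xi : Rd R d) : R :=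
  Rintegral mu setT (fun x : Rd R d => phi x * sin (2 * pi * dotp x xi)).

(** <zeta, phi> = <g, F^{-1} phi> = \int g(xi) (F^{-1}phi)(xi) dxi, for
    zeta the tempered distribution with Fourier transform g = g1 + i g2.
    zeta vanishes on phi iff both real and imaginary parts vanish. *)
Definition pairing_vanishes (mu : {measure set (Rd R d) -> \bar R}) (g1 g2 : Rd R d -> R)
    (phi : 'rV[R]_d -> R) : Prop :=
  Rintegral mu setT (fun xi => g1 xi * invF_re mu phi xi - g2 xi * invF_im mu phi xi) = 0 /\
  Rintegral mu setT (fun xi => g1 xi * invF_im mu phi xi + g2 xi * invF_re mu phi xi) = 0.

Definition support_in (mu : {measure set (Rd R d) -> \bar R}) (g1 g2 : Rd R d -> R)
    (S : set 'rV[R]_d) : Prop :=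
  forall phi, test_fun_off S phi -> pairing_vanishes mu g1 g2 phi.

End Defs2.

Definition half_dual_exp {R : realType} (q : R) : \bar R :=
  if q == 1 then (+oo)%E else (q / (q - 1) / 2)%:E.

(* Main.v *)
(** Pair zeta with a smooth bump phi and cover S by finitely many dyadic cubes, N_k of them at scale
    2^-k. A partition of unity built from smooth plateaus on these cubes writes phi as a test
    function vanishing near S plus pieces Psi_k living on the N_k cubes of scale 2^-k with
    derivatives of order m bounded by C 2^(km). Bessel's inequality (for Psi_k and for its iterated
    differences) shows that the inverse transform of Psi_k has L^2 norm at most C (N_k 2^-kd)^(1/2)
    and is concentrated on |xi| <= 2^k; truncating g at a level t_k and writing h_k for the L^2 norm
    of g above that level, this gives
      \int |g| |F^-1 Psi_k| <= C N_k^(1/2) (t_k + 2^(-kd/2) h_k) = C (N_k 2^(-2kd/p))^(1/2) a_k.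
    If t_k is the level above which |g| has distribution function at most 2^(kd), the condition g in
    L_{p,q} with p > 2 makes (a_k) an l^q sequence. Finite capacity bounds the l^(q'/2) norm of N_k
    2^(-2kd/p), so by Hoelder the sum over k is small for covers by small sets; hence zeta(phi) = 0.
    Translating phi multiplies its transform by a character, so Fourier uniqueness gives g K = 0
    almost everywhere for K = F^-1 phi, and K <> 0 on any prescribed ball when phi is concentrated
    near 0. *)

(* Finite capacity controls only the counts N_k, so no constant may depend on the cover. For this
   reason the cubes of one scale are kept distinct, so that at most 5^d bumps of that scale matter
   at a point, and a coarser scale l enters the k-th piece only through a factor exp(O(2^(l-k))),
   whose product over l converges. The order of differentiation m = d + 1 comes from Cauchy-Schwarz
   on the shells |xi| ~ 2^n 2^k: the volume of a shell costs 2^(nd/2) against a decay 2^(-nm), so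
   any m > d/2 would give a convergent sum. The assumption p > 2 enters twice: it makes g
   square-integrable above a level, and it gives 2^(d/p) < 2^(d/2), so that the tails h_k, which
   accumulate all larger values of g, obey a contracting recursion after normalization. Finite
   capacity alone makes the sum of the terms N_k^(1/2) 2^(-kd/p) a_k bounded, not small. Smallness
   comes from restricting the diameters: only scales k >= k0 then occur, and the l^q tail of (a_k)
   is small there. Sets of diameter zero escape this count and need a separate budget. *)
Require Import Defs.
From HB Require Import structures.
From mathcomp Require Import all_boot all_order all_algebra.
From mathcomp Require Import all_classical all_reals all_analysis measurable_realfun.
From mathcomp Require Import ring lra zify.
Set Implicit Arguments.
Unset Strict Implicit.
Unset Printing Implicit Defensive.
Import Order.TTheory GRing.Theory Num.Theory.
Import numFieldNormedType.Exports.
Local Open Scope classical_set_scope.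
Local Open Scope ring_scope.

(** * Lebesgue measure and translations *)

Section EuclideanMeasure.
Context {R : realType} {d : nat}.
Local Notation T := (Rd R d).
Implicit Types (a b v x : 'rV[R]_d).

Lemma measurable_box a b : measurable (box a b : set T).
Proof. by apply: sub_sigma_algebra; exists a, b. Qed.

Definition lowhalf (i : 'I_d) (c : R) : set T := [set x : T | x 0 i < c].

Lemma measurable_lowhalf i c : measurable (lowhalf i c).
Proof.
have -> : lowhalf i c = \bigcup_n (box (\row_j (- n%:R)) (\row_j (if j == i then c else n%:R)) : set T).
  apply/seteqP; split=> [x /= xc|x [n _] /(_ i)]; last first.
    by rewrite !mxE eqxx => /andP[].
  pose M := \sum_j `|x 0 j|.
  have Mx j : `|x 0 j| <= M by rewrite /M (bigD1 j)//= lerDl sumr_ge0.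
  have M0 : 0 <= M by rewrite sumr_ge0.
  exists (Num.truncn M).+1 => // j; rewrite !mxE.
  have h : `|x 0 j| < (Num.truncn M).+1%:R.
    by apply: (le_lt_trans (Mx j)); rewrite truncnS_gt.
  move: h; rewrite ltr_norml => /andP[h1 h2]; rewrite (ltW h1)/=.
  by case: eqP => // ->.
by apply: bigcup_measurable => n _; exact: measurable_box.
Qed.

Lemma measurable_coord (i : 'I_d) : measurable_fun setT (fun x : T => (x : 'rV[R]_d) 0 i).
Proof.
apply: (measurability _ (RGenInftyO.measurableE R)).

move=> _ [_ [c ->] <-]; rewrite setTI.
rewrite (_ : _ @^-1` _ = lowhalf i c); first exact: measurable_lowhalf.
by apply/seteqP; split=> x /=; rewrite in_itv.
Qed.

Lemma measurable_to_Rd d' (T' : measurableType d') (f : T' -> T) :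
  (forall i, measurable_fun setT (fun t => (f t : 'rV[R]_d) 0 i)) -> measurable_fun setT f.
Proof.
move=> mf; have := @measurability _ _ T' T setT f (@boxes R d) erefl; apply.
move=> _ [_ [a [b ->]] <-]; rewrite setTI.
rewrite (_ : _ @^-1` _ = \bigcap_(i in [set: 'I_d])
   (fun t => (f t : 'rV[R]_d) 0 i) @^-1` [set` `[a 0 i, b 0 i[]).
  apply: fin_bigcap_measurable => // i _; rewrite -[X in measurable X]setTI.
  exact: (mf i).
apply/seteqP; split=> [t h i _|t h i]; first by rewrite /= in_itv/=; exact: h.
by have := h i I; rewrite /= in_itv.
Qed.

Definition translate v (x : T) : T := (x : 'rV[R]_d) + v.

Lemma measurable_translate v : measurable_fun setT (translate v).
Proof.
apply: measurable_to_Rd => i.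
under eq_fun do rewrite /translate mxE.
by apply: measurable_funD => //; exact: measurable_coord.
Qed.

Definition cube (r : R) : set T := box (\row_(i < d) (- r)) (\row_(i < d) r).

Lemma cubeP r x : cube r x <-> forall i, - r <= x 0 i < r.
Proof. by split=> h i; have := h i; rewrite !mxE. Qed.

Lemma measurable_cube r : measurable (cube r).
Proof. exact: measurable_box. Qed.

Lemma cubes_cover : \bigcup_n cube n%:R = setT.
Proof.
apply/seteqP; split=> // x _.
pose M := \sum_j `|(x : 'rV[R]_d) 0 j|.
exists (Num.truncn M).+1 => //; apply/cubeP => j.
have Mx : `|(x : 'rV[R]_d) 0 j| <= M by rewrite /M (bigD1 j)//= lerDl sumr_ge0.
have : `|(x : 'rV[R]_d) 0 j| < (Num.truncn M).+1%:R.
  by apply: (le_lt_trans Mx); rewrite truncnS_gt.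
by rewrite ltr_norml => /andP[h1 h2]; rewrite (ltW h1).
Qed.

Lemma cubeS r s : r <= s -> cube r `<=` cube s.
Proof.
move=> rs x /cubeP h; apply/cubeP => i; case/andP: (h i) => h1 h2.
by rewrite (lt_le_trans h2 rs) (le_trans _ h1)// lerN2.
Qed.

Lemma setI_closed_boxes : setI_closed (@boxes R d).
Proof.
move=> _ _ [a [b ->]] [a' [b' ->]].
exists (\row_i Num.max (a 0 i) (a' 0 i)), (\row_i Num.min (b 0 i) (b' 0 i)).
apply/seteqP; split=> [x [h h'] i|x h].
  have /andP[h1 h2] := h i; have /andP[h3 h4] := h' i.
  by rewrite !mxE ge_max lt_min h1 h2 h3 h4.
by split=> i; have := h i; rewrite !mxE ge_max lt_min => /andP[/andP[h1 h2] /andP[h3 h4]];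
  rewrite ?h1 ?h2 ?h3 ?h4.
Qed.

Variable mu : {measure set T -> \bar R}.
Hypothesis Hmu : is_lebesgue_measure mu.

Lemma mu_cube r : 0 <= r -> mu (cube r) = ((2 * r) ^+ d)%:E.
Proof.
move=> r0; rewrite /cube Hmu; last by move=> i; rewrite !mxE; lra.
congr EFin; rewrite -[d in RHS]card_ord -prodr_const; apply: eq_bigr => i _.
by rewrite !mxE; lra.
Qed.

Lemma mu_box_lty a b : (mu (box a b : set T) < +oo)%E.
Proof.
have [h|/existsNP[i /negP]] := pselect (forall i, a 0 i <= b 0 i).
  by rewrite Hmu// ltry.
rewrite -ltNge => ba; rewrite (_ : box a b = set0) ?measure0//.
apply/seteqP; split=> // x /(_ i) /andP[h1 h2].
by have := lt_trans (le_lt_trans h1 h2) ba; rewrite ltxx.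
Qed.

Lemma mu_sigma_finite : sigma_finite setT mu.
Proof.
exists (fun n => cube n%:R); first by rewrite cubes_cover.
by move=> n; split; [exact: measurable_cube|exact: mu_box_lty].
Qed.

Lemma translate_boxE v a b :
  translate v @^-1` (box a b) = (box (a - v) (b - v) : set T).
Proof.
by apply/seteqP; split=> x h i; have := h i; rewrite !mxE lerBlDr ltrBrDr.
Qed.

(** The translated measure agrees with [mu] on boxes, which form a pi-system generating the
    sigma-algebra, and it is finite on the cubes that exhaust the space. *)
Lemma mu_translate v (A : set T) : measurable A ->
  mu (translate v @^-1` A) = mu A.
Proof.
move=> mA.
pose sh := fun x : T => (x + v : 'rV[R]_d) : T.
pose m : {measure set T -> \bar R} := measure_function_pushforward__canonical__measure_function_Measure mu (measurable_translate v).
apply: (@measure_unique _ R T (@boxes R d) (fun n => cube n%:R) erefl _ _ _ m mu _ _ A mA).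
- exact: setI_closed_boxes.
- by move=> n; exists (\row_i - n%:R), (\row_i n%:R).
- exact: cubes_cover.
- move=> _ [a [b ->]]; rewrite /= /pushforward/= translate_boxE.
  have [h|h] := pselect (forall i, a 0 i <= b 0 i).
    rewrite !Hmu//; last by move=> i; rewrite !mxE lerD2r.
    by congr EFin; apply: eq_bigr => i _; rewrite !mxE; lra.
  (* The volume formula covers only ordered endpoints; if a side is reversed, the box and its
     translate are both empty. *)
  have [i /negP] := (existsNP _).2 h; rewrite -ltNge => ba.
  rewrite (_ : box a b = set0); last first.
    apply/seteqP; split=> // x /(_ i) /andP[h1 h2].
    by have := lt_trans (le_lt_trans h1 h2) ba; rewrite ltxx.
  rewrite (_ : box _ _ = set0) ?measure0//.
  apply/seteqP; split=> // x /(_ i); rewrite !mxE => /andP[h1 h2].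
  by have := le_lt_trans h1 h2; rewrite ltrD2r => /(lt_trans ba); rewrite ltxx.
- by move=> n /=; rewrite /pushforward/= translate_boxE mu_box_lty.
Qed.

Lemma ge0_integral_translate v (f : T -> \bar R) : measurable_fun setT f ->
  (forall x, (0 <= f x)%E) ->
  (\int[mu]_x f (translate v x) = \int[mu]_x f x)%E.
Proof.
move=> mf f0.
have := @ge0_integral_pushforward _ _ T T R _ (measurable_translate v) mu setT f measurableT mf.
rewrite preimage_setT => /(_ (fun y _ => f0 y)) <-.
apply: eq_measure_integral; first exact: measurable_translate.
by move=> mf' A mA _; exact: mu_translate.
Qed.

Lemma Rintegral_translate v (f : T -> R) : measurable_fun setT f ->
  \int[mu]_x f (translate v x) = \int[mu]_x f x.
Proof.
move=> mf; rewrite /Rintegral; congr fine.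
rewrite [LHS]integralE [RHS]integralE.
have mE : measurable_fun setT (EFin \o f) by exact/measurable_EFinP.
congr (_ - _)%E.
  have p := measurable_funepos mE.
have q x : (0 <= (EFin \o f)^\+ x)%E by exact: funepos_ge0.
rewrite -(ge0_integral_translate v p q); apply: eq_integral => x _; by rewrite !funeposE.
have p := measurable_funeneg mE.
have q x : (0 <= (EFin \o f)^\- x)%E by exact: funeneg_ge0.
rewrite -(ge0_integral_translate v p q); apply: eq_integral => x _; by rewrite !funenegE.
Qed.

End EuclideanMeasure.

(** * Bounded functions and functions of bounded support *)

Section BoundedFunctions.
Context {R : realType} {d : nat}.
Local Notation T := (Rd R d).
Implicit Types (v x xi : 'rV[R]_d) (f g u : T -> R).

Definition bmeas f := measurable_fun setT f /\ exists M, forall x, `|f x| <= M.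

(** The class in which all integrals in the space variable are taken: stable under linear
    combinations, translations and multiplication by bounded measurable functions, and always
    integrable. *)
Definition bsupp u := bmeas u /\ exists r, forall x, u x != 0 -> cube r x.

Lemma bmeas_bound f : bmeas f -> exists2 M, 0 < M & forall x, `|f x| <= M.
Proof.
move=> [_ [M hM]]; exists (`|M| + 1); first by rewrite ltr_wpDl.
by move=> x; rewrite (le_trans (hM x))// (le_trans (ler_norm _))// lerDl.
Qed.

Lemma bmeas_cst c : bmeas (cst c).
Proof. by split; [exact: measurable_cst|exists `|c|]. Qed.

Lemma bmeasD f g : bmeas f -> bmeas g -> bmeas (fun x => f x + g x).
Proof.
move=> [mf [M hM]] [mg [N hN]]; split; first exact: measurable_funD.
by exists (M + N) => x; rewrite (le_trans (ler_normD _ _))// lerD.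
Qed.

Lemma bmeasM f g : bmeas f -> bmeas g -> bmeas (fun x => f x * g x).
Proof.
move=> [mf [M hM]] [mg [N hN]]; split; first exact: measurable_funM.
by exists (M * N) => x; rewrite normrM ler_pM.
Qed.

Lemma bmeasZ c f : bmeas f -> bmeas (fun x => c * f x).
Proof. by move=> bf; apply: bmeasM => //; exact: bmeas_cst. Qed.

Lemma bmeasN f : bmeas f -> bmeas (fun x => - f x).
Proof. by move=> /(bmeasZ (-1)); under eq_fun do rewrite mulN1r. Qed.

Lemma bmeasB f g : bmeas f -> bmeas g -> bmeas (fun x => f x - g x).
Proof. by move=> bf bg; apply: bmeasD => //; exact: bmeasN. Qed.

Lemma bmeas_prod (I : Type) (s : seq I) (h : I -> T -> R) :
  (forall i, bmeas (h i)) -> bmeas (fun x => \prod_(i <- s) h i x).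
Proof.
move=> bh; elim: s => [|i s ih].
  by under eq_fun do rewrite big_nil; exact: bmeas_cst.
by under eq_fun do rewrite big_cons; exact: bmeasM.
Qed.

Lemma bmeas_indic (A : set T) : measurable A -> bmeas (\1_A : T -> R).
Proof.
move=> mA; split; first exact: measurable_indic.
by exists 1 => x; rewrite indicE; case: (_ \in _); rewrite ?normr1 ?normr0.
Qed.

Lemma bmeas_translate v f : bmeas f -> bmeas (fun x => f (translate v x)).
Proof.
move=> [mf [M hM]]; split; last by exists M => x.
by apply: measurableT_comp => //; exact: measurable_translate.
Qed.

Lemma measurable_dotp xi : measurable_fun setT (fun x : T => dotp x xi).
Proof.
apply: measurable_sum => i; apply: measurable_funM => //; exact: measurable_coord.
Qed.

Lemma measurable_phase xi : measurable_fun setT (fun x : T => 2 * pi * dotp x xi).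
Proof. by apply: measurable_funM => //; exact: measurable_dotp. Qed.

Lemma measurable_cosr : measurable_fun setT (@cos R).
Proof. by apply: continuous_measurable_fun => x; exact: continuous_cos. Qed.

Lemma measurable_sinr : measurable_fun setT (@sin R).
Proof. by apply: continuous_measurable_fun => x; exact: continuous_sin. Qed.

Lemma bmeas_cos xi : bmeas (fun x : T => cos (2 * pi * dotp x xi)).
Proof.
split; last by exists 1 => x; rewrite cos_max.
exact: (measurableT_comp measurable_cosr (measurable_phase xi)).
Qed.

Lemma bmeas_sin xi : bmeas (fun x : T => sin (2 * pi * dotp x xi)).
Proof.
split; last by exists 1 => x; rewrite sin_max.
exact: (measurableT_comp measurable_sinr (measurable_phase xi)).
Qed.

Lemma bsuppM u f : bsupp u -> bmeas f -> bsupp (fun x => u x * f x).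
Proof.
move=> [bu [r hr]] bf; split; first exact: bmeasM.
by exists r => x; rewrite mulf_eq0 negb_or => /andP[/hr].
Qed.

Lemma bsuppZ c u : bsupp u -> bsupp (fun x => c * u x).
Proof.
move=> bu; under eq_fun do rewrite mulrC; apply: bsuppM => //; exact: bmeas_cst.
Qed.

Lemma bsuppD u g : bsupp u -> bsupp g -> bsupp (fun x => u x + g x).
Proof.
move=> [bu [r hr]] [bg [s hs]]; split; first exact: bmeasD.
exists (Num.max r s) => x; have [->|/hr h _] := eqVneq (u x) 0; last first.
  by apply: cubeS h; rewrite le_max lexx.
by rewrite add0r => /hs; apply: cubeS; rewrite le_max lexx orbT.
Qed.

Lemma bsuppN u : bsupp u -> bsupp (fun x => - u x).
Proof. by move=> /(bsuppZ (-1)); under eq_fun do rewrite mulN1r. Qed.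

Lemma bsuppB u g : bsupp u -> bsupp g -> bsupp (fun x => u x - g x).
Proof. by move=> bf bg; apply: bsuppD => //; exact: bsuppN. Qed.

Lemma bsupp_sum (I : Type) (s : seq I) (h : I -> T -> R) :
  (forall i, bsupp (h i)) -> bsupp (fun x => \sum_(i <- s) h i x).
Proof.
move=> bh; elim: s => [|i s ih].
  under eq_fun do rewrite big_nil; split; first exact: bmeas_cst.
  by exists 0 => x; rewrite eqxx.
by under eq_fun do rewrite big_cons; exact: bsuppD.
Qed.

Lemma bsupp_cube r : bsupp (\1_(cube r) : T -> R).
Proof.
split; first by apply: bmeas_indic; exact: measurable_cube.
exists r => x; rewrite indicE; case: (boolP (x \in cube r)); last by rewrite eqxx.
by rewrite inE.
Qed.

Lemma bsupp_translate v u : bsupp u -> bsupp (fun x => u (translate v x)).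
Proof.
move=> [bu [r hr]]; split; first exact: bmeas_translate.
exists (r + \sum_j `|v 0 j|) => x /hr /cubeP h; apply/cubeP => i.
have vi : `|v 0 i| <= \sum_j `|v 0 j| by rewrite (bigD1 i)//= lerDl sumr_ge0.
move: (h i) vi; rewrite /translate mxE ler_norml => /andP[h1 h2] /andP[h3 h4].
by apply/andP; split; lra.
Qed.

Variable mu : {measure set T -> \bar R}.
Hypothesis Hmu : is_lebesgue_measure mu.

Lemma bsupp_integrable u : bsupp u -> mu.-integrable setT (EFin \o u).
Proof.
move=> [bu [r hr]]; have [M M0 hM] := bmeas_bound bu.
have mc : measurable (cube r : set T) by exact: measurable_cube.
have : mu.-integrable (cube r) (EFin \o u).
  apply: measurable_bounded_integrable => //; first exact: mu_box_lty.
    by apply: measurable_funTS; case: bu.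
  exists M; split; first exact: num_real.
  by move=> N MN x _ /=; rewrite (le_trans (hM x))// ltW.
move/(integrable_mkcond _ mc).
congr (mu.-integrable setT _); apply/funext => x; rewrite patchE; case: ifPn => //.
by move=> /negP; rewrite inE => nc /=; apply/esym; congr EFin; apply: contra_notP nc => /eqP/hr.
Qed.

Lemma int_D u g : bsupp u -> bsupp g ->
  \int[mu]_x (u x + g x) = \int[mu]_x u x + \int[mu]_x g x.
Proof. by move=> bu bg; rewrite RintegralD//; exact: bsupp_integrable. Qed.

Lemma int_Z c u : bsupp u -> \int[mu]_x (c * u x) = c * \int[mu]_x u x.
Proof. by move=> bu; rewrite RintegralZl//; exact: bsupp_integrable. Qed.

Lemma int_N u : bsupp u -> \int[mu]_x (- u x) = - \int[mu]_x u x.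
Proof.
by move=> bu; under eq_Rintegral do rewrite -mulN1r; rewrite int_Z// mulN1r.
Qed.

Lemma int_B u g : bsupp u -> bsupp g ->
  \int[mu]_x (u x - g x) = \int[mu]_x u x - \int[mu]_x g x.
Proof. by move=> bu bg; rewrite RintegralB//; exact: bsupp_integrable. Qed.

Lemma int_sum (I : Type) (s : seq I) (h : I -> T -> R) :
  (forall i, bsupp (h i)) ->
  \int[mu]_x (\sum_(i <- s) h i x) = \sum_(i <- s) \int[mu]_x h i x.
Proof.
move=> bh; elim: s => [|i s ih].
  by rewrite big_nil; under eq_Rintegral do rewrite big_nil; rewrite Rintegral_cst// mul0r.
rewrite big_cons -ih -int_D//; last exact: bsupp_sum.
by apply: eq_Rintegral => x _; rewrite big_cons.
Qed.

Lemma int_le u g : bsupp u -> bsupp g -> (forall x, u x <= g x) ->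
  \int[mu]_x u x <= \int[mu]_x g x.
Proof. by move=> bu bg ug; apply: le_Rintegral => //; exact: bsupp_integrable. Qed.

Lemma int_translate v u : bsupp u -> \int[mu]_x u (translate v x) = \int[mu]_x u x.
Proof. by move=> [[mu' _] _]; exact: Rintegral_translate. Qed.

Lemma int_cube r : 0 <= r -> \int[mu]_x \1_(cube r) x = (2 * r) ^+ d.
Proof.
move=> r0; rewrite /Rintegral integral_indic ?setIT//; last exact: measurable_cube.
by rewrite (mu_cube Hmu).
Qed.

End BoundedFunctions.

(** * Bessel's inequality *)

Section Trigonometry.
Context {R : realType}.

(** Antiperiodicity under pi is the one property of cosine and sine behind the orthogonality of
    characters, so both are treated by a single argument. *)
Lemma antiperiodic_int (g : R -> R) : (forall y, g (y + pi) = - g y) ->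
  forall (k : int) y, g (y + 2 * pi * k%:~R) = g y.
Proof.
move=> gpi.
have gn (n : nat) y : g (y + 2 * pi * n%:R) = g y.
  elim: n y => [|n ih] y; first by rewrite mulr0 addr0.
  rewrite -natr1 (_ : y + _ = y + 2 * pi * n%:R + pi + pi); last by ring.
  by rewrite !gpi opprK ih.
case=> n y; first exact: gn.
by rewrite NegzE -(gn n.+1); congr g; rewrite mulrNz -pmulrn; ring.
Qed.

End Trigonometry.

Section Bessel.
Context {R : realType} {d : nat}.
Local Notation T := (Rd R d).
Implicit Types (v x xi : 'rV[R]_d) (f g u : T -> R).
Variable mu : {measure set T -> \bar R}.
Hypothesis Hmu : is_lebesgue_measure mu.

Lemma indic1 (A : set T) (x : T) : A x -> \1_A x = 1 :> R.
Proof. by move=> Ax; rewrite indicE mem_set. Qed.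

Lemma indic0 (A : set T) (x : T) : ~ A x -> \1_A x = 0 :> R.
Proof. by move=> Ax; rewrite indicE memNset. Qed.

Lemma dotp_translate i s x xi : dotp (x + s *: unit_vec R i) xi = dotp x xi + s * xi 0 i.
Proof.
rewrite /dotp (bigD1 i)//= [in RHS](bigD1 i)//= !mxE !eqxx/= mulr1 mulrDl -!addrA.
congr (_ + _); rewrite addrC; congr (_ + _); apply: eq_bigr => j ji.
by rewrite !mxE (negbTE ji) andbF mulr0 addr0.
Qed.

Lemma translate_coord i s (x : T) j : (translate (s *: unit_vec R i) x : 'rV[R]_d) 0 j =
  (x : 'rV[R]_d) 0 j + (if j == i then s else 0).
Proof.
by rewrite /translate !mxE eqxx /=; case: eqP => _; rewrite ?mulr1 ?mulr0.
Qed.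

(** Over a full period cell the integral does not change when f is shifted, yet the shift by s
    reverses its sign; hence it equals its own opposite. *)
Lemma int_antiperiodic f r s i : bmeas f -> 0 <= s <= 2 * r ->
  (forall x : T, f (translate ((2 * r) *: unit_vec R i) x) = f x) ->
  (forall x : T, f (translate (s *: unit_vec R i) x) = - f x) ->
  \int[mu]_x (f x * \1_(cube r) x) = 0.
Proof.
move=> bf /andP[s0 s2r] fper fanti.
pose lo := lowhalf i (- r + s) : set T.
have mlo : measurable lo by exact: measurable_lowhalf.
have mC : measurable (cube r : set T) by exact: measurable_cube.
(* After the shift by s, the part of the cube pushed through the face at r is folded back by the
   period 2r: [G1] is the part that stays inside, [G2] the part that re-enters. *)
pose G1 := fun y : T => (f y * \1_(~` lo) y) * \1_(cube r) y.
pose G2 := fun y : T => (f y * \1_lo y) * \1_(cube r) y.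
have bC : bsupp (\1_(cube r) : T -> R) by exact: bsupp_cube.
have bM h : bmeas h -> bsupp (fun x => h x * \1_(cube r) x).
  by move=> bh; under eq_fun do rewrite mulrC; exact: bsuppM.
have bG1 : bsupp G1 by apply: bM; apply: bmeasM => //; apply: bmeas_indic; exact: measurableC.
have bG2 : bsupp G2 by apply: bM; apply: bmeasM => //; exact: bmeas_indic.
have fE y : f y * \1_(cube r) y = G1 y + G2 y.
  rewrite /G1 /G2 -mulrDl -mulrDr; congr (_ * _).
  have [h|h] := pselect (lo y).
    by rewrite (indic1 h) (@indic0 (~` lo))// add0r mulr1.
  by rewrite (indic0 h) (@indic1 (~` lo))// addr0 mulr1.
pose e := unit_vec R i.
have fsE x : f (translate (s *: e) x) * \1_(cube r) x =
    G1 (translate (s *: e) x) + G2 (translate ((s - 2 * r) *: e) x).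
  have cubeE t : cube r (translate (t *: e) x) <-> (- r <= (x : 'rV[R]_d) 0 i + t < r) /\
      (forall j, j != i -> - r <= (x : 'rV[R]_d) 0 j < r).
    rewrite cubeP; split=> [h|[h1 h2] j].
      split; first by have := h i; rewrite translate_coord eqxx.
      by move=> j /negbTE ji; have := h j; rewrite translate_coord ji addr0.
    by rewrite translate_coord; case: eqP => [->//|/eqP ji]; rewrite addr0; exact: h2.
  have cubeE0 : cube r x <-> (- r <= (x : 'rV[R]_d) 0 i < r) /\
      (forall j, j != i -> - r <= (x : 'rV[R]_d) 0 j < r).
    by have := cubeE 0; rewrite scale0r /translate addr0 addr0.
  have loE t : lo (translate (t *: e) x) <-> (x : 'rV[R]_d) 0 i + t < - r + s.
    by rewrite /lo /lowhalf /= translate_coord eqxx.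
  rewrite /G1 /G2.
  have [rest|nrest] := pselect (forall j, j != i -> - r <= (x : 'rV[R]_d) 0 j < r); last first.
    by rewrite !(@indic0 (cube r)) ?mulr0 ?addr0// => [/cubeE[]|/cubeE[]|/cubeE0[]].
  have -> : f (translate ((s - 2 * r) *: e) x) = f (translate (s *: e) x).
    rewrite -(fper (translate ((s - 2 * r) *: e) x)); congr f.
    by rewrite /translate -addrA -scalerDl subrK.
  move: ((x : 'rV[R]_d) 0 i) cubeE cubeE0 loE => xi cubeE cubeE0 loE.
  have [h|h] := ltP xi (- r).
    rewrite (@indic0 (cube r) x); last by move=> /cubeE0[/andP[]]; lra.
    rewrite (@indic0 (cube r) (translate ((s - 2 * r) *: e) x)); last by move=> /cubeE[/andP[]]; lra.
    rewrite (@indic0 (~` lo)); first by rewrite !mulr0 mul0r addr0.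
    by apply; apply/loE; lra.
  have [h1|h1] := ltP xi (r - s).
    rewrite (@indic1 (cube r) x); last by apply/cubeE0; split => //; apply/andP; split; lra.
    rewrite (@indic0 (cube r) (translate ((s - 2 * r) *: e) x)); last by move=> /cubeE[/andP[]]; lra.
    rewrite (@indic1 (~` lo)); last by move=> /loE; lra.
    rewrite (@indic1 (cube r)); first by rewrite !mulr1 mulr0 addr0.
    by apply/cubeE; split => //; apply/andP; split; lra.
  rewrite (@indic0 (cube r) (translate (s *: e) x)); last by move=> /cubeE[/andP[]]; lra.
  have [h2|h2] := ltP xi r.
    rewrite (@indic1 (cube r) x); last by apply/cubeE0; split => //; apply/andP; split; lra.
    rewrite (@indic1 (cube r)); last by apply/cubeE; split => //; apply/andP; split; lra.
    rewrite (@indic1 lo (translate ((s - 2 * r) *: e) x)); last by apply/loE; lra.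
    by rewrite !mulr1 mulr0 add0r.
  rewrite (@indic0 (cube r) x); last by move=> /cubeE0[/andP[]]; lra.
  rewrite (@indic0 lo (translate ((s - 2 * r) *: e) x)); last by move=> /loE; lra.
  by rewrite !mulr0 mul0r addr0.
have bsh v u : bsupp u -> bsupp (fun x => u (translate v x)) by exact: bsupp_translate.
have e1 : \int[mu]_x (f (translate (s *: e) x) * \1_(cube r) x) = \int[mu]_x (f x * \1_(cube r) x).
  under eq_Rintegral do rewrite fsE.
  under [RHS]eq_Rintegral do rewrite fE.
  rewrite int_D ?(int_D Hmu bG1 bG2)//; [|exact: bsh|exact: bsh].
  by rewrite !(int_translate Hmu).
have e2 : \int[mu]_x (f (translate (s *: e) x) * \1_(cube r) x) = - \int[mu]_x (f x * \1_(cube r) x).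
  under eq_Rintegral do rewrite fanti mulNr.
  by rewrite int_N//; exact: bM.
move: e2; rewrite e1; lra.
Qed.

(** Complex Bessel inequality in real form: the functions c_n + i s_n are orthogonal on the cube
    with squared norm V, and A_n - i B_n are the coefficients of u. *)
Lemma bessel_abstract (I : finType) (u : T -> R) (c s : I -> T -> R) (V r : R) :
  0 < V -> bsupp u -> (forall x, u x != 0 -> cube r x) ->
  (forall n, bmeas (c n)) -> (forall n, bmeas (s n)) ->
  (forall n m, \int[mu]_x ((c n x * c m x + s n x * s m x) * \1_(cube r) x) = V * (n == m)%:R) ->
  (forall n m, \int[mu]_x ((c n x * s m x - s n x * c m x) * \1_(cube r) x) = 0) ->
  \sum_n ((\int[mu]_x (u x * c n x)) ^+ 2 + (\int[mu]_x (u x * s n x)) ^+ 2)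
     <= V * \int[mu]_x (u x ^+ 2).
Proof.
move=> V0 bu ur bc bs ort1 ort2.
pose A n := \int[mu]_x (u x * c n x); pose B n := \int[mu]_x (u x * s n x).
pose p x := \sum_n (A n * c n x + B n * s n x).
pose p' x := \sum_n (A n * s n x - B n * c n x).
set S := \sum_n _; have SE : S = \sum_n (A n ^+ 2 + B n ^+ 2) by [].
have bC : bsupp (\1_(cube r) : T -> R) by exact: bsupp_cube.
have bM h : bmeas h -> bsupp (fun x => h x * \1_(cube r) x).
  by move=> bh; under eq_fun do rewrite mulrC; exact: bsuppM.
have bum : bmeas u by case: bu.
have uC x : u x * \1_(cube r) x = u x.
  have [->|/ur h] := eqVneq (u x) 0; first by rewrite mul0r.
  by rewrite (indic1 h) mulr1.
pose q n m x := (A n * A m + B n * B m) * ((c n x * c m x + s n x * s m x) * \1_(cube r) x) +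
   (A n * B m - B n * A m) * ((c n x * s m x - s n x * c m x) * \1_(cube r) x).
have ppE x : (p x ^+ 2 + p' x ^+ 2) * \1_(cube r) x = \sum_n \sum_m q n m x.
  rewrite !expr2 !big_distrlr/= -big_split/= mulr_suml; apply: eq_bigr => n _.
  by rewrite -big_split/= mulr_suml; apply: eq_bigr => m _; rewrite /q; ring.
have bq n m : bsupp (q n m).
  apply: bsuppD; apply: bsuppZ; apply: bM; [apply: bmeasD|apply: bmeasB]; exact: bmeasM.
have bqn n : bsupp (fun x => \sum_m q n m x) by exact: bsupp_sum.
have iq n m : \int[mu]_x q n m x = (A n * A m + B n * B m) * (V * (n == m)%:R).
  rewrite int_D//; [|by apply: bsuppZ; apply: bM; apply: bmeasD; exact: bmeasM|
     by apply: bsuppZ; apply: bM; apply: bmeasB; exact: bmeasM].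
  rewrite !int_Z//; [|by apply: bM; apply: bmeasB; exact: bmeasM|
     by apply: bM; apply: bmeasD; exact: bmeasM].
  by rewrite ort1 ort2 mulr0 addr0.
pose w n x := A n * (u x * c n x) + B n * (u x * s n x).
have bw n : bsupp (w n) by apply: bsuppD; apply: bsuppZ; exact: bsuppM.
have bu2 : bsupp (fun x => u x * u x) by exact: bsuppM.
(* Here p + i p' is V times the orthogonal projection of u. Integrating |V u - (p + i p')|^2 >= 0
   gives V^2 |u|^2 - 2 V S + V S >= 0, which is the claim. *)
have expand x : V ^+ 2 * (u x * u x) + (- 2 * V) * (\sum_n w n x) + \sum_n \sum_m q n m x =
   ((V * u x - p x) ^+ 2 + p' x ^+ 2) * \1_(cube r) x.
  rewrite -ppE (_ : \sum_n w n x = u x * p x); last first.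
    by rewrite /p mulr_sumr; apply: eq_bigr => n _; rewrite /w; ring.
  have [h|h] := pselect (cube r x); first by rewrite (indic1 h); ring.
  have -> : u x = 0 by rewrite -uC (indic0 h) mulr0.
  by rewrite (indic0 h); ring.
have bs1 : bsupp (fun x => \sum_n w n x) by exact: bsupp_sum.
have bs2 : bsupp (fun x => \sum_n \sum_m q n m x) by exact: bsupp_sum.
have : 0 <= \int[mu]_x (V ^+ 2 * (u x * u x) + (- 2 * V) * (\sum_n w n x) + \sum_n \sum_m q n m x).
  by apply: Rintegral_ge0 => x _; rewrite expand mulr_ge0 ?addr_ge0 ?sqr_ge0.
rewrite int_D//; last by apply: bsuppD; exact: bsuppZ.
rewrite int_D//; [|exact: bsuppZ|exact: bsuppZ].
rewrite !int_Z// !int_sum//.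
rewrite (_ : \sum_n \int[mu]_x w n x = S); last first.
  rewrite SE; apply: eq_bigr => n _; rewrite int_D//; [|by apply: bsuppZ; exact: bsuppM|by apply: bsuppZ; exact: bsuppM].
  by rewrite !int_Z//; [exact: bsuppM|exact: bsuppM].
rewrite (_ : \sum_n \int[mu]_x \sum_m q n m x = V * S); last first.
  rewrite SE mulr_sumr; apply: eq_bigr => n _; rewrite int_sum// (bigD1 n)//= big1 ?addr0.
    by rewrite iq eqxx mulr1; ring.
  by move=> m mn; rewrite iq eq_sym (negbTE mn) !mulr0.
rewrite (_ : \int[mu]_x (u x ^+ 2) = \int[mu]_x (u x * u x)); last by apply: eq_Rintegral => x _; rewrite expr2.
set J := Rintegral _ _ _.
have -> : V ^+ 2 * J + - 2 * V * S + V * S = V * (V * J - S) by ring.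
by rewrite pmulr_rge0// subr_ge0.
Qed.

Lemma dotpDr x xi eta : dotp x (xi + eta) = dotp x xi + dotp x eta.
Proof. by rewrite /dotp -big_split; apply: eq_bigr => i _; rewrite mxE mulrDr. Qed.

Lemma dotpNr x xi : dotp x (- xi) = - dotp x xi.
Proof. by rewrite /dotp -sumrN; apply: eq_bigr => i _; rewrite mxE mulrN. Qed.

Lemma dotpDl x y xi : dotp (x + y) xi = dotp x xi + dotp y xi.
Proof. by rewrite /dotp -big_split; apply: eq_bigr => i _; rewrite mxE mulrDl. Qed.

Lemma int_wave_eq0 (g : R -> R) (r : R) (eta : 'rV[R]_d) i (k : int) :
  0 < r -> (forall y, g (y + pi) = - g y) -> k != 0 -> eta 0 i = k%:~R / (2 * r) ->
  bmeas (fun x : T => g (2 * pi * dotp x eta)) ->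
  \int[mu]_x (g (2 * pi * dotp x eta) * \1_(cube r) x) = 0.
Proof.
move=> r0 gpi k0 etai bg.
have gNpi y : g (y - pi) = - g y by rewrite -[in RHS](subrK pi y) gpi opprK.
have kr0 : (k%:~R : R) != 0 by rewrite intr_eq0.
have rn0 : r != 0 by rewrite gt_eqF.
have nk1 : 1 <= `|k%:~R : R| by rewrite -intr_norm -[1]/(1%:~R) ler_int -gtz0_ge1 normr_gt0.
(* A shift by r / |k| in direction i moves the phase by pi or -pi, and |k| >= 1 keeps it within one
   period. *)
apply: (@int_antiperiodic _ r (r / `|k%:~R|) i) => //.
- apply/andP; split; first by rewrite divr_ge0// ltW.
  rewrite ler_pdivrMr ?(lt_le_trans ltr01)//.
  by rewrite (@le_trans _ _ (2 * r * 1))// ?ler_pM2l ?mulr1; lra.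
- move=> x; rewrite /translate dotp_translate etai -[RHS](antiperiodic_int gpi k).
  by congr g; rewrite mulrDr; congr (_ + _); field; rewrite rn0.
- move=> x; rewrite /translate dotp_translate etai mulrDr.
  have [kp|kn] := lerP 0 (k%:~R : R).
    rewrite ger0_norm// -gpi; congr g; congr (_ + _); field.
    by rewrite kr0 rn0.
  rewrite ltr0_norm// -gNpi; congr g; congr (_ + _); field.
  by rewrite kr0 rn0.
Qed.

(** The power spectrum |F^-1 u|^2. *)
Definition spec u xi : R := invF_re mu u xi ^+ 2 + invF_im mu u xi ^+ 2.

Definition grid (r : R) (N : nat) (n : {ffun 'I_d -> 'I_N}) : 'rV[R]_d :=
  \row_i ((n i)%:R / (2 * r)).

(** The spacing 1 / (2r) is the reciprocal of the side of the cube, which makes the characters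
    orthogonal there. Orthogonality sees only differences of frequencies, so the whole grid may be
    offset by any [theta]. *)
Lemma bessel_grid u r N (theta : 'rV[R]_d) : 0 < r -> bsupp u ->
  (forall x, u x != 0 -> cube r x) ->
  \sum_(n : {ffun 'I_d -> 'I_N}) spec u (theta + grid r n) <= (2 * r) ^+ d * \int[mu]_x (u x ^+ 2).
Proof.
move=> r0 bu ur; pose xi_ n := theta + @grid r N n.
have xiB n m i : (xi_ n - xi_ m) 0 i = ((n i)%:Z - (m i)%:Z)%:~R / (2 * r).
  by rewrite !mxE intrB -!pmulrn; ring.
apply: (@bessel_abstract _ u (fun n x => cos (2 * pi * dotp x (xi_ n)))
  (fun n x => sin (2 * pi * dotp x (xi_ n))) _ r) => //.
- by rewrite exprn_gt0//; lra.
- by move=> n; exact: bmeas_cos.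
- by move=> n; exact: bmeas_sin.
- move=> n m.
  have e (x : T) : cos (2 * pi * dotp x (xi_ n)) * cos (2 * pi * dotp x (xi_ m)) +
     sin (2 * pi * dotp x (xi_ n)) * sin (2 * pi * dotp x (xi_ m)) =
     cos (2 * pi * dotp x (xi_ n - xi_ m)).
    by rewrite dotpDr dotpNr mulrBr cosB.
  under eq_Rintegral do rewrite e.
  have [->|nm] := eqVneq n m.
    under eq_Rintegral => x _.
      rewrite subrr (_ : dotp x 0 = 0) ?mulr0 ?cos0 ?mul1r; last first.
        by rewrite /dotp big1// => i _; rewrite mxE mulr0.
      over.
    by rewrite (int_cube Hmu) ?mulr1// ltW.
  have /existsP[i ni] : [exists i, n i != m i].
    by apply: contraNT nm => /existsPn h; apply/eqP/ffunP => i; have /negPn/eqP := h i.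
  rewrite mulr0; apply: (@int_wave_eq0 cos r _ i ((n i)%:Z - (m i)%:Z)) => //.
  + by move=> y; rewrite cosDpi.
  + by rewrite subr_eq0; apply: contra ni => /eqP[] /val_inj ->.
  + exact: bmeas_cos.
- move=> n m.
  have e (x : T) : cos (2 * pi * dotp x (xi_ n)) * sin (2 * pi * dotp x (xi_ m)) -
     sin (2 * pi * dotp x (xi_ n)) * cos (2 * pi * dotp x (xi_ m)) =
     sin (2 * pi * dotp x (xi_ m - xi_ n)).
    by rewrite dotpDr dotpNr mulrBr sinB; ring.
  under eq_Rintegral do rewrite e.
  have [->|nm] := eqVneq n m.
    under eq_Rintegral => x _.
      rewrite subrr (_ : dotp x 0 = 0) ?mulr0 ?sin0 ?mul0r; last first.
        by rewrite /dotp big1// => i _; rewrite mxE mulr0.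
      over.
    by rewrite Rintegral_cst// mul0r.
  have /existsP[i ni] : [exists i, n i != m i].
    by apply: contraNT nm => /existsPn h; apply/eqP/ffunP => i; have /negPn/eqP := h i.
  apply: (@int_wave_eq0 sin r _ i ((m i)%:Z - (n i)%:Z)) => //.
  + by move=> y; rewrite sinDpi.
  + by rewrite subr_eq0 eq_sym; apply: contra ni => /eqP[] /val_inj ->.
  + exact: bmeas_sin.
Qed.

End Bessel.

Section BesselIntegral.
Context {R : realType} {d : nat}.
Local Notation T := (Rd R d).
Implicit Types (v x xi : 'rV[R]_d) (f g u : T -> R).
Variable mu : {measure set T -> \bar R}.
Hypothesis Hmu : is_lebesgue_measure mu.

(** Tonelli applied to the positive and negative parts separately, since no integrability of [h] is
    assumed; [mu] is first repackaged as a sigma-finite measure. *)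
Lemma measurable_Rintegral_param (h : T * T -> R) : measurable_fun setT h ->
  measurable_fun setT (fun xi : T => \int[mu]_x h (xi, x)).
Proof.
move=> mh.
have sf := mu_sigma_finite Hmu.
pose H2 := isSFinite.Build _ _ _ _ (sfinite_measure_sigma_finite sf).
pose H3 := isSigmaFinite.Build _ _ _ _ sf.
pose smu : {sigma_finite_measure set T -> \bar R} :=
  HB.pack_for {sigma_finite_measure set T -> \bar R} (Measure.sort mu) H2 H3.
have mE : measurable_fun setT (EFin \o h) by exact/measurable_EFinP.
have mp := @measurable_fun_fubini_tonelli_F _ _ T T R smu _ (measurable_funepos mE) (funepos_ge0 _).
have mn := @measurable_fun_fubini_tonelli_F _ _ T T R smu _ (measurable_funeneg mE) (funeneg_ge0 _).
have := emeasurable_funB mp mn.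
have mf : measurable_fun setT (@fine R) by [].
move=> /(measurableT_comp mf).
congr (measurable_fun setT _); apply/funext => xi /=.
rewrite /Rintegral [in RHS]integralE /fubini_F; congr (fine (_ - _)%E).
  by apply: eq_integral => x _; rewrite !funeposE.
by apply: eq_integral => x _; rewrite !funenegE.
Qed.

Lemma measurable_dotp2 : measurable_fun setT (fun z : T * T => dotp (z.2 : 'rV[R]_d) z.1).
Proof.
apply: measurable_sum => i; apply: measurable_funM.
  by apply: (measurableT_comp (measurable_coord i)); exact: measurable_snd.
by apply: (measurableT_comp (measurable_coord i)); exact: measurable_fst.
Qed.

Lemma measurable_invF_re u : measurable_fun setT u -> measurable_fun setT (invF_re mu u).
Proof.
move=> mu'; apply: (@measurable_Rintegral_param (fun z => u z.2 * cos (2 * pi * dotp z.2 z.1))).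
apply: measurable_funM; first by apply: (measurableT_comp mu'); exact: measurable_snd.
apply: (measurableT_comp measurable_cosr); apply: measurable_funM => //.
exact: measurable_dotp2.
Qed.

Lemma measurable_invF_im u : measurable_fun setT u -> measurable_fun setT (invF_im mu u).
Proof.
move=> mu'; apply: (@measurable_Rintegral_param (fun z => u z.2 * sin (2 * pi * dotp z.2 z.1))).
apply: measurable_funM; first by apply: (measurableT_comp mu'); exact: measurable_snd.
apply: (measurableT_comp measurable_sinr); apply: measurable_funM => //.
exact: measurable_dotp2.
Qed.

Lemma measurable_spec u : measurable_fun setT u -> measurable_fun setT (spec mu u : T -> R).
Proof.
by move=> mu'; apply: measurable_funD; apply: measurable_funX;
  [exact: measurable_invF_re|exact: measurable_invF_im].
Qed.

Lemma spec_ge0 u xi : 0 <= spec mu u xi.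
Proof. by rewrite addr_ge0 ?sqr_ge0. Qed.

(* Averaging [bessel_grid] over the offsets theta in one cell of the frequency grid turns the sum over
   grid points into the integral; this replaces Plancherel's theorem. *)
Lemma bessel_int u rho : bsupp u ->
  (\int[mu]_(xi in cube rho) (spec mu u xi)%:E <= (\int[mu]_x (u x ^+ 2))%:E)%E.
Proof.
move=> bu; have [[mu' _] [r0 hr0]] := bu.
pose r := Num.max r0 1.
have r_gt0 : 0 < r by rewrite lt_max ltr01 orbT.
have hr x : u x != 0 -> cube r x by move=> /hr0; apply: cubeS; rewrite le_max lexx.
pose a : R := (2 * r)^-1; have a0 : 0 < a by rewrite invr_gt0; lra.
(* N cells of side [a] per axis suffice to cover an interval of length 2 rho; [theta] below centres
   the block of cells at 0. *)
pose N := (Num.truncn (2 * rho / a)).+1.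
have Nrho : 2 * rho <= N%:R * a.
  by rewrite -ler_pdivrMr// ltW// truncnS_gt.
pose theta : 'rV[R]_d := \row_i (- (N%:R * a / 2)).
pose D : set T := box (\row_i (0 : R)) (\row_i a).
have mD : measurable D by exact: measurable_box.
pose c (n : {ffun 'I_d -> 'I_N}) := theta + grid r n.
have cover (xi : T) : cube rho xi -> exists n, D (translate (- c n) xi).
  move=> /cubeP h.
  have bnd i : 0 <= ((xi : 'rV[R]_d) 0 i + N%:R * a / 2) / a < N%:R.
    have /andP[h1 h2] := h i; rewrite divr_ge0 ?(ltW a0)//; last by lra.
    by rewrite ltr_pdivrMr//=; lra.
  pose z i : R := ((xi : 'rV[R]_d) 0 i + N%:R * a / 2) / a.
  have lt i : (Num.truncn (z i) < N)%N.
    by have /andP[h1 h2] := bnd i; rewrite truncn_lt_nat.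
  exists [ffun i => Ordinal (lt i)] => i.
  rewrite /translate !mxE ffunE /=.
  have /andP[h1 h2] := bnd i.
  have /andP[] := truncn_itv h1; set m := Num.truncn _ => m1 m2.
  rewrite -/a; move: m1 m2; rewrite ler_pdivlMr// ltr_pdivrMr// => m1 m2.
  by move: m2; rewrite -[m.+1%:R]natr1 => m2; apply/andP; split; lra.
have mspec := measurable_spec mu'.
have mspecE : measurable_fun setT (fun xi : T => (spec mu u xi)%:E) by exact/measurable_EFinP.
have sE0 (xi : T) : (0 <= (spec mu u xi)%:E)%E by rewrite lee_fin spec_ge0.
pose F n (xi : T) := (spec mu u xi * \1_D (translate (- c n) xi))%:E.
have mF n : measurable_fun setT (F n).
  apply/measurable_EFinP; apply: measurable_funM => //.
  by apply: measurableT_comp; [exact: measurable_indic|exact: measurable_translate].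
have F0 n xi : (0 <= F n xi)%E by rewrite lee_fin mulr_ge0 ?spec_ge0// indicE.
pose G n (eta : T) := (spec mu u (eta + c n : 'rV[R]_d) * \1_D eta)%:E.
have FG n (eta : T) : G n eta = F n (translate (c n) eta).
  rewrite /F /G; congr (_ * _)%:E; congr (\1_D _).
  by rewrite /translate addrK.
have mG n : measurable_fun setT (G n).
  rewrite (_ : G n = F n \o translate (c n)); last by apply/funext => eta; exact: FG.
  by apply: measurableT_comp => //; exact: measurable_translate.
have G0 n xi : (0 <= G n xi)%E by rewrite FG.
have mc : measurable (cube rho : set T) by exact: measurable_cube.
rewrite integral_mkcond.
apply: (@le_trans _ _ (\int[mu]_xi (\sum_n F n xi))%E).
  apply: ge0_le_integral => //.
  - by move=> x _; apply: erestrict_ge0.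
  - by apply/(measurable_restrictT _ mc); exact: measurable_funTS.
  - by apply: emeasurable_sum.
  - move=> xi _; rewrite patchE; case: ifPn => [|_]; last by apply: sume_ge0.
    rewrite inE => /cover[n Dn]; rewrite (bigD1 n)//= {1}/F indic1// mulr1.
    by rewrite leeDl//; apply: sume_ge0.
rewrite ge0_integral_sum//.
rewrite (eq_bigr (fun n => \int[mu]_x G n x)%E); last first.
  move=> n _; rewrite -(@ge0_integral_translate _ _ _ Hmu (c n) (F n))//.
  by apply: eq_integral => x _; rewrite FG.
rewrite -ge0_integral_sum//.
pose J := \int[mu]_x (u x ^+ 2).
apply: (@le_trans _ _ (\int[mu]_xi (((2 * r) ^+ d * J)%:E * (\1_D xi)%:E))%E).
  apply: ge0_le_integral => //.
  - by move=> x _; apply: sume_ge0.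
  - by apply: emeasurable_sum.
  - apply: emeasurable_funM => //; apply/measurable_EFinP; exact: measurable_indic.
  - move=> eta _; have [h|h] := pselect (D eta); last first.
      rewrite indic0// mule0 big1// => n _; by rewrite /G indic0// mulr0.
    rewrite indic1// mule1 (eq_bigr (fun n => (spec mu u (eta + c n : 'rV[R]_d))%:E)).
      rewrite sumEFin lee_fin.
      apply: le_trans (bessel_grid Hmu N (eta + theta : 'rV[R]_d) r_gt0 bu hr).
      by rewrite le_eqVlt; apply/orP; left; apply/eqP; apply: eq_bigr => n _; rewrite addrA.
    by move=> n _; rewrite /G indic1// mulr1.
rewrite ge0_integralZl//; last 2 first.
- by apply/measurable_EFinP; exact: measurable_indic.
- by rewrite lee_fin mulr_ge0 ?exprn_ge0//; [lra|apply: Rintegral_ge0 => x _; rewrite sqr_ge0].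
rewrite integral_indic// setIT Hmu; last by move=> i; rewrite !mxE ltW.
(* The cell volume a^d cancels (2r)^d exactly, so the auxiliary radius r disappears from the
   bound. *)
rewrite -EFinM lee_fin (eq_bigr (fun=> a)); last by move=> i _; rewrite !mxE subr0.
rewrite prodr_const card_ord mulrAC -exprMn /a mulfV ?expr1n ?mul1r//.
by rewrite gt_eqF//; lra.
Qed.

End BesselIntegral.

(** * Fourier uniqueness for integrable functions *)

Section SignIteration.
Context {R : realType}.

(* Its iterates converge on [-1, 1] to the sign function, which is thus a pointwise limit of polynomials. *)
Definition sgstep (y : R) : R := (3 * y - y ^+ 3) / 2.

Lemma sgstep_bound y : `|y| <= 1 -> `|sgstep y| <= 1.
Proof.
rewrite !ler_norml /sgstep => /andP[h1 h2].
have e1 : 1 - (3 * y - y ^+ 3) / 2 = (1 - y) ^+ 2 * (2 + y) / 2 by field.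
have e2 : 1 + (3 * y - y ^+ 3) / 2 = (1 + y) ^+ 2 * (2 - y) / 2 by field.
have p1 : 0 <= (1 - y) ^+ 2 * (2 + y) / 2.
  by rewrite divr_ge0// mulr_ge0 ?sqr_ge0//; lra.
have p2 : 0 <= (1 + y) ^+ 2 * (2 - y) / 2.
  by rewrite divr_ge0// mulr_ge0 ?sqr_ge0//; lra.
by apply/andP; split; lra.
Qed.

Lemma iter_sgstep_bound n y : `|y| <= 1 -> `|iter n sgstep y| <= 1.
Proof. by move=> y1; elim: n => //= n; exact: sgstep_bound. Qed.

Lemma iter_sgstep0 n : iter n sgstep 0 = 0.
Proof. by elim: n => //= n ->; rewrite /sgstep mulr0 expr0n subrr mul0r. Qed.

Lemma iter_sgstepN n y : iter n sgstep (- y) = - iter n sgstep y.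
Proof. by elim: n => //= n ->; rewrite /sgstep; field. Qed.

(** On (0, 1] the iterates increase, and one step multiplies the distance to 1 by (2 - z - z^2) / 2
    <= 1 - z / 2, which is at most 1 - y / 2 because z >= y. *)
Lemma iter_sgstep_gt0 n y : 0 < y <= 1 ->
  y <= iter n sgstep y <= 1 /\ 1 - iter n sgstep y <= (1 - y / 2) ^+ n.
Proof.
move=> /andP[y0 y1]; elim: n => [|n [/andP[h1 h2] h3]] /=.
  by rewrite lexx y1 expr0; split => //; lra.
set z := iter n sgstep y in h1 h2 h3 *.
have z0 : 0 < z by apply: lt_le_trans h1.
have zz : z <= sgstep z.
  rewrite -subr_ge0 (_ : _ - _ = z * (1 - z) * (1 + z) / 2); last by rewrite /sgstep; field.
  by rewrite divr_ge0// !mulr_ge0//; lra.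
have z1 : `|sgstep z| <= 1 by apply: sgstep_bound; rewrite ler_norml h2 andbT; lra.
split; first by rewrite (le_trans h1 zz)/=; move: z1; rewrite ler_norml => /andP[].
rewrite exprSr (_ : 1 - sgstep z = (1 - z) * ((2 - z - z ^+ 2) / 2)); last by rewrite /sgstep; field.
apply: ler_pM => //; first by lra.
  rewrite (_ : 2 - z - z ^+ 2 = (1 - z) * (2 + z)); last by ring.
  by rewrite divr_ge0// mulr_ge0//; lra.
have : 0 <= z ^+ 2 by rewrite sqr_ge0.
lra.
Qed.

Lemma iter_sgstep_cvg y : `|y| <= 1 -> iter n sgstep y @[n --> \oo] --> Num.sg y.
Proof.
have pos z : 0 < z <= 1 -> iter n sgstep z @[n --> \oo] --> (1 : R).
  move=> z01; apply: (@squeeze_cvgr _ _ _ _ (fun n => 1 - (1 - z / 2) ^+ n) (fun=> 1)).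
  - near=> n; have [/andP[_ h2] h3] := iter_sgstep_gt0 n z01.
    by rewrite h2 andbT; lra.
  - rewrite -[X in _ --> X]subr0; apply: cvgB; first exact: cvg_cst.
    have := @cvg_geometric R 1 (1 - z / 2).
    rewrite /geometric /=; under eq_fun do rewrite mul1r; apply.
    by move: z01 => /andP[? ?]; rewrite ltr_norml; lra.
  - exact: cvg_cst.
move=> y1; have [y0|y0|y0] := ltgtP 0 y.
- rewrite gtr0_sg//; apply: pos; rewrite y0/=.
  by move: y1; rewrite ler_norml => /andP[].
- rewrite ltr0_sg//; have := @pos (- y); under eq_fun do rewrite iter_sgstepN.
  move=> h; have : - (- iter n sgstep y) @[n --> \oo] --> (- 1 : R).
    by apply: cvgN; apply: h; move: y1; rewrite ler_norml => /andP[]; lra.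
  by under eq_fun do rewrite opprK.
- by rewrite -y0 sgr0; under eq_fun do rewrite iter_sgstep0; exact: cvg_cst.
Unshelve. all: by end_near. Qed.

End SignIteration.

Section FourierUniqueness.
Context {R : realType} {d : nat}.
Local Notation T := (Rd R d).
Implicit Types (b : 'rV[R]_d) (f w : T -> R).
Variable mu : {measure set T -> \bar R}.
Variable h : T -> R.
Hypothesis hint : mu.-integrable setT (EFin \o h).

Lemma integrable_mul_bmeas f : bmeas f -> mu.-integrable setT (EFin \o (fun x => h x * f x)).
Proof.
move=> bf; have [M M0 hM] := bmeas_bound bf.
have mh : measurable_fun setT h by have /integrableP[/measurable_EFinP] := hint.
apply: (@le_integrable _ _ _ mu setT measurableT _ (fun x => M%:E * (EFin \o h) x)%E).
- by apply/measurable_EFinP; apply: measurable_funM => //; case: bf.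
- move=> x _ /=; rewrite lee_fin !normrM (ger0_norm (ltW M0)) mulrC.
  exact: ler_wpM2r.
- exact: integrableZl.
Qed.

Definition annihilated f := bmeas f /\ forall b,
  \int[mu]_x (h x * (f x * cos (2 * pi * dotp x b))) = 0 /\
  \int[mu]_x (h x * (f x * sin (2 * pi * dotp x b))) = 0.

(* Multipliers form an algebra closed under bounded limits and containing the characters. It therefore contains
   the sign of [sin (2 pi (x_i - a) / L)], hence (L -> oo) indicators of half-spaces, hence of all measurable sets. *)
Definition multiplier w := bmeas w /\ forall f, annihilated f -> annihilated (fun x => w x * f x).

Lemma multiplier_cst c : multiplier (cst c).
Proof.
split; first exact: bmeas_cst.
move=> f [bf nf]; split; first by apply: bmeasM => //; exact: bmeas_cst.
move=> b; have [n1 n2] := nf b.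
split.
  under eq_Rintegral do rewrite -mulrA mulrCA.
  by rewrite RintegralZl ?n1 ?mulr0//; apply: integrable_mul_bmeas; apply: bmeasM => //; exact: bmeas_cos.
under eq_Rintegral do rewrite -mulrA mulrCA.
by rewrite RintegralZl ?n2 ?mulr0//; apply: integrable_mul_bmeas; apply: bmeasM => //; exact: bmeas_sin.
Qed.

Lemma multiplierM w w' : multiplier w -> multiplier w' -> multiplier (fun x => w x * w' x).
Proof.
move=> [bw gw] [bw' gw']; split; first exact: bmeasM.
by move=> f nf; under eq_fun do rewrite -mulrA; apply: gw; exact: gw'.
Qed.

Lemma annihilatedD f f' : annihilated f -> annihilated f' -> annihilated (fun x => f x + f' x).
Proof.
move=> [bf nf] [bf' nf']; split; first exact: bmeasD.
move=> b; have [n1 n2] := nf b; have [n1' n2'] := nf' b; split.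
  under eq_Rintegral do rewrite mulrDl mulrDr.
  rewrite RintegralD ?n1 ?n1' ?addr0//; apply: integrable_mul_bmeas; apply: bmeasM => //; exact: bmeas_cos.
under eq_Rintegral do rewrite mulrDl mulrDr.
rewrite RintegralD ?n2 ?n2' ?addr0//; apply: integrable_mul_bmeas; apply: bmeasM => //; exact: bmeas_sin.
Qed.

Lemma multiplierD w w' : multiplier w -> multiplier w' -> multiplier (fun x => w x + w' x).
Proof.
move=> [bw gw] [bw' gw']; split; first exact: bmeasD.
by move=> f nf; under eq_fun do rewrite mulrDl; apply: annihilatedD; [exact: gw|exact: gw'].
Qed.

Lemma multiplierZ c w : multiplier w -> multiplier (fun x => c * w x).
Proof. by move=> gw; apply: multiplierM => //; exact: multiplier_cst. Qed.

Lemma multiplierB w w' : multiplier w -> multiplier w' -> multiplier (fun x => w x - w' x).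
Proof.
move=> gw gw'; under eq_fun do rewrite -[X in _ + X]mulN1r.
by apply: multiplierD => //; exact: multiplierZ.
Qed.

Lemma multiplier_prod (I : Type) (s : seq I) (w : I -> T -> R) :
  (forall i, multiplier (w i)) -> multiplier (fun x => \prod_(i <- s) w i x).
Proof.
move=> gw; elim: s => [|i s ih]; first by under eq_fun do rewrite big_nil; exact: multiplier_cst.
by under eq_fun do rewrite big_cons; exact: multiplierM.
Qed.

(** Product-to-sum formulas reduce a product of two characters to the frequencies c + b and c - b,
    at which the integrals already vanish. *)
Lemma multiplier_wave c : multiplier (fun x => cos (2 * pi * dotp x c)) /\ multiplier (fun x => sin (2 * pi * dotp x c)).
Proof.
have key f : annihilated f -> forall b,
    \int[mu]_x (h x * (f x * (cos (2 * pi * dotp x c) * cos (2 * pi * dotp x b)))) = 0 /\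
    \int[mu]_x (h x * (f x * (cos (2 * pi * dotp x c) * sin (2 * pi * dotp x b)))) = 0 /\
    \int[mu]_x (h x * (f x * (sin (2 * pi * dotp x c) * cos (2 * pi * dotp x b)))) = 0 /\
    \int[mu]_x (h x * (f x * (sin (2 * pi * dotp x c) * sin (2 * pi * dotp x b)))) = 0.
  move=> [bf nf] b; have [p1 p2] := nf (c + b); have [m1 m2] := nf (c - b).
  have ic e : mu.-integrable setT (EFin \o (fun x => h x * (f x * cos (2 * pi * dotp x e)))).
    by apply: integrable_mul_bmeas; apply: bmeasM => //; exact: bmeas_cos.
  have ise e : mu.-integrable setT (EFin \o (fun x => h x * (f x * sin (2 * pi * dotp x e)))).
    by apply: integrable_mul_bmeas; apply: bmeasM => //; exact: bmeas_sin.
  have comb u1 u2 k : mu.-integrable setT (EFin \o u1) -> mu.-integrable setT (EFin \o u2) ->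
     \int[mu]_x u1 x = 0 -> \int[mu]_x u2 x = 0 -> \int[mu]_x (2^-1 * (u1 x + k * u2 x)) = 0.
    move=> i1 i2 e1 e2.
    have ik : mu.-integrable setT (EFin \o (fun x => k * u2 x)) by apply: (integrableZl measurableT k i2).
    rewrite RintegralZl//; last by apply: (integrableD measurableT i1 ik).
    by rewrite RintegralD// RintegralZl// e1 e2 mulr0 addr0 mulr0.
  split; [|split; [|split]].
  - rewrite -(comb _ _ 1 (ic (c + b)) (ic (c - b)) p1 m1); apply: eq_Rintegral => x _.
    by rewrite !dotpDr dotpNr !mulrDr mulrN cosB cosD; field.
  - rewrite -(comb _ _ (-1) (ise (c + b)) (ise (c - b)) p2 m2); apply: eq_Rintegral => x _.
    by rewrite !dotpDr dotpNr !mulrDr mulrN sinB sinD; field.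
  - rewrite -(comb _ _ 1 (ise (c + b)) (ise (c - b)) p2 m2); apply: eq_Rintegral => x _.
    by rewrite !dotpDr dotpNr !mulrDr mulrN sinB sinD; field.
  - rewrite -(comb _ _ (-1) (ic (c - b)) (ic (c + b)) m1 p1); apply: eq_Rintegral => x _.
    by rewrite !dotpDr dotpNr !mulrDr mulrN cosB cosD; field.
split; (split; [by [exact: bmeas_cos|exact: bmeas_sin]|]) => f nf;
  (split; [by apply: bmeasM; [by [exact: bmeas_cos|exact: bmeas_sin]|by case: nf]|]) => b;
  have [k1 [k2 [k3 k4]]] := key f nf b.
  by split; [rewrite -[RHS]k1|rewrite -[RHS]k2]; apply: eq_Rintegral => x _; congr (_ * _); rewrite mulrA; congr (_ * _); rewrite mulrC.
by split; [rewrite -[RHS]k3|rewrite -[RHS]k4]; apply: eq_Rintegral => x _; congr (_ * _); rewrite mulrA; congr (_ * _); rewrite mulrC.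
Qed.

(** Dominated convergence with majorant M |h f e|, where e is the tested cosine or sine. *)
Lemma multiplier_lim (w_ : nat -> T -> R) w (M : R) : (forall n, multiplier (w_ n)) ->
  (forall n x, `|w_ n x| <= M) -> (forall x, w_ n x @[n --> \oo] --> w x) -> multiplier w.
Proof.
move=> gw wM wcvg.
have mw : measurable_fun setT w.
  apply: (@measurable_fun_cvg _ _ _ setT w_) => //.
  by move=> n; case: (gw n) => -[].
have wM' x : `|w x| <= M.
  apply: (cvgr_to_le (cvg_norm (wcvg x))).
  by near=> n; exact: wM.
have bw : bmeas w by split => //; exists M.
split => // f nf; have bf : bmeas f by case: nf.
split; first exact: bmeasM.
have lim0 (e : T -> R) : bmeas e ->
    (forall n, \int[mu]_x (h x * (w_ n x * f x * e x)) = 0) ->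
    \int[mu]_x (h x * (w x * f x * e x)) = 0.
  move=> be en0.
  have ben n : bmeas (fun x => w_ n x * f x * e x).
    by apply: bmeasM => //; apply: bmeasM => //; case: (gw n).
  have ie := integrable_mul_bmeas (bmeasM bf be).
  have := @dominated_convergence _ _ _ mu setT measurableT
    (fun n x => (h x * (w_ n x * f x * e x))%:E) (fun x => (h x * (w x * f x * e x))%:E)
    (fun x => M%:E * `|(h x * (f x * e x))%:E|)%E.
  case.
  - by move=> n; have /integrableP[] := integrable_mul_bmeas (ben n).
  - have bb : bmeas (fun x => w x * f x * e x) by apply: bmeasM => //; exact: bmeasM.
    by have /integrableP[] := integrable_mul_bmeas bb.
  - apply: aeW => x _; apply: cvg_EFin; first by near=> n.
    apply: cvgMr; rewrite /=; apply: cvgMl; apply: cvgMl; exact: wcvg.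
  - by apply: integrableZl => //; apply: integrable_abse.
  - apply: aeW => x n _ /=; rewrite lee_fin !normrM.
    rewrite mulrCA -!mulrA ler_pM// ?wM// mulrCA//.
  have e0n n : (\int[mu]_x (h x * (w_ n x * f x * e x))%:E)%E = 0%E.
    have := en0 n; rewrite /Rintegral => en.
    by rewrite -[LHS]fineK ?en//; apply: integrable_fin_num => //; exact: integrable_mul_bmeas.
  move=> _ _ /=; under eq_fun do rewrite e0n.
  move=> c0; have c1 : cst 0%E n @[n --> \oo] --> (0%E : \bar R) by exact: cvg_cst.
  by rewrite /Rintegral (cvg_unique _ c0 c1).
move=> b; split; apply: lim0.
- exact: bmeas_cos.
- by move=> n; case: (gw n) => _ /(_ _ nf) [_ /(_ b)[]].
- exact: bmeas_sin.
- by move=> n; case: (gw n) => _ /(_ _ nf) [_ /(_ b)[]].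
Unshelve. all: by end_near. Qed.

Lemma multiplier_iter_sgstep n w : multiplier w -> multiplier (fun x => iter n sgstep (w x)).
Proof.
move=> gw; elim: n => //= n ih; rewrite /sgstep.
under eq_fun do rewrite mulrC !exprS expr0 mulr1; apply: multiplierZ; apply: multiplierB; first exact: multiplierZ.
by apply: multiplierM => //; exact: multiplierM.
Qed.

Lemma multiplier_sg w : multiplier w -> (forall x, `|w x| <= 1) -> multiplier (fun x => Num.sg (w x)).
Proof.
move=> gw w1; apply: (@multiplier_lim (fun n x => iter n sgstep (w x)) _ 1).
- by move=> n; exact: multiplier_iter_sgstep.
- by move=> n x; exact: iter_sgstep_bound.
- by move=> x; exact: iter_sgstep_cvg.
Qed.

Lemma sg_sin_small (y : R) : `|y| < pi -> Num.sg (sin y) = Num.sg y.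
Proof.
rewrite ltr_norml => /andP[y1 y2]; have [y0|y0|<-] := ltgtP 0 y.
- by rewrite !gtr0_sg// sin_gt0_pi// y0.
- rewrite !ltr0_sg// -oppr_gt0 -sinN sin_gt0_pi// oppr_gt0 y0/=; lra.
- by rewrite sin0.
Qed.

Lemma multiplier_sg_coord i a : multiplier (fun x : T => Num.sg ((x : 'rV[R]_d) 0 i - a)).
Proof.
pose c n : 'rV[R]_d := n.+1%:R^-1 *: unit_vec R i.
have dc (x : T) n : 2 * pi * dotp x (c n) = 2 * pi * (n.+1%:R^-1 * (x : 'rV[R]_d) 0 i).
  congr (_ * _); rewrite /dotp (bigD1 i)//= big1 ?addr0; last first.
    by move=> j ji; rewrite !mxE (negbTE ji) andbF !mulr0.
  by rewrite !mxE !eqxx mulr1 mulrC.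
pose s n (x : T) := sin (2 * pi * (n.+1%:R^-1 * ((x : 'rV[R]_d) 0 i - a))).
have gs n : multiplier (s n).
  have [g1 g2] := multiplier_wave (c n).
  rewrite (_ : s n = fun x : T => cos (2 * pi * (n.+1%:R^-1 * a)) * sin (2 * pi * dotp x (c n))
     - sin (2 * pi * (n.+1%:R^-1 * a)) * cos (2 * pi * dotp x (c n))).
    by apply: multiplierB; exact: multiplierZ.
  by apply/funext => x; rewrite /s !dc !mulrBr sinB; ring.
apply: (@multiplier_lim (fun n x => Num.sg (s n x)) _ 1).
- by move=> n; apply: multiplier_sg => // x; exact: sin_max.
- by move=> n x; rewrite normr_sg; case: (_ != 0).
- move=> x; apply: cvg_near_cst; set y := _ - a.
  (* Once n + 1 > 2 |y|, the argument of the sine lies in (-pi, pi), where the sine has the sign of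
     its argument; the sequence is constant from there on. *)
  exists (Num.truncn (2 * `|y|)) => // n /= hn.
  rewrite /s -/y sg_sin_small.
    by rewrite mulrA sgrM gtr0_sg ?mul1r// mulr_gt0// ?invr_gt0// mulr_gt0// pi_gt0.
  rewrite normrM ger0_norm; last by rewrite mulr_ge0// pi_ge0.
  rewrite normrM ger0_norm; last by rewrite invr_ge0.
  rewrite (_ : 2 * pi * _ = pi * (2 * `|y| / n.+1%:R)); last by ring.
  rewrite gtr_pMr ?pi_gt0// ltr_pdivrMr// mul1r (lt_le_trans (truncnS_gt _))//.
  by rewrite ler_nat.
Qed.

Lemma multiplier_lowhalf i a : multiplier (\1_(lowhalf i a) : T -> R).
Proof.
(* For a sign sigma, (sigma^2 - sigma) / 2 is 1 at -1 and 0 at 0 and 1, so the strict half-space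
   comes out exactly. *)
rewrite (_ : \1_ _ = fun x : T => 2^-1 * (Num.sg ((x : 'rV[R]_d) 0 i - a) * Num.sg ((x : 'rV[R]_d) 0 i - a)
   - Num.sg ((x : 'rV[R]_d) 0 i - a))).
  by apply: multiplierZ; apply: multiplierB; [apply: multiplierM|]; exact: multiplier_sg_coord.
apply/funext => x.
have [xa|xa|xa] := ltgtP ((x : 'rV[R]_d) 0 i) a.
- rewrite indic1; last by rewrite /lowhalf.
  by rewrite ltr0_sg ?subr_lt0//; field.
- rewrite indic0; last by rewrite /lowhalf/= ltNge (ltW xa).
  by rewrite gtr0_sg ?subr_gt0//; field.
- rewrite indic0; last by rewrite /lowhalf/= xa ltxx.
  by rewrite xa subrr sgr0; field.
Qed.

(** Sets whose indicator is a multiplier form a sigma-algebra: complements by linearity, countable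
    unions as bounded limits of one minus a product. Boxes are finite intersections of half-spaces
    and their complements. *)
Lemma multiplier_measurable (A : set T) : measurable A -> multiplier (\1_A : T -> R).
Proof.
pose G := [set A : set T | multiplier (\1_A : T -> R)].
suff : measurable `<=` G by apply.
apply: smallest_sub.
  split.
  - rewrite /G /= (_ : \1_ _ = cst 0 :> (T -> R)); first exact: multiplier_cst.
    by apply/funext => x; rewrite indic0.
  - move=> B gB; rewrite /G /= (_ : \1_ _ = fun x => 1 - \1_B x :> R).
      by apply: multiplierB => //; exact: multiplier_cst.
    apply/funext => x; have [Bx|Bx] := pselect (B x).
      by rewrite indic0 ?indic1 ?subrr// => -[].
    by rewrite indic1 ?indic0 ?subr0.
  - move=> B gB; rewrite /G /=.
    apply: (@multiplier_lim (fun n x => 1 - \prod_(k < n) (1 - \1_(B k) x)) _ 1).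
    + by move=> n; apply: multiplierB; [exact: multiplier_cst|apply: multiplier_prod => k; apply: multiplierB; [exact: multiplier_cst|exact: gB]].
    + move=> n x; set p := \prod_(_ < _) _.
      have /andP[p0 p1] : 0 <= p <= 1.
        have h01 k : 0 <= (1 - \1_(B k) x : R) <= 1.
          by rewrite indicE; case: (_ \in _); rewrite ?subrr ?subr0 ?lexx ?ler01.
        rewrite /p prodr_ge0 /=; last by move=> k _; case/andP: (h01 k).
        by apply: prodr_ile1 => k _; exact: h01.
      by rewrite ger0_norm; lra.
    + move=> x; apply: cvg_near_cst.
      have [[k _ Bk]|nB] := pselect ((\bigcup_k B k) x).
        exists k.+1 => // n /= kn; rewrite indic1; last by exists k.
        by rewrite (bigD1 (Ordinal kn))//= indic1// subrr mul0r subr0.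
      exists 0 => // n _ /=; rewrite indic0// big1 ?subrr// => k _.
      by rewrite indic0 ?subr0// => Bk; apply: nB; exists k.
move=> _ [a [b ->]]; rewrite /G /=.
rewrite (_ : \1_ _ = fun x : T => \prod_(i < d) (\1_(lowhalf i (b 0 i)) x * (1 - \1_(lowhalf i (a 0 i)) x))).
  apply: multiplier_prod => i; apply: multiplierM; first exact: multiplier_lowhalf.
  by apply: multiplierB; [exact: multiplier_cst|exact: multiplier_lowhalf].
apply/funext => x; have [bx|/existsNP[i bi]] := pselect (box a b x).
  rewrite indic1// big1// => i _; have /andP[h1 h2] := bx i.
  rewrite indic1; last by rewrite /lowhalf.
  by rewrite indic0 ?subr0 ?mulr1// /lowhalf /= ltNge h1.
rewrite indic0; last by move=> /(_ i).
rewrite (bigD1 i)//=; have [h1|h1] := ltP ((x : 'rV[R]_d) 0 i) (a 0 i).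
  by rewrite (indic1 (A := lowhalf i (a 0 i)))// subrr mulr0 mul0r.
rewrite indic0 ?mul0r// /lowhalf /= => h2; apply: bi.
by rewrite h1 h2.
Qed.

(** The constant 1 is annihilated, hence so is every indicator; frequency 0 then says that h
    integrates to zero over every measurable set. *)
Lemma fourier_unique : (forall b, \int[mu]_x (h x * cos (2 * pi * dotp x b)) = 0 /\
    \int[mu]_x (h x * sin (2 * pi * dotp x b)) = 0) ->
  {ae mu, forall x, h x = 0}.
Proof.
move=> h0.
have n1 : annihilated (cst 1).
  split; first exact: bmeas_cst.
  by move=> b; have [e1 e2] := h0 b; split; [rewrite -[RHS]e1|rewrite -[RHS]e2];
    apply: eq_Rintegral => x _; rewrite /= mul1r.
have : ae_eq mu setT (EFin \o h) (cst 0%E).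
  apply: integral_ae_eq => // E _ mE; rewrite integral0.
  have [_ /(_ _ n1)[_ /(_ 0)[+ _]]] := multiplier_measurable mE.
  have -> : \int[mu]_x (h x * (\1_E x * cst 1 x * cos (2 * pi * dotp x 0))) =
            \int[mu]_(x in E) h x.
    rewrite [RHS]Rintegral_mkcond; apply: eq_Rintegral => x _.
    rewrite (_ : dotp x 0 = 0) ?mulr0 ?cos0 /cst ?mulr1; last first.
      by rewrite /dotp big1// => i _; rewrite mxE mulr0.
    by rewrite patchE indicE; case: ifP => _; rewrite ?mulr1 ?mulr0.
  rewrite /Rintegral => e0; rewrite -[LHS]fineK ?e0//.
  apply: integrable_fin_num => //; exact: integrableS hint.
by apply: filterS => x /(_ I) /= [].
Qed.

End FourierUniqueness.

(** * Smooth bumps *)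

Section DifferentiabilityClasses.
Context {R : realType} {V : normedModType R} {I : Type}.
Variable e : I -> V.
Implicit Types (f g : V -> R).

(** Derivatives are taken only along the directions [e i]: one notion then serves both the line (a
    single direction) and R^d (coordinate directions), and iterated coordinate derivatives are all
    that [smooth] asks for. *)
Fixpoint Ck (n : nat) f : Prop :=
  continuous f /\ if n is n'.+1 then
    forall i, (forall x, derivable f x (e i)) /\ Ck n' (fun x => 'D_(e i) f x)
  else True.

Lemma Ck_continuous n f : Ck n f -> continuous f.
Proof. by case: n => [|n] []. Qed.

Lemma Ck_derivable n f i x : Ck n.+1 f -> derivable f x (e i).
Proof. by move=> [_ /(_ i)[]]. Qed.

Lemma Ck_derive n f i : Ck n.+1 f -> Ck n (fun x => 'D_(e i) f x).
Proof. by move=> [_ /(_ i)[]]. Qed.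

Lemma CkW n f : Ck n.+1 f -> Ck n f.
Proof.
elim: n f => [|n ih] f; first by case.
by move=> [cf df]; split => // i; have [d1 d2] := df i; split => //; exact: ih.
Qed.

Lemma Ck_cst n c : Ck n (fun=> c).
Proof.
elim: n c => [|n ih] c; first by split => // x; exact: cvg_cst.
split; first by move=> x; exact: cvg_cst.
move=> i; split; first by move=> x; exact: derivable_cst.
by under eq_fun do rewrite derive_cst; exact: ih.
Qed.

Lemma derive_add f g x v : derivable f x v -> derivable g x v ->
  'D_v (fun y => f y + g y) x = 'D_v f x + 'D_v g x.
Proof. exact: deriveD. Qed.

Lemma derive_mul f g x v : derivable f x v -> derivable g x v ->
  'D_v (fun y => f y * g y) x = f x * 'D_v g x + g x * 'D_v f x.
Proof. exact: deriveM. Qed.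

Lemma CkD n f g : Ck n f -> Ck n g -> Ck n (fun x => f x + g x).
Proof.
elim: n f g => [|n ih] f g [cf df] [cg dg].
  by split => // x; apply: cvgD; [exact: cf|exact: cg].
split; first by move=> x; apply: cvgD; [exact: cf|exact: cg].
move=> i; have [f1 f2] := df i; have [g1 g2] := dg i; split.
  by move=> x; exact: (derivableD (f1 x) (g1 x)).
by under eq_fun => x do rewrite (derive_add (f1 x) (g1 x)); exact: ih.
Qed.

Lemma CkM n f g : Ck n f -> Ck n g -> Ck n (fun x => f x * g x).
Proof.
elim: n f g => [|n ih] f g cdf cdg; have [cf df] := cdf; have [cg dg] := cdg.
  by split => // x; apply: cvgM; [exact: cf|exact: cg].
split; first by move=> x; apply: cvgM; [exact: cf|exact: cg].
move=> i; have [f1 f2] := df i; have [g1 g2] := dg i; split.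
  by move=> x; exact: (derivableM (f1 x) (g1 x)).
under eq_fun => x do rewrite (derive_mul (f1 x) (g1 x)).
by apply: CkD; apply: ih => //; exact: CkW.
Qed.

Lemma CkZ n c f : Ck n f -> Ck n (fun x => c * f x).
Proof. by move=> cf; apply: CkM => //; exact: Ck_cst. Qed.

Lemma CkN n f : Ck n f -> Ck n (fun x => - f x).
Proof. by move=> /(CkZ (-1)); under eq_fun do rewrite mulN1r. Qed.

Lemma CkB n f g : Ck n f -> Ck n g -> Ck n (fun x => f x - g x).
Proof. by move=> cf cg; apply: CkD => //; exact: CkN. Qed.

Lemma Ck_prod n (J : Type) (s : seq J) (P : pred J) (F : J -> V -> R) :
  (forall j, Ck n (F j)) -> Ck n (fun x => \prod_(j <- s | P j) F j x).
Proof.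
move=> cF; elim: s => [|j s ih]; first by under eq_fun do rewrite big_nil; exact: Ck_cst.
by under eq_fun do rewrite big_cons; case: (P j) => //; exact: CkM.
Qed.

Lemma derive_line f x v : 'D_v f x = 'D_1 (fun t : R => f (t *: v + x)) (0 : R).
Proof.
rewrite /derive; set g1 := fun h => h^-1 *: _; set g2 := fun h => h^-1 *: _.
suff -> : g1 = g2 by [].
by rewrite funeqE /g1 /g2 => h /=; rewrite addr0 scale0r add0r [_%:A]mulr1.
Qed.

Lemma is_derive_line f x v : derivable f x v ->
  is_derive (0 : R) 1 (fun t : R => f (t *: v + x)) ('D_v f x).
Proof. by move=> /derivable1P df; split => //; rewrite derive_line. Qed.

(** Restricting f to a line reduces this to the one-variable chain rule; f is not known to be
    differentiable in all directions. *)
Lemma derive_compr (h : R -> R) f x v : derivable f x v -> derivable h (f x) 1 ->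
  is_derive x v (fun y => h (f y)) ('D_1 h (f x) * 'D_v f x).
Proof.
move=> df dh; have d1 := is_derive_line df.
have dh' : is_derive (f (0 *: v + x)) 1 h ('D_1 h (f x)).
  by rewrite scale0r add0r; exact: derivableP.
have := @is_derive1_comp _ h (fun t => f (t *: v + x)) 0 _ _ dh' d1.
move=> [dd dv]; split; first exact/derivable1P.
by rewrite derive_line -dv.
Qed.

End DifferentiabilityClasses.
Arguments Ck_derivable {R V I e n f} i x _.
Arguments Ck_derive {R V I e n f} i _.

Lemma Ck_comp {R : realType} {V : normedModType R} {I : Type} (e : I -> V) n (h : R -> R) f :
  (forall k, Ck (fun _ : unit => (1 : R)) k h) -> Ck e n f -> Ck e n (fun x => h (f x)).
Proof.
elim: n h f => [|n ih] h f ch cf.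
  split => // x; apply: (@continuous_comp _ _ _ f h); first by case: cf => /(_ x).
  exact: (Ck_continuous (ch 0%N)).
have ccf : continuous (fun x => h (f x)).
  move=> x; apply: (@continuous_comp _ _ _ f h); first exact: (Ck_continuous cf).
  exact: (Ck_continuous (ch 0%N)).
split => // i.
have dd x : is_derive x (e i) (fun y => h (f y)) ('D_1 h (f x) * 'D_(e i) f x).
  have dh : derivable h (f x) 1 by exact: (Ck_derivable tt (f x) (ch 1%N)).
  have df : derivable f x (e i) by exact: (Ck_derivable i x cf).
  exact: derive_compr.
split; first by move=> x; case: (dd x).
under eq_fun => x do rewrite (derive_val (is_derive := dd x)).
apply: CkM; last exact: Ck_derive.
apply: (ih (fun y => 'D_1 h y)); last exact: CkW.
by move=> k; exact: (Ck_derive tt (ch k.+1)).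
Qed.

Notation C1k R := (Ck (fun _ : unit => (1 : R))).

Section SmoothStep.
Context {R : realType}.

(** The classical flat function exp(-1/x) is the case n = 0. The factors x^-n close the family under
    differentiation, so smoothness follows by induction for all n at once. *)
Definition flat (n : nat) (x : R) : R := if 0 < x then x^-1 ^+ n * expR (- x^-1) else 0.

Lemma expR_ge_pow (n : nat) (y : R) : 0 < y -> y ^+ n <= n%:R ^+ n * expR y.
Proof.
move=> y0; case: n => [|n]; first by rewrite !expr0 mul1r ltW// expR_gt1.
have n0 : (0 : R) < n.+1%:R by rewrite ltr0n.
have h : y / n.+1%:R <= expR (y / n.+1%:R).
  by apply: le_trans (expR_ge1Dx _); rewrite lerDr.
have : (y / n.+1%:R) ^+ n.+1 <= expR (y / n.+1%:R) ^+ n.+1.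
  by rewrite ler_pXn2r// nnegrE ?expR_ge0// divr_ge0// ltW.
rewrite -expRM_natl (mulrC n.+1%:R) divfK ?gt_eqF// expr_div_n ler_pdivrMr ?exprn_gt0//.
by rewrite mulrC.
Qed.

Lemma flat_ge0 n x : 0 <= flat n x.
Proof.
rewrite /flat; case: ifPn => // x0; rewrite mulr_ge0 ?expR_ge0//.
by rewrite exprn_ge0// invr_ge0 ltW.
Qed.

Lemma flat_le n x : `|flat n x| <= n.+1%:R ^+ n.+1 * `|x|.
Proof.
rewrite ger0_norm ?flat_ge0// /flat; case: ifPn => [x0|_]; last by rewrite mulr_ge0// exprn_ge0.
rewrite (gtr0_norm x0).
have xi : 0 < x^-1 by rewrite invr_gt0.
have xn0 : x != 0 by rewrite gt_eqF.
have : x^-1 ^+ n.+1 / expR x^-1 <= n.+1%:R ^+ n.+1.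
  by rewrite ler_pdivrMr ?expR_gt0// expR_ge_pow.
rewrite -(ler_pM2r x0); apply: le_trans.
by rewrite expRN exprSr -!mulrA [_^-1 * x]mulrC [x^-1 * _]mulrA mulVf// mul1r.
Qed.

Lemma is_derive_flat n (x : R) :
  is_derive x (1 : R) (flat n) (flat n.+2 x - n%:R * flat n.+1 x).
Proof.
have [x0|x0|x0] := ltgtP 0 x.
- have near_eq : \forall y \near x, y^-1 ^+ n * expR (- y^-1) = flat n y.
    by near=> y; rewrite /flat ifT//; near: y; exact: lt_nbhsr.
  have xn0 : x != 0 by rewrite gt_eqF.
  have dinv : is_derive x (1 : R) (fun y : R => y^-1) (- x ^- 2).
    have := @is_deriveV R id x 1 1 xn0 (is_derive_id _ _).
    by move=> [d1 d2]; split => //; rewrite d2 [_ *: _]mulr1.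
  have dexp : is_derive x (1 : R) (fun y : R => expR (- y^-1)) (expR (- x^-1) * x ^- 2).
    have := @is_derive1_comp _ expR (fun y : R => - y^-1) x _ _ (is_derive_expR _) (is_deriveN dinv).
    by rewrite opprK.
  have dpow := is_deriveX n dinv.
  have := is_deriveM dpow dexp.
  have -> : [eta GRing.inv] ^+ n * (fun y : R => expR (- y^-1)) =
      (fun y : R => y^-1 ^+ n * expR (- y^-1)).
    by apply/funext => y; rewrite mulrfctE exprfctE.
  rewrite exprfctE => -[d1 d2].
  split; first by apply: near_eq_derivable d1; exact: near_eq.
  rewrite -(near_eq_derive (1 : R) near_eq) d2 /flat x0.
  rewrite -![_ *: _]/(_ * _).
  case: n {near_eq dpow d1 d2} => [|n] /=; first by rewrite !expr0; field.
  rewrite !exprS; set w := x^-1 ^+ n.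
  by field.
- have near_eq : \forall y \near x, cst 0 y = flat n y.
    near=> y; rewrite /flat ifF//; apply/negbTE; rewrite -leNgt ltW//.
    by near: y; exact: lt_nbhsl.
  have [d1 d2] := is_derive_cst (0 : R) x (1 : R).
  split; first by apply: near_eq_derivable d1; exact: near_eq.
  rewrite -(near_eq_derive (1 : R) near_eq) d2 /flat.
  by rewrite ltNge (ltW x0)/= mulr0 subr0.
- rewrite -x0 /flat ltxx mulr0 subr0.
  (* At the origin the difference quotient of [flat n] is [flat n.+1] itself, which tends to 0 by
     [flat_le]. *)
  have H : (fun h : R => h^-1 *: ((flat n \o shift 0) (h *: (1 : R)) - flat n 0)) @ 0^' --> (0 : R).
    have -> : (fun h : R => h^-1 *: ((flat n \o shift 0) (h *: (1 : R)) - flat n 0)) = flat n.+1.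
      apply/funext => h /=; rewrite addr0 [_%:A]mulr1 /flat ltxx subr0.
      case: ifPn => h0; last by rewrite scaler0.
      by rewrite -[_ *: _]/(_ * _) mulrA exprS.
    apply/cvgr0Pnorm_le => eps eps0.
    have K0 : 0 < n.+2%:R ^+ n.+2 :> R by rewrite exprn_gt0// ltr0n.
    near=> h; apply: (le_trans (flat_le n.+1 h)).
    rewrite mulrC -ler_pdivlMr//.
    by near: h; apply: dnbhs0_le; rewrite divr_gt0.
  by split; [apply/cvg_ex; exists 0|exact: cvg_lim H].
Unshelve. all: by end_near. Qed.

Lemma flat_C1k k n : C1k R k (flat n).
Proof.
have cont m : continuous (flat m).
  move=> x; apply/differentiable_continuous/derivable1_diffP.
  by have [] := is_derive_flat m x.
elim: k n => [|k ih] n; first by split.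
split => // _; split; first by move=> x; have [] := is_derive_flat n x.
rewrite (_ : (fun x => 'D_1 (flat n) x) = fun x => flat n.+2 x - n%:R * flat n.+1 x); last first.
  by apply/funext => x; have [_ ->] := is_derive_flat n x.
by apply: CkB; [exact: ih|apply: CkZ; exact: ih].
Qed.

Lemma flat0_mono (x y : R) : x <= y -> flat 0 x <= flat 0 y.
Proof.
move=> xy; rewrite {1}/flat; case: ifPn => x0; last exact: flat_ge0.
have y0 : 0 < y by apply: lt_le_trans xy.
by rewrite /flat y0 !expr0 !mul1r ler_expR lerN2 lef_pV2.
Qed.

(** A composition in place of the usual quotient f(1 - x) / (f(x) + f(1 - x)): the only division is
    by a constant, so the chain rule alone gives smoothness. *)
Definition sstep (x : R) : R := flat 0 (flat 0 1 - flat 0 x) / flat 0 (flat 0 1).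

Lemma flat0_1_gt0 : 0 < flat 0 1 :> R.
Proof. by rewrite /flat ltr01 expr0 mul1r expR_gt0. Qed.

Lemma flat0_gt0 (x : R) : 0 < x -> 0 < flat 0 x.
Proof. by move=> x0; rewrite /flat x0 expr0 mul1r expR_gt0. Qed.

Lemma sstep1 x : x <= 0 -> sstep x = 1.
Proof.
move=> x0; rewrite /sstep [flat 0 x]/flat ifF; last by apply/negbTE; rewrite -leNgt.
by rewrite subr0 mulfV// gt_eqF// flat0_gt0// flat0_1_gt0.
Qed.

Lemma sstep0 x : 1 <= x -> sstep x = 0.
Proof.
move=> x1; rewrite /sstep {1}/flat ifF ?mul0r//; apply/negbTE; rewrite -leNgt subr_le0.
exact: flat0_mono.
Qed.

Lemma sstep_itv x : 0 <= sstep x <= 1.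
Proof.
have c0 : 0 < flat 0 (flat 0 1) :> R by rewrite flat0_gt0// flat0_1_gt0.
apply/andP; split; first by rewrite divr_ge0 ?flat_ge0.
by rewrite ler_pdivrMr// mul1r flat0_mono// gerBl flat_ge0.
Qed.

Lemma sstep_C1k k : C1k R k sstep.
Proof.
rewrite (_ : sstep = fun x => (flat 0 (flat 0 1))^-1 * flat 0 (flat 0 1 - flat 0 x)).
  apply: CkZ; apply: (@Ck_comp _ R _ _ _ (flat 0)); first by move=> j; exact: flat_C1k.
  by apply: CkB; [exact: Ck_cst|exact: flat_C1k].
by apply/funext => x; rewrite /sstep mulrC.
Qed.

Lemma C1k_id k : C1k R k (fun x : R => x).
Proof.
case: k => [|k]; first by split => // x; exact: cvg_id.
split; first by move=> x; exact: cvg_id.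
move=> _; split; first by move=> x; exact: derivable_id.
rewrite (_ : (fun x => 'D_1 (fun x : R => x) x) = fun=> 1); first exact: Ck_cst.
by apply/funext => x; rewrite derive_id.
Qed.

(** Equal to 1 for |y| <= 3/2 and to 0 for y^2 >= 13/4, in particular for |y| > 19/10. The value 3/2
    is the half-side of a [plateau] in rescaled coordinates, measured from its [center]. *)
Definition chi (y : R) : R := sstep (y * y - 9 / 4).

Lemma chi_C1k k : C1k R k chi.
Proof.
apply: (@Ck_comp _ R _ _ _ sstep (fun y : R => y * y - 9 / 4)); first by move=> j; exact: sstep_C1k.
by apply: CkB; [apply: CkM; exact: C1k_id|exact: Ck_cst].
Qed.

Lemma chi_itv y : 0 <= chi y <= 1. Proof. exact: sstep_itv. Qed.

Lemma chi1 y : `|y| <= 3 / 2 -> chi y = 1.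
Proof.
rewrite ler_norml => /andP[y1 y2]; apply: sstep1.
have : 0 <= (3 / 2 - y) * (3 / 2 + y) by apply: mulr_ge0; lra.
lra.
Qed.

Lemma chi0 y : 19 / 10 < `|y| -> chi y = 0.
Proof.
move=> hy; apply: sstep0.
have : (19 / 10) ^+ 2 <= `|y| ^+ 2 by rewrite ler_pXn2r ?nnegrE// ltW.
rewrite real_normK ?num_real// expr2; lra.
Qed.

Definition chin (n : nat) : R -> R := iter n (fun h : R -> R => fun y => 'D_1 h y) chi.

Lemma chin_C1k n k : C1k R k (chin n).
Proof.
elim: n k => [|n ih] k; first exact: chi_C1k.
exact: (Ck_derive tt (ih k.+1)).
Qed.

(** The region |y| > 19/10 is open, so vanishing there is inherited by derivatives. *)
Lemma chin_supp n y : 19 / 10 < `|y| -> chin n y = 0.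
Proof.
elim: n y => [|n ih] y hy; first exact: chi0.
have near_eq : \forall z \near y, chin n z = cst 0 z.
  near=> z; apply: ih; near: z.
  have : `|z| @[z --> y] --> `|y| by apply: cvg_norm; exact: cvg_id.
  by move=> /(_ [set t | 19 / 10 < t]) /=; apply; exact: lt_nbhsr.
by rewrite /chin iterS -/(chin n) (near_eq_derive (1 : R) near_eq) derive_cst.
Unshelve. all: by end_near. Qed.

Lemma chin_bounded N : exists2 M, 1 <= M & forall n y, (n <= N)%N -> `|chin n y| <= M.
Proof.
have one n : exists2 M, 1 <= M & forall y, `|chin n y| <= M.
  have cn : continuous (chin n) by exact: (Ck_continuous (chin_C1k n 0)).
  have cw : {within `[(-2 : R), 2], continuous (fun y => `|chin n y|)}.
    apply: continuous_subspaceT => y; apply: cvg_norm; exact: cn.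
  have [|c _ hc] := @EVT_max R (fun y => `|chin n y|) (-2) 2 _ cw; first by lra.
  exists (1 + `|chin n c|); first by rewrite lerDl.
  move=> y; have [hy|hy] := ltP 2 `|y|.
    by rewrite chin_supp ?normr0 ?addr_ge0//; lra.
  rewrite (@le_trans _ _ `|chin n c|) ?lerDr//; apply: hc.
  by rewrite in_itv/= -ler_norml.
elim: N => [|N [M M1 hM]].
  by have [M M1 hM] := one 0%N; exists M => // n y; rewrite leqn0 => /eqP ->.
have [M' M'1 hM'] := one N.+1; exists (M + M'); first by lra.
move=> n y; rewrite leq_eqVlt => /orP[/eqP ->|nN].
  by rewrite (le_trans (hM' y))// lerDr; lra.
by rewrite (le_trans (hM n y nN))// lerDl; lra.
Qed.

End SmoothStep.

(** * Weighted jets *)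

Section Jets.
Context {R : realType} {d : nat}.
Local Notation V := 'rV[R]_d.
Implicit Types (u w : V -> R) (x c : V) (i j : 'I_d).
Local Notation E := (@unit_vec R d).

Lemma is_derive_coord i j x : is_derive x (E j) (fun y : V => y 0 i) ((i == j)%:R).
Proof.
have H : (fun h : R => h^-1 *: (((fun y : V => y 0 i) \o shift x) (h *: E j) - x 0 i)) @ 0^'
    --> ((i == j)%:R : R).
  apply: cvg_near_cst; near=> h; rewrite /= !mxE eqxx /= addrK.
  by rewrite -[_ *: _]/(_ * _) mulrA mulVf ?mul1r//; near: h; exact: nbhs_dnbhs_neq.
by split; [apply/cvg_ex; exists (i == j)%:R|exact: cvg_lim H].
Unshelve. all: by end_near. Qed.

Lemma Ck_coord k i : Ck E k (fun y : V => y 0 i).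
Proof.
have cc : continuous (fun y : V => y 0 i) by move=> x; exact: coord_continuous.
case: k => [|k]; first by split.
split => // j; split; first by move=> x; case: (is_derive_coord i j x).
rewrite (_ : (fun x => 'D_(E j) (fun y : V => y 0 i) x) = fun=> (i == j)%:R); first exact: Ck_cst.
by apply/funext => x; case: (is_derive_coord i j x).
Qed.

(** The parameter [c] lives in rescaled coordinates: the bump is centred at c / lam, with width of
    order 1 / lam. *)
Definition bump (lam : R) c x : R := \prod_i chi (lam * x 0 i - c 0 i).

Lemma bump_Ck k lam c : Ck E k (bump lam c).
Proof.
apply: Ck_prod => i; apply: (@Ck_comp _ _ _ E k chi (fun x : V => lam * x 0 i - c 0 i)).
  by move=> j; exact: chi_C1k.
by apply: CkB; [apply: CkZ; exact: Ck_coord|exact: Ck_cst].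
Qed.

Lemma bump_itv lam c x : 0 <= bump lam c x <= 1.
Proof.
rewrite /bump prodr_ge0 /=; last by move=> i _; case/andP: (chi_itv (lam * x 0 i - c 0 i)).
by apply: prodr_ile1 => i _; exact: chi_itv.
Qed.

Lemma bump1 lam c x : (forall i, `|lam * x 0 i - c 0 i| <= 3 / 2) -> bump lam c x = 1.
Proof. by move=> h; rewrite /bump big1// => i _; exact: chi1. Qed.

Lemma bump0 lam c x i : 19 / 10 < `|lam * x 0 i - c 0 i| -> bump lam c x = 0.
Proof. by move=> h; rewrite /bump (bigD1 i)//= chi0// mul0r. Qed.

Definition Dn i n u : V -> R := iter n (fun w : V -> R => fun x => 'D_(E i) w x) u.

Lemma DnS i n u : Dn i n.+1 u = Dn i n (fun x => 'D_(E i) u x).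
Proof. by rewrite /Dn iterSr. Qed.

Lemma Dn_Ck i n k u : Ck E (n + k) u -> Ck E k (Dn i n u).
Proof.
elim: n u => [//|n ih] u; rewrite DnS addSn => cu.
by apply: ih; exact: (Ck_derive i cu).
Qed.

(* The sum of [binomial(m, k) * t^k * |D_i^k u|]: the weights make it submultiplicative ([jet_mul]) while controlling
   the top derivative ([jet_Dn]). With t the cube size, a plateau at a larger scale contributes only 1 + O(size ratio),
   so products over all coarser scales stay bounded. *)
Fixpoint jet i (t : R) (m : nat) u x : R :=
  if m is m'.+1 then jet i t m' u x + t * jet i t m' (fun y => 'D_(E i) u y) x
  else `|u x|.

Lemma jet_ge0 i (t : R) m u x : 0 <= t -> 0 <= jet i t m u x.
Proof.
by move=> t0; elim: m u => [|m ih] u /=; [exact: normr_ge0|rewrite addr_ge0// mulr_ge0].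
Qed.

Lemma jet_Dn i (t : R) m u x : 0 <= t -> t ^+ m * `|Dn i m u x| <= jet i t m u x.
Proof.
move=> t0; elim: m u => [|m ih] u; first by rewrite expr0 mul1r.
rewrite DnS exprS -mulrA (le_trans (ler_wpM2l t0 (ih _)))//.
by rewrite lerDr jet_ge0.
Qed.

Lemma jet_add i (t : R) m u w x : 0 <= t -> Ck E m u -> Ck E m w ->
  jet i t m (fun y => u y + w y) x <= jet i t m u x + jet i t m w x.
Proof.
move=> t0; elim: m u w => [|m ih] u w cu cw /=; first exact: ler_normD.
rewrite (_ : (fun y => 'D_(E i) (fun y0 => u y0 + w y0) y) =
   fun y => 'D_(E i) u y + 'D_(E i) w y); last first.
  by apply/funext => y; exact: (derive_add (Ck_derivable i y cu) (Ck_derivable i y cw)).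
have h1 := ih _ _ (CkW cu) (CkW cw).
have h2 := ih _ _ (Ck_derive i cu) (Ck_derive i cw).
have h3 := ler_wpM2l t0 h2.
by apply: le_trans (lerD h1 h3) _; rewrite mulrDr; lra.
Qed.

(** By Leibniz and induction the left side is at most U W + t (U W' + U' W), and (U + t U') (W + t
    W') exceeds this by t^2 U' W' >= 0. *)
Lemma jet_mul i (t : R) m u w x : 0 <= t -> Ck E m u -> Ck E m w ->
  jet i t m (fun y => u y * w y) x <= jet i t m u x * jet i t m w x.
Proof.
move=> t0; elim: m u w => [|m ih] u w cu cw /=; first by rewrite normrM.
rewrite (_ : (fun y => 'D_(E i) (fun y0 => u y0 * w y0) y) =
   fun y => u y * 'D_(E i) w y + w y * 'D_(E i) u y); last first.
  by apply/funext => y; exact: (derive_mul (Ck_derivable i y cu) (Ck_derivable i y cw)).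
have cu' := Ck_derive i cu; have cw' := Ck_derive i cw.
have h1 := ih _ _ (CkW cu) (CkW cw).
have h2 := ih _ _ (CkW cu) cw'; have h3 := ih _ _ (CkW cw) cu'.
have h4 := jet_add i x t0 (CkM (CkW cu) cw') (CkM (CkW cw) cu').
move: h1 h2 h3 h4.
set U := jet i t m u x; set U' := jet i t m (fun y => 'D_(E i) u y) x.
set W := jet i t m w x; set W' := jet i t m (fun y => 'D_(E i) w y) x => h1 h2 h3 h4.
have U'0 : 0 <= U' by exact: jet_ge0.
have W'0 : 0 <= W' by exact: jet_ge0.
have h5 := ler_wpM2l t0 (le_trans h4 (lerD h2 h3)).
apply: le_trans (lerD h1 h5) _.
have : 0 <= t * U' * (t * W') by rewrite !mulr_ge0.
rewrite !mulrDr !mulrDl; lra.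
Qed.

Lemma jet_cst1 i t m x : jet i t m (fun=> 1) x = 1.
Proof.
have z n : jet i t n (fun=> 0) x = 0.
  elim: n => [|n ih] /=; first by rewrite normr0.
  by rewrite (_ : (fun y : V => 'D_(E i) (fun=> 0 : R) y) = fun=> 0) ?ih ?mulr0 ?addr0//; apply/funext => y; rewrite derive_cst.
elim: m => [|m ih] /=; first by rewrite normr1.
rewrite ih (_ : (fun y : V => 'D_(E i) (fun=> 1 : R) y) = fun=> 0) ?z ?mulr0 ?addr0//.
by apply/funext => y; rewrite derive_cst.
Qed.

Lemma jet_prod i (t : R) m (J : Type) (s : seq J) (F : J -> V -> R) x : 0 <= t ->
  (forall a, Ck E m (F a)) ->
  jet i t m (fun y => \prod_(a <- s) F a y) x <= \prod_(a <- s) jet i t m (F a) x.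
Proof.
move=> t0 cF; elim: s => [|b s ih].
  by rewrite big_nil; under eq_fun do rewrite big_nil; rewrite jet_cst1.
rewrite big_cons; under eq_fun do rewrite big_cons.
apply: le_trans (jet_mul i x t0 (cF b) _) _; first exact: Ck_prod.
by apply: ler_wpM2l => //; exact: jet_ge0.
Qed.

Lemma jet_opp i t m u x : Ck E m u -> jet i t m (fun y => - u y) x = jet i t m u x.
Proof.
elim: m u => [|m ih] u cu /=; first by rewrite normrN.
rewrite (_ : (fun y => 'D_(E i) (fun y0 => - u y0) y) = fun y => - 'D_(E i) u y).
  by rewrite !ih//; [exact: Ck_derive|exact: CkW].
by apply/funext => y; exact: (deriveN (Ck_derivable i y cu)).
Qed.

(** Separates the value from the terms with at least one derivative. Each of the latter carries an
    explicit factor t, the source of the small excess over 1 in [jet_bump_compl]. *)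
Lemma jet_compl i t m u x : Ck E m u ->
  jet i t m (fun y => 1 - u y) x = `|1 - u x| + \sum_(k < m) t * jet i t k (fun y => 'D_(E i) u y) x.
Proof.
elim: m u => [|m ih] u cu /=; first by rewrite big_ord0 addr0.
rewrite ih ?big_ord_recr /= ?addrA; last exact: CkW.
congr (_ + t * _).
rewrite (_ : (fun y => 'D_(E i) (fun y0 => 1 - u y0) y) = fun y => - 'D_(E i) u y).
  by rewrite jet_opp//; exact: Ck_derive.
apply/funext => y.
have dc : derivable (fun=> 1 : R) y (E i) by exact: derivable_cst.
have du : derivable u y (E i) by exact: (Ck_derivable i y cu).
by rewrite (deriveB dc du) derive_cst sub0r.
Qed.

(* The n-th partial derivative of [bump lam c] in direction i. *)
Definition bumpd i lam c (n : nat) x : R :=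
  lam ^+ n * chin n (lam * x 0 i - c 0 i) * \prod_(j | j != i) chi (lam * x 0 j - c 0 j).

Lemma bumpd0 i lam c : bumpd i lam c 0 = bump lam c.
Proof. by apply/funext => x; rewrite /bumpd /bump expr0 mul1r [RHS](bigD1 i). Qed.

Lemma derive_bumpd i lam c n : (fun x => 'D_(E i) (bumpd i lam c n) x) = bumpd i lam c n.+1.
Proof.
apply/funext => x; rewrite derive_line.
set K := \prod_(j | j != i) chi (lam * x 0 j - c 0 j).
have -> : (fun t : R => bumpd i lam c n (t *: E i + x)) =
   fun t : R => (lam ^+ n * K) * chin n (lam * (t + x 0 i) - c 0 i).
  apply/funext => t; rewrite /bumpd (_ : (t *: E i + x) 0 i = t + x 0 i); last first.
    by rewrite !mxE !eqxx mulr1.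
  rewrite (eq_bigr (fun j => chi (lam * x 0 j - c 0 j))) -/K; first by rewrite mulrAC.
  by move=> j /negbTE ji; rewrite !mxE ji andbF mulr0 add0r.
have dl : derivable (fun t : R => lam * (t + x 0 i) - c 0 i) 0 1.
  have h : C1k R 1 (fun t : R => lam * (t + x 0 i) - c 0 i).
    apply: CkB; last exact: Ck_cst.
    by apply: CkZ; apply: CkD; [exact: C1k_id|exact: Ck_cst].
  exact: (Ck_derivable tt 0 h).
have dc := Ck_derivable tt (lam * (0 + x 0 i) - c 0 i) (chin_C1k n 1).
have [dd dv] := derive_compr dl dc.
have ddv : 'D_1 (fun t : R => lam * (t + x 0 i) - c 0 i) (0 : R) = lam.
  have d1 : derivable (fun t : R => lam * (t + x 0 i)) 0 1.
    have h : C1k R 1 (fun t : R => lam * (t + x 0 i)).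
      by apply: CkZ; apply: CkD; [exact: C1k_id|exact: Ck_cst].
    exact: (Ck_derivable tt 0 h).
  have d2 : derivable (fun t : R => t + x 0 i) 0 1.
    have h : C1k R 1 (fun t : R => t + x 0 i) by apply: CkD; [exact: C1k_id|exact: Ck_cst].
    exact: (Ck_derivable tt 0 h).
  rewrite (deriveB d1 (derivable_cst _ _ _)) derive_cst subr0.
  rewrite (derive_mul (derivable_cst lam _ _) d2) derive_cst mulr0 addr0.
  by rewrite (derive_add (@derivable_id _ _ _ _) (derivable_cst _ _ _)) derive_id derive_cst addr0 mulr1.
rewrite (derive_mul (derivable_cst (lam ^+ n * K) _ _) dd) derive_cst mulr0 addr0 dv ddv add0r.
rewrite /bumpd -/K (_ : chin n.+1 _ = 'D_1 (chin n) (lam * x 0 i - c 0 i))// /cst exprS.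
by ring.
Qed.

Lemma bumpd_le i (lam : R) c n x (M : R) : 0 <= lam -> `|chin n (lam * x 0 i - c 0 i)| <= M ->
  `|bumpd i lam c n x| <= lam ^+ n * M.
Proof.
move=> lam0 hM; rewrite /bumpd !normrM ger0_norm ?exprn_ge0//.
have M0 : 0 <= M by exact: le_trans hM.
rewrite -[leRHS]mulr1 ler_pM//; first by rewrite mulr_ge0// exprn_ge0.
  by rewrite ler_wpM2l// exprn_ge0.
rewrite ger0_norm; last by apply: prodr_ge0 => j _; case/andP: (chi_itv (lam * x 0 j - c 0 j)).
by apply: prodr_ile1 => j _; exact: chi_itv.
Qed.

Lemma jet_bumpd i (t : R) m (lam : R) c n x (M : R) N : 0 <= t -> 0 <= lam -> (m + n <= N)%N ->
  (forall k y, (k <= N)%N -> `|chin k y| <= M) ->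
  jet i t m (bumpd i lam c n) x <= (1 + t * lam) ^+ m * lam ^+ n * M.
Proof.
move=> t0 lam0 + hM; elim: m n => [|m ih] n mnN /=.
  by rewrite expr0 mul1r; apply: bumpd_le => //; exact: hM.
rewrite derive_bumpd.
have h1 := ih n (leq_trans (leq_add (leqnSn m) (leqnn n)) mnN).
have h2 : jet i t m (bumpd i lam c n.+1) x <= (1 + t * lam) ^+ m * lam ^+ n.+1 * M.
  by apply: ih; rewrite addnS -addSn.
apply: le_trans (lerD h1 (ler_wpM2l t0 h2)) _.
by rewrite !exprS; set a := _ ^+ m; set b := _ ^+ n; lra.
Qed.

(** The value of one minus a bump is at most 1, and each of the m derivative terms of [jet_compl] is
    at most t lam (1 + t lam)^k M <= 2^m M (t lam). *)
Lemma jet_bump_compl i (t : R) m (lam : R) c x (M : R) : 0 <= t -> 0 <= lam -> t * lam <= 1 ->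
  (forall k y, (k <= m)%N -> `|chin k y| <= M) ->
  jet i t m (fun y => 1 - bump lam c y) x <= 1 + m%:R * (2 ^+ m * M) * (t * lam).
Proof.
move=> t0 lam0 tl hM; rewrite jet_compl; last exact: bump_Ck.
have tl0 : 0 <= t * lam by rewrite mulr_ge0.
have M0 : 0 <= M by apply: le_trans (hM 0%N 0 _).
have /andP[b0 b1] := bump_itv lam c x.
apply: lerD; first by rewrite ger0_norm; lra.
rewrite -(bumpd0 i); under eq_bigr => k _ do rewrite derive_bumpd.
apply: (@le_trans _ _ (\sum_(k < m) (2 ^+ m * M) * (t * lam))).
  apply: ler_sum => k _.
  have kM : forall k' y, (k' <= m)%N -> `|chin k' y| <= M by [].
  have h := @jet_bumpd i t k lam c 1 x M m t0 lam0 _ kM.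
  apply: le_trans (ler_wpM2l t0 (h _)) _; first by rewrite addn1 ltn_ord.
  rewrite expr1 (_ : t * ((1 + t * lam) ^+ k * lam * M) = (1 + t * lam) ^+ k * M * (t * lam)); last by ring.
  rewrite ler_wpM2r// ler_wpM2r//.
  apply: (@le_trans _ _ (2 ^+ k)); first by apply: lerXn2r; rewrite ?nnegrE; lra.
  by rewrite ler_eXn2l ?ltr1n// ltnW.
by rewrite sumr_const card_ord -[leLHS]mulr_natl -!mulrA.
Qed.

(** The exact value 1 matters: distant cubes are then neutral in a product, however many of them
    there are. *)
Lemma jet_bump_compl_far i t m lam c x j : 19 / 10 < `|lam * x 0 j - c 0 j| ->
  jet i t m (fun y => 1 - bump lam c y) x = 1.
Proof.
move=> far; rewrite jet_compl; last exact: bump_Ck.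
rewrite (bump0 far) subr0 normr1 big1 ?addr0// => k _.
have z n : bumpd i lam c n x = 0.
  rewrite /bumpd; have [<-|ij] := eqVneq j i; first by rewrite chin_supp// mulr0 mul0r.
  by rewrite (bigD1 j)//= chi0// mul0r mulr0.
rewrite -(bumpd0 i) derive_bumpd.
suff -> : jet i t k (bumpd i lam c 1) x = 0 by rewrite mulr0.
elim: (val k) 1%N => [|k' ih] n /=; first by rewrite z normr0.
by rewrite ih derive_bumpd ih mulr0 addr0.
Qed.

Lemma jet_bump i (t : R) m (lam : R) c x (M : R) : 0 <= t -> 0 <= lam ->
  (forall k y, (k <= m)%N -> `|chin k y| <= M) ->
  jet i t m (bump lam c) x <= (1 + t * lam) ^+ m * M.
Proof.
move=> t0 lam0 hM; rewrite -(bumpd0 i).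
have := @jet_bumpd i t m lam c 0 x M m t0 lam0 _ hM.
by rewrite addn0 expr0 mulr1; exact.
Qed.

Lemma Ck_smooth u : (forall k, Ck E k u) -> smooth u.
Proof.
move=> cu; have H l k : Ck E k (iter_partial l u).
  elim: l k => [|i l ih] k; first exact: cu.
  exact: (Ck_derive i (ih k.+1)).
move=> l; split; first exact: (Ck_continuous (H l 0%N)).
by move=> i x; exact: (Ck_derivable i x (H l 1%N)).
Qed.

End Jets.

(** * Finite differences *)

Section Translate.
Context {R : realType} {V : normedModType R}.

Lemma derive_translate (u : V -> R) (z v x : V) : 'D_v (fun y => u (y + z)) x = 'D_v u (x + z).
Proof.
rewrite /derive; set g1 := fun h => h^-1 *: _; set g2 := fun h => h^-1 *: _.
suff -> : g1 = g2 by [].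
by apply/funext => h; rewrite /g1 /g2 /= addrA.
Qed.

Lemma derivable_translate (u : V -> R) (z v x : V) : derivable u (x + z) v ->
  derivable (fun y => u (y + z)) x v.
Proof.
rewrite /derivable; set g1 := fun h => h^-1 *: _; set g2 := fun h => h^-1 *: _.
suff -> : g1 = g2 by [].
by apply/funext => h; rewrite /g1 /g2 /= addrA.
Qed.

Lemma continuous_translate (u : V -> R) (z : V) : continuous u ->
  continuous (fun y => u (y + z)).
Proof.
move=> cu x; apply: (@continuous_comp _ _ _ (fun y : V => y + z) u); last exact: cu.
exact: (cvgD cvg_id (cvg_cst z)).
Qed.

End Translate.

Section FiniteDifferences.
Context {R : realType} {d : nat}.
Local Notation V := 'rV[R]_d.
Local Notation T := (Rd R d).
Implicit Types (u w : V -> R) (x c : V) (i j : 'I_d).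
Local Notation E := (@unit_vec R d).

Lemma Ck_translate n u (z : V) : Ck E n u -> Ck E n (fun x => u (x + z)).
Proof.
elim: n u => [|n ih] u cu.
  by split => //; apply: continuous_translate; case: cu.
split; first by apply: continuous_translate; case: cu.
move=> i; split; first by move=> x; apply: derivable_translate; exact: (Ck_derivable i _ cu).
rewrite (_ : (fun x => 'D_(E i) (fun y => u (y + z)) x) = fun x => 'D_(E i) u (x + z)).
  exact: (ih (fun x => 'D_(E i) u x) (Ck_derive i cu)).
by apply/funext => x; rewrite derive_translate.
Qed.

(* Centred differences multiply the transform by [2i sin (2 pi h xi_i)], so smoothness yields decay of the transform
   without integrating by parts. *)
Definition dlt i (h : R) u x : R := u (x + h *: E i) - u (x + (- h) *: E i).

Lemma dlt_Ck i h n u : Ck E n u -> Ck E n (dlt i h u).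
Proof. by move=> cu; apply: CkB; exact: Ck_translate. Qed.

Lemma Dn_dlt i h n u : Ck E n u -> Dn i n (dlt i h u) = dlt i h (Dn i n u).
Proof.
elim: n u => [//|n ih] u cu; rewrite !DnS -ih; last exact: (Ck_derive i cu).
congr (Dn i n _); apply/funext => x; rewrite /dlt.
have d1 : derivable (fun y => u (y + h *: E i)) x (E i).
  by apply: derivable_translate; exact: (Ck_derivable i _ cu).
have d2 : derivable (fun y => u (y + (- h) *: E i)) x (E i).
  by apply: derivable_translate; exact: (Ck_derivable i _ cu).
by rewrite (deriveB d1 d2) !derive_translate.
Qed.

Lemma dlt_le i (h : R) u x (M : R) : 0 <= h -> Ck E 1 u ->
  (forall y, `|'D_(E i) u y| <= M) -> `|dlt i h u x| <= 2 * h * M.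
Proof.
move=> h0 cu hM.
pose f := fun s : R => u (s *: E i + x).
have df s : is_derive s (1 : R) f ('D_(E i) u (s *: E i + x)).
  have d0 : derivable u (s *: E i + x) (E i) by exact: (Ck_derivable i _ cu).
  have := is_derive_line d0 => -[dd dv]; rewrite -dv.
  have e : f = (fun y : R => (fun t : R => u (t *: E i + (s *: E i + x))) (y + (- s))).
    by apply/funext => y; rewrite /f addrA -scalerDl subrK.
  split; rewrite e.
    apply: (derivable_translate (u := fun t : R => u (t *: E i + (s *: E i + x)))).
    by rewrite subrr.
  by rewrite (derive_translate (fun t : R => u (t *: E i + (s *: E i + x)))) subrr.
have [] := @MVT_segment R f (fun s => 'D_(E i) u (s *: E i + x)) (- h) h.
- by lra.
- apply: continuous_subspaceT => s; apply/differentiable_continuous/derivable1_diffP.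
  by case: (df s).
move=> s _; rewrite /f => e.
rewrite /dlt [x + h *: _]addrC [x + (- h) *: _]addrC e normrM mulrC.
rewrite (_ : h - - h = 2 * h); last by lra.
by rewrite ger0_norm ?ler_wpM2l//; lra.
Qed.

Lemma iter_dlt_le i (h : R) m u x (M : R) : 0 <= h -> Ck E m u ->
  (forall y, `|Dn i m u y| <= M) -> `|iter m (dlt i h) u x| <= (2 * h) ^+ m * M.
Proof.
move=> h0; elim: m u M x => [|m ih] u M x cu hM; first by rewrite expr0 mul1r; exact: hM.
rewrite iterSr exprSr -mulrA; apply: ih; first by apply: dlt_Ck; exact: CkW.
move=> y; rewrite Dn_dlt; last exact: CkW.
apply: dlt_le => //; apply: Dn_Ck; by rewrite addn1.
Qed.

Lemma iter_dlt_supp i (h : R) m u x : 0 <= h -> iter m (dlt i h) u x != 0 ->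
  exists2 s : R, `|s| <= m%:R * h & u (x + s *: E i) != 0.
Proof.
move=> h0; elim: m x => [|m ih] x /= ux.
  by exists 0; [rewrite normr0 mul0r|rewrite scale0r addr0].
have : iter m (dlt i h) u (x + h *: E i) != 0 \/ iter m (dlt i h) u (x + (- h) *: E i) != 0.
  have [e1|] := eqVneq (iter m (dlt i h) u (x + h *: E i)) 0; last by left.
  by right; apply: contra ux => /eqP e2; rewrite /dlt e1 e2 subrr.
case=> /ih[s hs us].
  exists (h + s); last by rewrite scalerDl addrA.
  rewrite (le_trans (ler_normD _ _))// -natr1 mulrDl mul1r addrC.
  by rewrite lerD// ger0_norm.
exists (- h + s); last by rewrite scalerDl addrA.
rewrite (le_trans (ler_normD _ _))// -natr1 mulrDl mul1r addrC normrN.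
by rewrite lerD// ger0_norm.
Qed.

Variable mu : {measure set T -> \bar R}.
Hypothesis Hmu : is_lebesgue_measure mu.

Lemma bsupp_dlt i h (u : T -> R) : bsupp u -> bsupp (dlt i h u : T -> R).
Proof. by move=> bu; apply: bsuppB; exact: bsupp_translate. Qed.

Lemma bsupp_iter_dlt i h m (u : T -> R) : bsupp u -> bsupp (iter m (dlt i h) u : T -> R).
Proof. by move=> bu; elim: m => //= m; exact: bsupp_dlt. Qed.

Lemma int_translate_wave (g : R -> R) i (h : R) (u : T -> R) (xi : V) :
  measurable_fun setT g -> (forall y, `|g y| <= 1) -> bsupp u ->
  \int[mu]_x (u (translate (h *: E i) x) * g (2 * pi * dotp x xi)) =
  \int[mu]_x (u x * g (2 * pi * dotp x xi - 2 * pi * (h * xi 0 i))).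
Proof.
move=> mg g1 bu.
have bw : bmeas (fun x : T => g (2 * pi * dotp x xi - 2 * pi * (h * xi 0 i))).
  split; last by exists 1.
  apply: (measurableT_comp mg); apply: measurable_funB => //; exact: measurable_phase.
rewrite -[RHS](int_translate Hmu (h *: E i)); last exact: (bsuppM bu bw).
apply: eq_Rintegral => x _; congr (_ * g _).
by rewrite /translate dotp_translate; ring.
Qed.

Lemma spec_dlt i (h : R) (u : T -> R) (xi : V) : bsupp u ->
  spec mu (dlt i h u) xi = 4 * sin (2 * pi * (h * xi 0 i)) ^+ 2 * spec mu u xi.
Proof.
move=> bu; set b := 2 * pi * (h * xi 0 i).
have bc := bmeas_cos xi; have bs := bmeas_sin xi.
have bsh s := bsupp_translate (s *: E i) bu.
have c1 y : `|cos y| <= 1 :> R by exact: cos_max.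
have s1 y : `|sin y| <= 1 :> R by exact: sin_max.
have bcs := bsuppM bu bc; have bss := bsuppM bu bs.
(* Used for (cos, sin) and for (sin, cos): the centred difference exchanges the two parts of the
   transform, up to a factor 2 sin b or -2 sin b. *)
have key (g g' : R -> R) (k : R) : measurable_fun setT g -> (forall y, `|g y| <= 1) ->
    bsupp (fun x : T => u x * g (2 * pi * dotp x xi - b)) ->
    bsupp (fun x : T => u x * g (2 * pi * dotp x xi + b)) ->
    bmeas (fun x : T => g (2 * pi * dotp x xi)) ->
    bsupp (fun x : T => u x * g' (2 * pi * dotp x xi)) ->
    (forall y, g (y - b) - g (y + b) = k * g' y) ->
    \int[mu]_x (dlt i h u x * g (2 * pi * dotp x xi)) =
    k * \int[mu]_x (u x * g' (2 * pi * dotp x xi)).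
  move=> mg g1 b1 b2 b3 b4 gg.
  have -> : \int[mu]_x (dlt i h u x * g (2 * pi * dotp x xi)) =
     \int[mu]_x (u (translate (h *: E i) x) * g (2 * pi * dotp x xi)) -
     \int[mu]_x (u (translate ((- h) *: E i) x) * g (2 * pi * dotp x xi)).
    rewrite -int_B//; [|exact: bsuppM|exact: bsuppM].
    by apply: eq_Rintegral => x _; rewrite -mulrBl.
  rewrite !int_translate_wave//.
  have -> : \int[mu]_x (u x * g (2 * pi * dotp x xi - 2 * pi * (- h * xi 0 i))) =
            \int[mu]_x (u x * g (2 * pi * dotp x xi + b)).
    by apply: eq_Rintegral => x _; congr (_ * g _); rewrite /b; ring.
  rewrite -/b -int_B// -int_Z//; apply: eq_Rintegral => x _.
  by rewrite -mulrBr gg; ring.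
have bb (g : R -> R) s : measurable_fun setT g -> (forall y, `|g y| <= 1) ->
    bsupp (fun x : T => u x * g (2 * pi * dotp x xi + s)).
  move=> mg g1; apply: bsuppM => //; split; last by exists 1.
  by apply: (measurableT_comp mg); apply: measurable_funD => //; exact: measurable_phase.
rewrite /spec /invF_re /invF_im.
rewrite (key cos sin (2 * sin b) measurable_cosr c1 (bb cos _ measurable_cosr c1) (bb cos _ measurable_cosr c1) bc bss); last first.
  by move=> y; rewrite cosB cosD; ring.
rewrite (key sin cos (- 2 * sin b) measurable_sinr s1 (bb sin _ measurable_sinr s1) (bb sin _ measurable_sinr s1) bs bcs).
  by ring.
by move=> y; rewrite sinB sinD; ring.
Qed.

(* For h = 1/(8 rho) the factor 2 |sin (2 pi h xi_i)| is at least 1 on rho <= |xi_i| <= 2 rho. *)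
Lemma spec_dlt_ge i (rho : R) m (u : T -> R) (xi : V) : bsupp u -> 0 < rho ->
  rho <= `|xi 0 i| <= 2 * rho ->
  spec mu u xi <= spec mu (iter m (dlt i (8 * rho)^-1) u) xi.
Proof.
move=> bu rho0 /andP[x1 x2].
have p0 : 0 < pi :> R by exact: pi_gt0.
pose b := 2 * pi * ((8 * rho)^-1 * xi 0 i).
(* |b| lies in [pi/4, pi/2], where cos(2|b|) <= 0; that is cos^2 <= sin^2, hence sin^2 >= 1/2. *)
have hb : 1 <= 4 * sin b ^+ 2.
  have -> : sin b ^+ 2 = sin `|b| ^+ 2.
    by have [b0|b0] := leP 0 b; [rewrite ger0_norm|rewrite ltr0_norm// sinN sqrrN].
  have nb : `|b| = pi / 4 * (`|xi 0 i| / rho).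
    rewrite /b !normrM normfV (gtr0_norm p0) !(ger0_norm (ler0n _ _)) normrM (gtr0_norm rho0) ger0_norm//.
    by field; rewrite gt_eqF.
  have b1 : pi / 4 <= `|b|.
    rewrite nb -[leLHS]mulr1 ler_wpM2l ?ler_pdivlMr ?mul1r//; lra.
  have b2 : `|b| <= pi / 2.
    rewrite nb (_ : pi / 2 = pi / 4 * 2); last by lra.
    by rewrite ler_wpM2l ?ler_pdivrMr//; lra.
  have c2 : cos `|b| ^+ 2 <= sin `|b| ^+ 2.
    have cb0 : 0 <= cos `|b| by apply: cos_ge0_pihalf; rewrite b2 andbT; lra.
    have : cos (`|b| *+ 2) <= 0.
      have -> : `|b| *+ 2 = (`|b| *+ 2 - pi) + pi by lra.
      rewrite cosDpi oppr_le0; apply: cos_ge0_pihalf.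
      by rewrite -mulr_natr; apply/andP; split; lra.
    by rewrite cos_mulr2n cos2sin2; have := cos2Dsin2 `|b|; lra.
  by have := cos2Dsin2 `|b|; lra.
elim: m => [//|m ih] /=.
rewrite spec_dlt; last exact: bsupp_iter_dlt.
apply: (le_trans ih); rewrite -[leLHS]mul1r; apply: ler_wpM2r => //.
exact: spec_ge0.
Qed.

End FiniteDifferences.

(** * Transforms of functions localized on cubes *)

Section NonnegativeIntegrals.
Context {R : realType} {d : nat}.
Local Notation T := (Rd R d).
Implicit Types (f g : T -> R) (A B : set T).
Variable mu : {measure set T -> \bar R}.

Lemma eint_le A f g : measurable A -> measurable_fun setT f -> measurable_fun setT g ->
  (forall x, 0 <= f x) -> (forall x, A x -> f x <= g x) ->
  (\int[mu]_(x in A) (f x)%:E <= \int[mu]_(x in A) (g x)%:E)%E.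
Proof.
move=> mA mf mg f0 fg; apply: ge0_le_integral => //.
- by move=> x _; rewrite lee_fin.
- by apply/measurable_EFinP; exact: measurable_funTS.
- by apply/measurable_EFinP; exact: measurable_funTS.
Qed.

Lemma eintD A f g : measurable A -> measurable_fun setT f -> measurable_fun setT g ->
  (forall x, 0 <= f x) -> (forall x, 0 <= g x) ->
  (\int[mu]_(x in A) (f x + g x)%:E =
   \int[mu]_(x in A) (f x)%:E + \int[mu]_(x in A) (g x)%:E)%E.
Proof.
move=> mA mf mg f0 g0; under eq_integral do rewrite EFinD.
rewrite ge0_integralD//; try by move=> x _; rewrite lee_fin.
- by apply/measurable_EFinP; exact: measurable_funTS.
- by apply/measurable_EFinP; exact: measurable_funTS.
Qed.

Lemma eintZ A c f : measurable A -> measurable_fun setT f -> 0 <= c ->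
  (forall x, 0 <= f x) ->
  (\int[mu]_(x in A) (c * f x)%:E = c%:E * \int[mu]_(x in A) (f x)%:E)%E.
Proof.
move=> mA mf c0 f0; under eq_integral do rewrite EFinM.
rewrite ge0_integralZl_EFin//; first by move=> x _; rewrite lee_fin.
by apply/measurable_EFinP; exact: measurable_funTS.
Qed.

Lemma eint_subset A B f : measurable A -> measurable B -> measurable_fun setT f ->
  (forall x, 0 <= f x) -> A `<=` B ->
  (\int[mu]_(x in A) (f x)%:E <= \int[mu]_(x in B) (f x)%:E)%E.
Proof.
move=> mA mB mf f0 AB; apply: ge0_subset_integral => //.
  by apply/measurable_EFinP; exact: measurable_funTS.
by move=> x _; rewrite lee_fin.
Qed.

Lemma eint_cover (I : finType) A (B0 : set T) (B : I -> set T) f :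
  measurable A -> measurable B0 -> (forall i, measurable (B i)) ->
  measurable_fun setT f -> (forall x, 0 <= f x) ->
  (forall x, A x -> B0 x \/ exists i, B i x) ->
  (\int[mu]_(x in A) (f x)%:E <= \int[mu]_(x in B0) (f x)%:E
     + \sum_i \int[mu]_(x in B i) (f x)%:E)%E.
Proof.
move=> mA mB0 mB mf f0 cov.
have mfE : measurable_fun setT (EFin \o f) by exact/measurable_EFinP.
have mr D : measurable D -> measurable_fun setT ((EFin \o f) \_ D).
  by move=> mD; apply/(measurable_restrictT _ mD); exact: measurable_funTS.
have r0 D x : (0 <= ((EFin \o f) \_ D) x)%E by apply: erestrict_ge0 => y _; rewrite lee_fin.
rewrite integral_mkcond [X in (_ <= X + _)%E]integral_mkcond.
under eq_bigr do rewrite integral_mkcond.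
rewrite -ge0_integral_sum//; last by move=> i; exact: mr.
rewrite -ge0_integralD//; last 3 first.
- exact: mr.
- by move=> x _; apply: sume_ge0.
- by apply: emeasurable_sum => i; exact: mr.
apply: ge0_le_integral => //.
- exact: mr.
- apply: emeasurable_funD; first exact: mr.
  by apply: emeasurable_sum => i; exact: mr.
move=> x _; rewrite {1}patchE; case: ifPn => [|_]; last by rewrite adde_ge0// sume_ge0.
rewrite inE => /cov[Bx|[i Bx]].
  by rewrite patchE mem_set// leeDl// sume_ge0.
rewrite (bigD1 i)//= [X in (_ <= _ + (X + _))%E]patchE mem_set//.
by rewrite addeCA leeDl// adde_ge0// sume_ge0.
Qed.

(** Cauchy-Schwarz against the constant 1, obtained by integrating sqrt f <= tau / 2 + f / (2 tau)
    with the optimal weight tau = sqrt (X / V). *)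
Lemma eint_sqrt_le A f (X V : R) : measurable A -> measurable_fun setT f -> (forall x, 0 <= f x) ->
  0 < X -> 0 < V -> (mu A <= V%:E)%E -> (\int[mu]_(x in A) (f x)%:E <= X%:E)%E ->
  (\int[mu]_(x in A) (Num.sqrt (f x))%:E <= (Num.sqrt (X * V))%:E)%E.
Proof.
move=> mA mf f0 X0 V0 muA intf; pose tau : R := Num.sqrt (X / V).
have tau0 : 0 < tau by rewrite sqrtr_gt0 divr_gt0.
have mm (c : R) : 0 <= c -> measurable_fun setT (fun x => c * f x) by move=> _; apply: measurable_funM.
have c0 : 0 <= (2 * tau)^-1 by rewrite invr_ge0; lra.
apply: (@le_trans _ _ (\int[mu]_(x in A) (tau / 2 + (2 * tau)^-1 * f x)%:E)%E).
  apply: eint_le => //.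
  - by apply: measurableT_comp mf; by apply: continuous_measurable_fun; exact: sqrt_continuous.
  - by apply: measurable_funD => //; exact: mm.
  move=> x _; pose y : R := Num.sqrt (f x); rewrite -/y.
  have -> : f x = y ^+ 2 by rewrite sqr_sqrtr.
  have : 0 <= (tau - y) ^+ 2 / (2 * tau) by rewrite divr_ge0 ?sqr_ge0//; lra.
  move=> h; rewrite -subr_ge0 (_ : _ - y = (tau - y) ^+ 2 / (2 * tau))//.
  by field; rewrite gt_eqF.
rewrite eintD//; last 3 first.
- exact: mm.
- by move=> x; lra.
- by move=> x; rewrite mulr_ge0.
have ec : (\int[mu]_(x in A) (tau / 2)%:E = (tau / 2)%:E * mu A)%E := integral_cst mu mA _.
rewrite ec eintZ//.
apply: (@le_trans _ _ ((tau / 2)%:E * V%:E + ((2 * tau)^-1)%:E * X%:E)%E).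
  by apply: leeD; apply: lee_wpmul2l => //; rewrite lee_fin//; lra.
rewrite -!EFinM -EFinD lee_fin le_eqVlt; apply/orP; left; apply/eqP.
rewrite /tau !sqrtrM ?(ltW X0)// sqrtrV ?(ltW V0)//.
have -> : X = Num.sqrt X ^+ 2 by rewrite sqr_sqrtr// ltW.
have -> : V = Num.sqrt V ^+ 2 by rewrite sqr_sqrtr// ltW.
rewrite !sqrtr_sqr !(ger0_norm (sqrtr_ge0 _)).
have sX0 : 0 < Num.sqrt X by rewrite sqrtr_gt0.
have sV0 : 0 < Num.sqrt V by rewrite sqrtr_gt0.
by field; rewrite !gt_eqF.
Qed.

Lemma eint_exhaust (F : nat -> set T) (f : T -> R) (B : \bar R) :
  measurable_fun setT f -> (forall x, 0 <= f x) -> (forall n, measurable (F n)) ->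
  nondecreasing_seq F -> \bigcup_n F n = setT ->
  (forall n, \int[mu]_(x in F n) (f x)%:E <= B)%E -> (\int[mu]_x (f x)%:E <= B)%E.
Proof.
move=> mf f0 mF Fnd Fcov h.
have cv := @ge0_nondecreasing_set_cvg_integral _ _ _ F (fun x : T => (f x)%:E) mu Fnd mF.
rewrite -Fcov -(cvg_lim _ (cv _ _))//; last 2 first.
- by move=> n; apply/measurable_EFinP; exact: measurable_funTS.
- by move=> n x _; rewrite lee_fin.
apply: lime_le; last by near=> n; exact: h.
apply: cvgP; apply: cv.
  by move=> n; apply/measurable_EFinP; exact: measurable_funTS.
by move=> n x _; rewrite lee_fin.
Unshelve. all: by end_near. Qed.

End NonnegativeIntegrals.

Section LocalizedFunctions.
Context {R : realType} {d : nat}.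
Local Notation V := 'rV[R]_d.
Local Notation T := (Rd R d).
Implicit Types (u w : V -> R) (x c : V) (i j : 'I_d) (s : seq V).
Local Notation E := (@unit_vec R d).
Variable mu : {measure set T -> \bar R}.
Hypothesis Hmu : is_lebesgue_measure mu.

(** Functions living on cubes of side comparable to 1 / lam, with centres [s] in rescaled
    coordinates. Pure derivatives of order m suffice, since the decay of the transform is obtained
    one coordinate at a time. *)
Record localized (m : nat) (lam C : R) s u : Prop := Localized {
  loc_Ck : Ck E m u;
  loc_bsupp : bsupp (u : T -> R);
  loc_le1 : forall x, `|u x| <= 1;
  loc_Dn : forall i x, `|Dn i m u x| <= C * lam ^+ m;
  loc_supp : forall x, u x != 0 -> exists2 c, c \in s & forall j, `|lam * x 0 j - c 0 j| <= 2 }.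

Lemma measurable_abs_coord_ge i (r : R) : measurable [set xi : T | r <= `|(xi : V) 0 i|].
Proof.
rewrite (_ : [set _ | _] = (fun xi : T => `|(xi : V) 0 i|) @^-1` [set` `[r, +oo[]).
  rewrite -[X in measurable X]setTI.
  by apply: (measurableT_comp (@normr_measurable R setT) (measurable_coord i)).
by apply/seteqP; split=> xi /=; rewrite in_itv/= andbT.
Qed.

Lemma int_sqr_covered (f : T -> R) (B lam r : R) s : bsupp f -> 0 < lam -> 0 <= r ->
  (forall x, `|f x| <= B) ->
  (forall x : T, f x != 0 -> exists2 c, c \in s & forall j, `|lam * (x : V) 0 j - c 0 j| <= r) ->
  \int[mu]_x (f x ^+ 2) <= B ^+ 2 * ((size s)%:R * (2 * (r + 1) / lam) ^+ d).
Proof.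
move=> bf lam0 r0 fB fs.
have B0 : 0 <= B by exact: le_trans (fB 0).
(* Half-side r + 1 instead of r leaves room for the boundary: the hypothesis allows equality, while
   [cube] is half-open. *)
pose Q c (x : T) : R := \1_(cube ((r + 1) / lam)) (translate (- (lam^-1 *: c)) x).
have bQ c : bsupp (Q c) by apply: bsupp_translate; exact: bsupp_cube.
have Q0 c x : 0 <= Q c x by rewrite /Q indicE.
have iQ c : \int[mu]_x Q c x = (2 * (r + 1) / lam) ^+ d.
  rewrite /Q int_translate//; last exact: bsupp_cube.
  by rewrite (int_cube Hmu) ?mulrA// divr_ge0 ?(ltW lam0)//; lra.
have bff : bsupp (fun x => f x * f x) by apply: bsuppM => //; case: bf.
have bS : bsupp (fun x => \sum_(c <- s) Q c x) by exact: bsupp_sum.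
apply: (@le_trans _ _ (\int[mu]_x (B ^+ 2 * \sum_(c <- s) Q c x))); last first.
  rewrite int_Z// int_sum//; apply: ler_wpM2l; first exact: sqr_ge0.
  rewrite (eq_bigr (fun=> (2 * (r + 1) / lam) ^+ d)); last by move=> c _; exact: iQ.
  rewrite le_eqVlt; apply/orP; left; apply/eqP; move: (_ ^+ d) => K; elim: (s) => [|c s' ih].
    by rewrite big_nil mul0r.
  by rewrite big_cons ih /= -natr1 mulrDl mul1r [RHS]addrC.
under eq_Rintegral do rewrite expr2.
apply: int_le => //; first exact: bsuppZ.
move=> x; have [->|/fs[c cs hc]] := eqVneq (f x) 0.
  by rewrite mul0r mulr_ge0 ?sqr_ge0// sumr_ge0.
have Qc : Q c x = 1.
  rewrite /Q indic1//; apply/cubeP => j; rewrite /translate !mxE.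
  have := hc j; rewrite ler_norml => /andP[h1 h2].
  rewrite (_ : _ - _ = (lam * x 0 j - c 0 j) / lam); last by field; rewrite gt_eqF.
  rewrite -mulNr ler_pM2r ?invr_gt0// ltr_pM2r ?invr_gt0//.
  by apply/andP; split; lra.
apply: (@le_trans _ _ (B ^+ 2 * 1)).
  by rewrite mulr1 -expr2 -real_normK ?num_real//; apply: lerXn2r; rewrite ?nnegrE//.
apply: ler_wpM2l; first exact: sqr_ge0.
rewrite (big_rem c)//= Qc lerDl sumr_ge0//.
Qed.

Variables (lam C : R) (s : seq V) (u : V -> R).
Hypotheses (lam0 : 0 < lam) (C0 : 0 < C).
Let m := d.+1.
Hypothesis Lu : localized m lam C s u.
(** The constant of [int_sqr_covered] for support radius m + 2: the radius 2 of [loc_supp], plus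
    room m for the spreading caused by m differences. *)
Let kap : R := (2 * (m.+2)%:R + 2) ^+ d.
Let Y : R := (size s)%:R * kap.

Let kap_gt0 : 0 < kap. Proof. by rewrite exprn_gt0//; lra. Qed.

Lemma spec_low L : (\int[mu]_(xi in cube L) (spec mu u xi)%:E <= (Y / lam ^+ d)%:E)%E.
Proof.
apply: le_trans (bessel_int Hmu L (loc_bsupp Lu)) _; rewrite lee_fin.
have := @int_sqr_covered u 1 lam m.+2%:R s (loc_bsupp Lu) lam0 (ler0n _ _) (loc_le1 Lu).
rewrite expr1n mul1r => h; apply: le_trans (h _) _.
  move=> x /(loc_supp Lu)[c cs hc]; exists c => // j; rewrite (le_trans (hc j))//.
  by rewrite ler_nat.
rewrite exprMn exprVn /Y /kap mulrA (_ : 2 * (m.+2%:R + 1) = 2 * m.+2%:R + 2)//; lra.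
Qed.

(** On this slab the m-fold difference of step 1 / (8 rho) dominates the transform of u, and its sup
    norm is at most (2h)^m C lam^m, where 2 h lam = lam / (4 rho). Bessel's inequality applied to it
    gives the decay. *)
Lemma spec_high i (rho : R) : lam <= rho ->
  (\int[mu]_(xi in cube (2 * rho) `&` [set xi : T | (rho <= `|(xi : V) 0 i|)%R]) (spec mu u xi)%:E
    <= ((C * (lam / rho) ^+ m) ^+ 2 * (Y / lam ^+ d))%:E)%E.
Proof.
move=> lr; have rho0 : 0 < rho by exact: lt_le_trans lr.
pose h := (8 * rho)^-1; have h0 : 0 <= h by rewrite invr_ge0; lra.
pose w : T -> R := iter m (dlt i h) u.
have bw : bsupp w by apply: bsupp_iter_dlt; exact: (loc_bsupp Lu).
have mc : measurable (cube (2 * rho) : set T) by exact: measurable_cube.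
have mA := measurable_abs_coord_ge i rho.
have mI := measurableI _ _ mc mA.
have ms f : bsupp f -> measurable_fun setT (spec mu f : T -> R).
  by move=> [[mf _] _]; exact: measurable_spec.
apply: (@le_trans _ _ (\int[mu]_(xi in cube (2 * rho)) (spec mu w xi)%:E)%E).
  apply: (@le_trans _ _ (\int[mu]_(xi in cube (2 * rho) `&` [set xi : T | (rho <= `|(xi : V) 0 i|)%R]) (spec mu w xi)%:E)%E).
    apply: eint_le => //; [exact: ms (loc_bsupp Lu)|exact: ms|by move=> x; exact: spec_ge0|].
    move=> xi [/cubeP cx rx]; apply: spec_dlt_ge => //; first exact: (loc_bsupp Lu).
    by rewrite rx/= ler_norml; have /andP[h1 h2] := cx i; rewrite h1 ltW.
  by apply: eint_subset => //; [exact: ms|by move=> x; exact: spec_ge0].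
apply: le_trans (bessel_int Hmu _ bw) _; rewrite lee_fin.
have wB x : `|w x| <= C * (lam / rho) ^+ m.
  have := iter_dlt_le x h0 (loc_Ck Lu) (loc_Dn Lu i).
  move=> hh; apply: (le_trans hh); rewrite mulrCA -exprMn ler_wpM2l ?(ltW C0)//.
  have q0 : 0 <= lam / rho by rewrite divr_ge0 ?ltW.
  have e : 2 * h * lam = lam / rho / 4 by rewrite /h; field; rewrite gt_eqF.
  by rewrite e; apply: lerXn2r; rewrite ?nnegrE; lra.
have := @int_sqr_covered w _ lam m.+2%:R s bw lam0 (ler0n _ _) wB.
move=> hh; apply: le_trans (hh _) _; last first.
  have -> : (2 * (m.+2%:R + 1) / lam) ^+ d = kap / lam ^+ d.
    by rewrite exprMn exprVn /kap; congr (_ ^+ d / _); lra.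
  by rewrite [_ * (kap / _)]mulrA.
move=> x /(iter_dlt_supp h0)[t ht /(loc_supp Lu)[c cs hc]]; exists c => // j.
have := hc j; rewrite !mxE eqxx /= mulrDr => hcj.
have e : lam * (x : V) 0 j - c 0 j = lam * (x : V) 0 j + lam * (t * (j == i)%:R) - c 0 j - lam * (t * (j == i)%:R) by lra.
have nm : (m.+2)%:R = 2 + m%:R :> R by rewrite -[in LHS]addn2 natrD addrC.
rewrite e nm; apply: le_trans (ler_normB _ _) _; apply: lerD => //.
rewrite normrM (gtr0_norm lam0).
have tm : `|t * (j == i)%:R| <= m%:R * h.
  rewrite normrM; apply: le_trans ht; case: (j == i); rewrite ?normr1 ?normr0 ?mulr1 ?mulr0//.
apply: le_trans (ler_wpM2l (ltW lam0) tm) _.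
rewrite mulrCA -[leRHS]mulr1 ler_wpM2l// /h ler_pdivrMr; lra.
Qed.

Definition amp (w : V -> R) (xi : V) : R := Num.sqrt (spec mu w xi).

Lemma amp_ge0 w xi : 0 <= amp w xi. Proof. exact: sqrtr_ge0. Qed.

Lemma measurable_amp (w : T -> R) : measurable_fun setT w -> measurable_fun setT (amp w : T -> R).
Proof.
move=> mw; apply: (measurableT_comp (g := spec mu w : T -> R)); last exact: measurable_spec.
by apply: continuous_measurable_fun; exact: sqrt_continuous.
Qed.

Hypothesis s0 : (0 < size s)%N.

Let Y0 : 0 < Y. Proof. by rewrite mulr_gt0// ltr0n. Qed.
Let X0 : 0 < Y / lam ^+ d. Proof. by rewrite divr_gt0// exprn_gt0. Qed.
Let mu_u : measurable_fun setT (u : T -> R). Proof. by case: (loc_bsupp Lu) => -[]. Qed.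

Lemma amp_low : (\int[mu]_(xi in cube lam) (amp u xi)%:E <= (2 ^+ d * Num.sqrt Y)%:E)%E.
Proof.
have V0 : 0 < (2 * lam) ^+ d by rewrite exprn_gt0// mulr_gt0.
have mc : measurable (cube lam : set T) by exact: measurable_cube.
have := @eint_sqrt_le _ _ mu _ _ _ _ mc (measurable_spec Hmu mu_u) (spec_ge0 mu u) X0 V0 _ (spec_low lam).
move=> h; apply: le_trans (h _) _; first by rewrite (mu_cube Hmu)// ltW.
rewrite lee_fin (_ : _ * _ = 2 ^+ d * Y); last first.
  by rewrite exprMn; field; rewrite gt_eqF// exprn_gt0.
rewrite sqrtrM ?exprn_ge0// ler_wpM2r ?sqrtr_ge0//.
have p1 : 1 <= 2 ^+ d :> R by rewrite exprn_ege1//; lra.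
rewrite -[leRHS]ger0_norm ?(le_trans _ p1)// -sqrtr_sqr ler_sqrt ?expr2; last by rewrite mulr_ge0// (le_trans _ p1).
by rewrite ler_peMl// (le_trans _ p1).
Qed.

(** Cauchy-Schwarz with volume (4 rho)^d: the decay 2^(-n(d+1)) beats the growth 2^(nd/2) of the
    root of the volume and leaves at least the summable factor 2^-n. *)
Lemma amp_high i n : (\int[mu]_(xi in cube (2 * (lam * 2 ^+ n)) `&`
    [set xi : T | (lam * 2 ^+ n <= `|(xi : V) 0 i|)%R]) (amp u xi)%:E
  <= (C * 2 ^+ d / 2 ^+ n * Num.sqrt Y)%:E)%E.
Proof.
have p1 : 1 <= 2 ^+ n :> R by rewrite exprn_ege1//; lra.
have p0 : 0 < 2 ^+ n :> R by lra.
set rho := lam * 2 ^+ n.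
have lr : lam <= rho by rewrite ler_peMr// ltW.
have rho0 : 0 < rho by exact: lt_le_trans lr.
set A := _ `&` _.
have mc : measurable (cube (2 * rho) : set T) by exact: measurable_cube.
have mA : measurable A.
  by apply: measurableI => //; exact: measurable_abs_coord_ge.
have V0 : 0 < (4 * rho) ^+ d by rewrite exprn_gt0//; lra.
have Z0 : 0 < (C * (lam / rho) ^+ m) ^+ 2 * (Y / lam ^+ d).
  by rewrite mulr_gt0// exprn_gt0// mulr_gt0// exprn_gt0// divr_gt0.
have := @eint_sqrt_le _ _ mu _ _ _ _ mA (measurable_spec Hmu mu_u) (spec_ge0 mu u) Z0 V0 _ (spec_high i lr).
move=> h; apply: le_trans (h _) _.
  apply: (@le_trans _ _ (mu (cube (2 * rho)))).
    by apply: le_measure; rewrite ?inE// => x [].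
  rewrite (mu_cube Hmu); last by rewrite mulr_ge0// ltW.
  by rewrite mulrA (_ : 2 * 2 = 4 :> R)//; lra.
rewrite lee_fin -[leRHS]ger0_norm; last first.
  by rewrite mulr_ge0 ?sqrtr_ge0// divr_ge0 ?(ltW p0)// mulr_ge0 ?(ltW C0)// exprn_ge0.
rewrite -sqrtr_sqr ler_sqrt; last by rewrite sqr_ge0.
have lr' : lam / rho = (2 ^+ n)^-1 by rewrite /rho invfM mulrA mulfV ?gt_eqF// mul1r.
set q := (2 ^+ n)^-1 in lr' *; have q0 : 0 < q by rewrite invr_gt0.
have q1 : q <= 1 by rewrite invf_le1.
have rE : rho = lam / q by rewrite /rho /q invrK.
have e4 : (4 * rho) ^+ d = (2 ^+ d) ^+ 2 * (lam ^+ d / q ^+ d).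
  rewrite rE !exprMn exprVn; congr (_ * _).
  by rewrite -exprM mulnC exprM; congr (_ ^+ d); rewrite expr2; lra.
rewrite e4 lr' (_ : q ^+ m = q ^+ d * q); last by rewrite /m exprSr.
have l0 : 0 < lam ^+ d by rewrite exprn_gt0.
have qd0 : 0 < q ^+ d by rewrite exprn_gt0.
have sY : Num.sqrt Y ^+ 2 = Y by rewrite sqr_sqrtr// ltW.
have -> : (C * 2 ^+ d * q * Num.sqrt Y) ^+ 2 = C ^+ 2 * (2 ^+ d) ^+ 2 * q ^+ 2 * Y.
  by rewrite -[in RHS]sY; ring.
have -> : (C * (q ^+ d * q)) ^+ 2 * (Y / lam ^+ d) * ((2 ^+ d) ^+ 2 * (lam ^+ d / q ^+ d)) =
   C ^+ 2 * (2 ^+ d) ^+ 2 * q ^+ 2 * Y * q ^+ d.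
  by field; rewrite !gt_eqF.
rewrite ler_piMr//; last by rewrite exprn_ile1// ltW.
by rewrite mulr_ge0 ?(ltW Y0)// !mulr_ge0// ?sqr_ge0// ltW.
Qed.

Let C1 : R := 2 ^+ d * (1 + 2 * d%:R * C).

Let C1_gt0 : 0 < C1.
Proof. by rewrite mulr_gt0 ?exprn_gt0// ltr_wpDr// !mulr_ge0// ltW. Qed.

Lemma amp_cube n : (\int[mu]_(xi in cube (lam * 2 ^+ n)) (amp u xi)%:E <= (C1 * Num.sqrt Y)%:E)%E.
Proof.
have mc r : measurable (cube r : set T) by exact: measurable_cube.
have mA i r : measurable (cube (2 * r) `&` [set xi : T | (r <= `|(xi : V) 0 i|)%R]).
  by apply: measurableI => //; exact: measurable_abs_coord_ge.
(* The induction carries the partial geometric sum 2 - 2 / 2^n, which counts the shells added so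
   far. *)
suff h : (\int[mu]_(xi in cube (lam * 2 ^+ n)) (amp u xi)%:E <=
    (2 ^+ d * (1 + d%:R * C * (2 - 2 / 2 ^+ n)) * Num.sqrt Y)%:E)%E.
  apply: (le_trans h); rewrite lee_fin ler_wpM2r ?sqrtr_ge0// /C1 ler_wpM2l ?exprn_ge0//.
  rewrite lerD2l (_ : 2 * d%:R * C = d%:R * C * 2); last by ring.
  rewrite ler_wpM2l//; first by rewrite mulr_ge0// ltW.
  by rewrite lerBlDr lerDl divr_ge0// exprn_ge0.
elim: n => [|n ih].
  by rewrite expr0 mulr1 divr1 subrr mulr0 addr0 mulr1; exact: amp_low.
have -> : lam * 2 ^+ n.+1 = 2 * (lam * 2 ^+ n) by rewrite exprS mulrCA.
set rho := lam * 2 ^+ n in ih *.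
have := @eint_cover _ _ mu _ (cube (2 * rho)) (cube rho)
  (fun i : 'I_d => cube (2 * rho) `&` [set xi : T | (rho <= `|(xi : V) 0 i|)%R]) _
  (mc _) (mc _) (fun i => mA i rho) (measurable_amp mu_u) (amp_ge0 u).
move=> h; apply: le_trans (h _) _.
  move=> xi cx; have [|/existsNP[i hi]] := pselect (forall i, `|(xi : V) 0 i| < rho).
    by move=> hx; left; apply/cubeP => i; have := hx i; rewrite ltr_norml => /andP[h1 ->]; rewrite ltW.
  by right; exists i; split => //=; rewrite leNgt; apply/negP.
apply: (@le_trans _ _ ((2 ^+ d * (1 + d%:R * C * (2 - 2 / 2 ^+ n)) * Num.sqrt Y)%:E +
   \sum_(i < d) (C * 2 ^+ d / 2 ^+ n * Num.sqrt Y)%:E)%E).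
  by apply: leeD => //; apply: lee_sum => i _; exact: amp_high.
rewrite sumEFin -EFinD lee_fin sumr_const card_ord -[X in _ + X]mulr_natl.
rewrite le_eqVlt; apply/orP; left; apply/eqP; rewrite exprS.
by field; rewrite gt_eqF// exprn_gt0.
Qed.

Lemma pairing_bound (G : T -> R) (t h : R) : measurable_fun setT G -> (forall x, 0 <= G x) ->
  0 <= t -> 0 < h ->
  (\int[mu]_x (G x ^+ 2 * \1_[set x | (t < G x)%R] x)%:E <= (h ^+ 2)%:E)%E ->
  (\int[mu]_xi (G xi * amp u xi)%:E <= (Num.sqrt Y * (C1 * t + h / Num.sqrt (lam ^+ d)))%:E)%E.
Proof.
move=> mG G0 t0 h0 hG.
have mc r : measurable (cube r : set T) by exact: measurable_cube.
have mB : measurable [set x | t < G x].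
  rewrite (_ : [set _ | _] = G @^-1` [set` `]t, +oo[]).
    by rewrite -[X in measurable X]setTI; exact: mG.
  by apply/seteqP; split=> xi /=; rewrite in_itv/= andbT.
have ma : measurable_fun setT (amp u : T -> R) by exact: measurable_amp.
have mGB : measurable_fun setT (fun x : T => G x ^+ 2 * \1_[set x : T | t < G x] x).
  by apply: measurable_funM; [exact: measurable_funX|exact: measurable_indic].
have GB0 (x : T) : 0 <= G x ^+ 2 * \1_[set x : T | t < G x] x by rewrite mulr_ge0 ?sqr_ge0// indicE.
have ms : measurable_fun setT (spec mu u : T -> R) by exact: measurable_spec.
pose F n : set T := cube (lam * 2 ^+ n).
have Fcov : \bigcup_n F n = setT.
  apply/seteqP; split=> // x _; have : (\bigcup_n cube n%:R) (x : T) by rewrite cubes_cover.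
  move=> [n _ cx]; have : n%:R / lam <= (Num.truncn (n%:R / lam)).+1%:R by rewrite ltW// truncnS_gt.
  set k := (Num.truncn _).+1 => hk; exists k => //; apply: cubeS cx.
  rewrite mulrC -ler_pdivrMr//; apply: (le_trans hk).
  by rewrite -natrX ler_nat ltnW// ltn_expl.
have Fnd : nondecreasing_seq F.
  move=> n n' nn'; apply/subsetPset; apply: cubeS; rewrite ler_wpM2l ?(ltW lam0)//.
  by rewrite ler_weXn2l//; lra.
have mGa : measurable_fun setT (fun x : T => G x * amp u x) by exact: measurable_funM.
apply: (@eint_exhaust _ _ mu F) => //; first by move=> x; rewrite mulr_ge0// amp_ge0.
  by move=> n; exact: mc.
move=> n.
(* The ratio of the two L^2 bounds, hence the optimal weight in G A <= (sg / 2) G^2 + A^2 / (2 sg)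
   on the set where G exceeds t. *)
pose sg : R := Num.sqrt (Y / lam ^+ d) / h.
have sg0 : 0 < sg by rewrite divr_gt0// sqrtr_gt0.
have mF : measurable (F n) by exact: mc.
apply: (@le_trans _ _ (\int[mu]_(x in F n) (t * amp u x +
    (sg / 2 * (G x ^+ 2 * \1_[set x | (t < G x)%R] x) + (2 * sg)^-1 * spec mu u x))%:E)%E).
  apply: eint_le => //.
  - apply: measurable_funD; first exact: measurable_funM.
    by apply: measurable_funD; exact: measurable_funM.
  - by move=> x; rewrite mulr_ge0// amp_ge0.
  move=> x _; have a0 := amp_ge0 u x.
  have sa : spec mu u x = amp u x ^+ 2 by rewrite sqr_sqrtr// spec_ge0.
  have sg2 : 0 <= (2 * sg)^-1 by rewrite invr_ge0; lra.
  have [tG|Gt] := ltP t (G x); last first.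
    rewrite (@indic0 _ _ [set x | t < G x] x) ?mulr0 ?add0r; last by move=> /=; rewrite ltNge Gt.
    by rewrite -[leLHS]addr0 lerD// ?ler_wpM2r// mulr_ge0// spec_ge0.
  rewrite (@indic1 _ _ [set x | t < G x] x)// mulr1 sa.
  apply: (@le_trans _ _ (sg / 2 * G x ^+ 2 + (2 * sg)^-1 * amp u x ^+ 2)); last by rewrite lerDr mulr_ge0.
  have : 0 <= (sg * G x - amp u x) ^+ 2 / (2 * sg) by rewrite divr_ge0 ?sqr_ge0//; lra.
  move=> h1; rewrite -subr_ge0 (_ : _ - _ = (sg * G x - amp u x) ^+ 2 / (2 * sg))//.
  by field; rewrite gt_eqF.
rewrite eintD//; last 4 first.
- exact: measurable_funM.
- by apply: measurable_funD; exact: measurable_funM.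
- by move=> x; rewrite mulr_ge0// amp_ge0.
- move=> x; rewrite addr_ge0// mulr_ge0 ?spec_ge0//; first by lra.
  by rewrite invr_ge0; lra.
rewrite eintD//; last 4 first.
- exact: measurable_funM.
- exact: measurable_funM.
- by move=> x; rewrite mulr_ge0//; lra.
- by move=> x; rewrite mulr_ge0 ?spec_ge0// invr_ge0; lra.
have i2 : 0 <= (2 * sg)^-1 by rewrite invr_ge0; lra.
have i3 : 0 <= sg / 2 by lra.
have ag := amp_ge0 u; have sg' := spec_ge0 mu u.
rewrite (eintZ mu mF ma t0 ag) (eintZ mu mF mGB i3 GB0) (eintZ mu mF ms i2 sg').
apply: (@le_trans _ _ (t%:E * (C1 * Num.sqrt Y)%:E + ((sg / 2)%:E * (h ^+ 2)%:E +
   ((2 * sg)^-1)%:E * (Y / lam ^+ d)%:E))%E).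
  apply: leeD; first by apply: lee_wpmul2l; [rewrite lee_fin|exact: amp_cube].
  apply: leeD; apply: lee_wpmul2l; rewrite ?lee_fin//; last exact: spec_low.
  by apply: le_trans hG; apply: eint_subset.
rewrite -!EFinM -!EFinD lee_fin le_eqVlt; apply/orP; left; apply/eqP.
have l0 : 0 < lam ^+ d by rewrite exprn_gt0.
rewrite mulrDr; congr (_ + _); first by ring.
rewrite /sg sqrtrM ?(ltW Y0)// sqrtrV ?(ltW l0)//.
have sY0 : 0 < Num.sqrt Y by rewrite sqrtr_gt0.
have sl0 : 0 < Num.sqrt (lam ^+ d) by rewrite sqrtr_gt0.
have sY : Y = Num.sqrt Y ^+ 2 by rewrite sqr_sqrtr// ltW.
have sl : lam ^+ d = Num.sqrt (lam ^+ d) ^+ 2 by rewrite sqr_sqrtr// ltW.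
rewrite [X in _ * (X / _)]sY [X in _ * (_ / X)]sl.
by field; rewrite !gt_eqF.
Qed.

End LocalizedFunctions.

(** * Truncation levels in Lorentz spaces *)

Section RecursiveInequalities.
Context {R : realType}.
Implicit Types (x e : nat -> R).

(** Summing the recursion compares the sum with its own shift, at the cost of the last term. As x k
    is bounded through the later x k.+1, an a priori bound B is needed for that term. *)
Lemma sum_le_forward x e (r M B : R) : 0 <= r < 1 -> (forall k, 0 <= x k <= B) ->
  (forall k, x k <= e k + r * x k.+1) -> (forall n, \sum_(k < n) e k <= M) ->
  forall n, \sum_(k < n) x k <= (M + B) / (1 - r).
Proof.
move=> /andP[r0 r1] xB xr eM n; have /andP[x0 _] := xB 0%N.
have /andP[xn0 xnB] := xB n.
have h : \sum_(k < n) x k <= M + r * \sum_(k < n) x k.+1.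
  apply: (@le_trans _ _ (\sum_(k < n) (e k + r * x k.+1))); first by apply: ler_sum.
  by rewrite big_split/= -mulr_sumr lerD2r; exact: eM.
have hs : \sum_(k < n) x k.+1 = \sum_(k < n) x k - x 0%N + x n.
  have := big_ord_recl n (fun k : 'I_n.+1 => x k) (op := +%R) (idx := 0).
  rewrite big_ord_recr/= => h2; have -> : \sum_(k < n) x k = x 0%N + \sum_(i < n) x i.+1 - x n.
    by rewrite -h2; lra.
  lra.
rewrite ler_pdivlMr; last by lra.
move: h; rewrite hs; set S := \sum_(k < n) _ => h.
have : r * (S - x 0%N + x n) <= r * S + B; last by lra.
have : r * x n <= B by apply: le_trans xnB; rewrite ler_piMl// ltW.
have : 0 <= r * x 0%N by rewrite mulr_ge0.
by lra.
Qed.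

Lemma sum_le_backward x e (r M : R) : 0 <= r < 1 -> (forall k, 0 <= x k) ->
  (forall k, x k.+1 <= r * x k + e k) -> (forall n, \sum_(k < n) e k <= M) ->
  forall n, \sum_(k < n) x k <= (M + x 0%N) / (1 - r).
Proof.
move=> /andP[r0 r1] x0 xr eM n.
have M0 : 0 <= M by have := eM 0%N; rewrite big_ord0.
rewrite ler_pdivlMr; last by lra.
case: n => [|n]; first by rewrite big_ord0 mul0r addr_ge0.
have h : \sum_(k < n) x k.+1 <= r * \sum_(k < n) x k + M.
  apply: (@le_trans _ _ (\sum_(k < n) (r * x k + e k))); first by apply: ler_sum.
  by rewrite big_split/= -mulr_sumr lerD2l; exact: eM.
have h3 : r * \sum_(k < n) x k <= r * \sum_(k < n.+1) x k.
  by rewrite ler_wpM2l// big_ord_recr/= lerDl.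
have h2 : \sum_(k < n.+1) x k = x 0%N + \sum_(k < n) x k.+1 by rewrite big_ord_recl.
by lra.
Qed.

End RecursiveInequalities.

Section MonotoneIntegrand.
Context {R : realType}.
Variables (p q : R) (m : R -> \bar R).
Hypotheses (p0 : 0 < p) (q1 : 1 <= q).
Hypothesis m0 : forall t, (0 <= m t)%E.
Hypothesis mni : forall s t, s <= t -> (m t <= m s)%E.
Local Notation lam := (@lebesgue_measure R).

Definition lorentz_integrand (t : R) : \bar R :=
  (poweR (m t * (t `^ p)%:E) (q / p) * (t^-1)%:E)%E.
Local Notation I := lorentz_integrand.

Lemma lorentz_integrand_ge0 t : 0 < t -> (0 <= I t)%E.
Proof. by move=> t0; rewrite mule_ge0 ?poweR_ge0// lee_fin invr_ge0 ltW. Qed.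

Lemma measurable_lorentz_integrand : measurable_fun (`]0, +oo[ : set R) I.
Proof.
have mm : measurable_fun setT m.
  (* Since m is nonincreasing, its superlevel sets are intervals. *)
  apply: (measurability _ (ErealGenOInfty.measurableE R)) => // _ [_ [x ->] <-].
  apply: measurableI => //; apply: is_interval_measurable => s t /=.
  rewrite !in_itv/= !andbT => fs ft u /andP[su ut].
  by rewrite in_itv/= andbT (lt_le_trans ft)// mni.
apply: (eq_measurable_fun (fun t => poweR (m t * (t `^ p)%:E) (q / p) * (t `^ (-1))%:E)%E).
  by move=> t; rewrite inE/= in_itv/= andbT => t0; rewrite /I powR_inv1// ltW.
apply: measurable_funTS; apply: emeasurable_funM.
  apply: (measurableT_comp (@measurable_poweR R (q / p))).
  by apply: emeasurable_funM => //; apply/measurable_EFinP; exact: measurable_powR.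
by apply/measurable_EFinP; exact: measurable_powR.
Qed.

(** The integrand is m^(q/p) s^(q-1), and s^(q-1) is smallest at s = a because q >= 1. *)
Lemma lorentz_integrand_lower (a b v : R) : 0 < a -> a <= b -> 0 <= v ->
  (forall s, s < b -> (v%:E <= m s)%E) ->
  ((v `^ (q / p) * ((b - a) * a `^ (q - 1)))%:E <= \int[lam]_(t in `[a, b[) I t)%E.
Proof.
move=> a0 ab v0 vm.
have sub : `[a, b[ `<=` (`]0, +oo[ : set R).
  by move=> s /=; rewrite !in_itv/= andbT => /andP[as_ _]; exact: lt_le_trans as_.
have -> : ((v `^ (q / p) * ((b - a) * a `^ (q - 1)))%:E =
    \int[lam]_(t in `[a, b[) (v `^ (q / p) * a `^ (q - 1))%:E)%E.
  rewrite integral_cst//= lebesgue_measure_itv/= lte_fin.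
  have [ab'|ba] := ltP a b; first by rewrite -EFinB -EFinM; congr (_%:E); ring.
  have -> : b = a by apply/eqP; rewrite eq_le ab ba.
  by rewrite subrr mul0r mulr0 mule0.
apply: ge0_le_integral => //.
- by move=> s _; rewrite lee_fin mulr_ge0// powR_ge0.
- by apply: measurable_funS measurable_lorentz_integrand.
move=> s /=; rewrite in_itv/= => /andP[as_ sb].
have s0 : 0 < s by exact: lt_le_trans as_.
apply: (@le_trans _ _ (poweR (v%:E * (s `^ p)%:E) (q / p) * (s^-1)%:E)%E).
  have -> : (poweR (v%:E * (s `^ p)%:E) (q / p) * (s^-1)%:E)%E =
    ((v * s `^ p) `^ (q / p) * s^-1)%:E by [].
  rewrite lee_fin powRM ?powR_ge0// -powRrM.
  rewrite (_ : p * (q / p) = q); last by field; rewrite gt_eqF.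
  rewrite -mulrA ler_wpM2l ?powR_ge0//.
  rewrite -(mulr_powRB1 (ltW s0) (lt_le_trans ltr01 q1)) mulrAC mulfV ?gt_eqF// mul1r.
  by apply: ge0_ler_powR; rewrite ?nnegrE ?subr_ge0 ?(ltW a0) ?(ltW s0).
rewrite /I lee_wpmul2r ?lee_fin ?invr_ge0 ?(ltW s0)//.
apply: gt0_ler_poweR; first by rewrite divr_ge0 ?(ltW p0)// (le_trans ler01).
- by rewrite in_itv/= andbC leey mule_ge0// lee_fin// powR_ge0.
- by rewrite in_itv/= andbC leey mule_ge0// lee_fin// powR_ge0.
by apply: lee_wpmul2r; [rewrite lee_fin powR_ge0|exact: vm].
Qed.

Variable J : R.
Hypothesis IJ : (\int[lam]_(t in `]0%R, +oo[) I t <= J%:E)%E.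

Lemma lorentz_integrand_itv (a b : R) : 0 < a -> (\int[lam]_(t in `[a, b[) I t <= J%:E)%E.
Proof.
move=> a0; apply: le_trans IJ; apply: ge0_subset_integral => //.
- exact: measurable_lorentz_integrand.
- by move=> s /=; rewrite in_itv/= andbT => s0; exact: lorentz_integrand_ge0.
by move=> s /=; rewrite !in_itv/= andbT => /andP[as_ _]; exact: lt_le_trans as_.
Qed.

(** The embedding into weak L_p: the interval [t/2, t) alone contributes this much to the Lorentz
    integral. *)
Lemma weak_type (t v : R) : 0 < t -> 0 <= v -> (forall s, s < t -> (v%:E <= m s)%E) ->
  v `^ (q / p) * (t / 2) `^ q <= J.
Proof.
move=> t0 v0 vm; have t20 : 0 < t / 2 by lra.
have t2t : t / 2 <= t by lra.
have := le_trans (lorentz_integrand_lower t20 t2t v0 vm) (lorentz_integrand_itv t t20).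
rewrite lee_fin (_ : t - t / 2 = t / 2); last by lra.
by rewrite mulr_powRB1 ?(ltW t20)// (lt_le_trans ltr01).
Qed.

(** [weak_type] solved for m t. A finite v strictly above the bound is inserted because m t could a
    priori be infinite. *)
Lemma weak_type_le (t : R) : 0 < t -> (m t <= (J `^ (p / q) / (t / 2) `^ p)%:E)%E.
Proof.
move=> t0; have q0 : 0 < q by exact: lt_le_trans ltr01 q1.
have t20 : 0 < t / 2 by lra.
set b := J `^ (p / q) / _; rewrite leNgt; apply/negP => bm.
have b0 : 0 <= b by rewrite divr_ge0 ?powR_ge0.
have [v bv vm] : exists2 v : R, b < v & (v%:E <= m t)%E.
  case: (m t) bm => [x bx| _|//]; first by exists x.
  by exists (b + 1); rewrite ?leey//; lra.
have v0 : 0 <= v by lra.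
have := weak_type t0 v0 (fun s st => le_trans vm (mni (ltW st))); apply/negP; rewrite -ltNge.
have e : v `^ (q / p) * (t / 2) `^ q = (v * (t / 2) `^ p) `^ (q / p).
  rewrite [in RHS]powRM ?powR_ge0// -powRrM; congr (_ * _ `^ _).
  by field; rewrite gt_eqF.
rewrite e ltNge; apply/negP => h.
have : (v * (t / 2) `^ p) <= J `^ (p / q).
  have pq : 0 <= p / q by rewrite divr_ge0// ltW.
  have J0 : 0 <= J by apply: le_trans h; exact: powR_ge0.
  have := ge0_ler_powR pq; move/(_ ((v * (t / 2) `^ p) `^ (q / p)) J).
  rewrite !nnegrE powR_ge0 J0 -powRrM (_ : q / p * (p / q) = 1); last first.
    by field; rewrite !gt_eqF.
  by rewrite powRr1 ?mulr_ge0 ?powR_ge0//; exact.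
by rewrite -ler_pdivlMr ?powR_gt0// leNgt bv.
Qed.

Let J0 : 0 <= J.
Proof.
have := @weak_type 1 0 ltr01 (lexx 0) (fun s _ => m0 s).
by apply: le_trans; rewrite mulr_ge0// powR_ge0.
Qed.

Variable v : nat -> R.
Hypotheses (v1 : forall k, 1 <= v k) (vnd : forall k, v k <= v k.+1).

(** The nonincreasing rearrangement at v k, that is the generalized inverse of m. The supremum of
    the empty set is 0, the right value when m never exceeds v k. *)
Definition level k : R := sup [set t | 0 < t /\ ((v k)%:E < m t)%E].

Let has_ub_level k : has_ubound [set t | 0 < t /\ ((v k)%:E < m t)%E].
Proof.
exists (2 * (1 + J)) => t [t0 vt].
have v0 : 0 <= v k by exact: le_trans (v1 k).
have := @weak_type t (v k) t0 v0 (fun s st => ltW (lt_le_trans vt (mni (ltW st)))).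
have J0' := J0; move=> h; have [t1|t1] := leP (t / 2) 1; first by lra.
have : t / 2 <= J; last by lra.
apply: le_trans h; apply: (@le_trans _ _ ((t / 2) `^ q)); first by rewrite le1r_powR// ltW.
rewrite -[leLHS]mul1r ler_wpM2r ?powR_ge0// -[leLHS](powRr0 (v k)) ler_powR//.
by rewrite divr_ge0 ?(ltW p0)// (le_trans ler01).
Qed.

Lemma level_ge0 k : 0 <= level k.
Proof.
rewrite /level; set A := [set _ | _]; have [[t At]|A0] := pselect (A !=set0).
  by apply: (@le_trans _ _ t); [case: At => /ltW|apply: ub_le_sup => //; exact: has_ub_level].
by rewrite (_ : A = set0) ?sup0//; apply/eqP/negP => /negP/set0P.
Qed.

Lemma level_le k t : 0 < t -> level k < t -> (m t <= (v k)%:E)%E.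
Proof.
move=> t0; apply: contraTT; rewrite -ltNge -leNgt => h.
by apply: ub_le_sup; [exact: has_ub_level|].
Qed.

Lemma level_gt k t : 0 < level k -> t < level k -> ((v k)%:E < m t)%E.
Proof.
move=> l0 tl; have [As|A0] := pselect ([set t | 0 < t /\ ((v k)%:E < m t)%E] !=set0).
  have kt : 0 < level k - t by rewrite subr_gt0.
  have [u [u0 vu] tu] := sup_adherent kt (conj As (has_ub_level k)).
  apply: lt_le_trans vu _; apply: mni; rewrite ltW//.
  by apply: le_lt_trans tu; rewrite /level; lra.
exfalso; move: l0; rewrite /level (_ : [set t | _] = set0) ?sup0 ?ltxx//.
by apply/eqP/negP => /negP/set0P.
Qed.

Lemma level_ni k : level k.+1 <= level k.
Proof.
rewrite leNgt; apply/negP => h.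
have [t t1 t2] : exists2 t, level k < t & t < level k.+1.
  by exists ((level k + level k.+1) / 2); lra.
have t0 : 0 < t := le_lt_trans (level_ge0 k) t1.
have := level_gt (lt_trans t0 t2) t2; rewrite ltNge => /negP; apply.
by rewrite (le_trans (level_le t0 t1))// lee_fin.
Qed.

(** The a priori bound that [sum_le_forward] requires in [sum_levels]. *)
Lemma level_bound k : v k `^ (q / p) * level k `^ q <= 2 `^ q * J.
Proof.
have q0 : q != 0 by rewrite gt_eqF// (lt_le_trans ltr01).
have := level_ge0 k; rewrite le_eqVlt => /orP[/eqP <-|l0].
  by rewrite powR0// mulr0 mulr_ge0// powR_ge0.
have vk0 : 0 <= v k := le_trans ler01 (v1 k).
have := weak_type l0 vk0 (fun s sl => ltW (level_gt l0 sl)) .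
have {2}-> : level k = 2 * (level k / 2) by lra.
rewrite (powRM q (ler0n _ 2)) ?divr_ge0 ?(ltW l0)// => h.
by rewrite mulrCA; apply: ler_wpM2l => //; exact: powR_ge0.
Qed.

Let IL k : \bar R := (\int[lam]_(t in `]level k.+1, level k]) I t)%E.

Let sub_level (a b : R) : 0 <= a -> `]a, b] `<=` (`]0, +oo[ : set R).
Proof.
by move=> a0 s /=; rewrite !in_itv/= andbT => /andP[h _]; exact: le_lt_trans h.
Qed.

Let I_ge0 (a b t : R) : 0 <= a -> `]a, b]%classic t -> (0 <= I t)%E.
Proof.
by move=> a0 /(sub_level a0); rewrite /= in_itv/= andbT; exact: lorentz_integrand_ge0.
Qed.

Let mI (a b : R) : 0 <= a -> measurable_fun (`]a, b] : set R) I.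
Proof.
by move=> a0; apply: measurable_funS measurable_lorentz_integrand => //; exact: sub_level.
Qed.

Lemma sum_level_integrals n : (\sum_(k < n) IL k <= J%:E)%E.
Proof.
apply: (@le_trans _ _ (\int[lam]_(t in `]level n, level 0]) I t)%E); last first.
  apply: le_trans IJ; apply: ge0_subset_integral => //.
  - exact: measurable_lorentz_integrand.
  - by move=> s /=; rewrite in_itv/= andbT => s0; exact: lorentz_integrand_ge0.
  by apply: sub_level; exact: level_ge0.
have aux (x y z : \bar R) : (x <= z -> x + y <= y + z)%E by move=> h; rewrite addeC leeD2l.
elim: n => [|n ih].
  by rewrite big_ord0 integral_ge0// => t; apply: I_ge0; exact: level_ge0.
have ln0 : level n <= level 0.
  by elim: (n) => [|i hi]//; apply: le_trans (level_ni i) hi.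
have e : `]level n.+1, level 0]%classic = `]level n.+1, level n] `|` `]level n, level 0] :> set R.
  by rewrite -[RHS]itv_bndbnd_setU// bnd_simp ?level_ni.
have -> : (\int[lam]_(t in `]level n.+1, level 0]) I t =
    IL n + \int[lam]_(t in `]level n, level 0]) I t)%E.
  rewrite e; apply: ge0_integral_setU => //; rewrite -?e.
  - by apply: mI; exact: level_ge0.
  - by move=> s; apply: I_ge0; exact: level_ge0.
  apply/disj_setPS => s [] /=; rewrite !in_itv/= => /andP[_ h1] /andP[h2 _].
  by move: (le_lt_trans h1 h2); rewrite ltxx.
by rewrite big_ord_recr; apply: aux ih.
Qed.

Let IL_ge0 k : (0 <= IL k)%E.
Proof. by apply: integral_ge0 => t; apply: I_ge0; exact: level_ge0. Qed.

Let IL_fin k : IL k \is a fin_num.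
Proof.
rewrite ge0_fin_numE//; apply: le_lt_trans (ltry J).
apply: le_trans (sum_level_integrals k.+1); rewrite big_ord_recr/= leeDr// sume_ge0//.
Qed.

(* Either [level k.+1 < kap * level k], and the integral over that gap dominates the k-th term, or the
   k-th term is at most [kap^q] times the next one; [sum_le_forward] then sums the alternatives. *)
Lemma sum_levels (D : R) : 1 < D -> (forall k, v k.+1 = D * v k) ->
  exists M, forall n, \sum_(k < n) (v k `^ (q / p) * level k `^ q) <= M.
Proof.
move=> D1 vD; have q0 : 0 < q by exact: lt_le_trans ltr01 q1.
have D0 : 0 < D by lra.
have p0' := p0; have q1' := q1.
(* Passing from k to k + 1 gains D^(q/p) = kap^(-2q) from v. If the level drops by a factor no
   smaller than kap, at most kap^-q of this is lost, so the k-th term is at most kap^q times the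
   next. *)
pose kap := D `^ (- (2 * p)^-1).
have k0 : 0 < kap by rewrite powR_gt0.
have k1 : kap < 1.
  have : 0 < (2 * p)^-1 by rewrite invr_gt0 mulr_gt0.
  move=> h; rewrite /kap powRN invf_lt1 ?powR_gt0// -[ltLHS](powRr0 D).
  by rewrite /powR gt_eqF// ltr_expR mul0r mulr_gt0// ln_gt0.
pose c := ((1 - kap) * kap `^ (q - 1)).
have c0 : 0 < c by rewrite mulr_gt0 ?powR_gt0//; lra.
have r1 : kap `^ q < 1.
  have <- : 1 `^ q = 1 :> R by rewrite powR1.
  by apply: gt0_ltr_powR; rewrite ?nnegrE ?(ltW k0).
exists ((c^-1 * J + 2 `^ q * J) / (1 - kap `^ q)).
apply: (@sum_le_forward _ (fun k => v k `^ (q / p) * level k `^ q) (fun k => c^-1 * fine (IL k))).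
- by rewrite powR_ge0 r1.
- by move=> k; rewrite level_bound mulr_ge0 ?powR_ge0.
- move=> k; have e0 : 0 <= c^-1 * fine (IL k) by rewrite mulr_ge0 ?fine_ge0// invr_ge0 ltW.
  have vk : 0 <= v k := le_trans ler01 (v1 k).
  have [h|h] := leP (kap * level k) (level k.+1).
    apply: (@le_trans _ _ (kap `^ q * (v k.+1 `^ (q / p) * level k.+1 `^ q))); last by rewrite lerDr.
    apply: (@le_trans _ _ (kap `^ q * (v k.+1 `^ (q / p) * (kap * level k) `^ q))); last first.
      rewrite !ler_wpM2l ?powR_ge0//; apply: ge0_ler_powR; rewrite ?nnegrE ?level_ge0 ?(ltW q0)//.
      by rewrite mulr_ge0 ?level_ge0// ltW.
    rewrite vD !powRM ?level_ge0 ?(ltW D0) ?(ltW k0)//.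
    rewrite le_eqVlt; apply/orP; left; apply/eqP.
    have e : kap `^ q * kap `^ q * D `^ (q / p) = 1.
      rewrite /kap -!powRrM -!powRD ?(gt_eqF D0) ?implybT//.
      by rewrite (_ : _ + _ = 0) ?powRr0//; field; rewrite gt_eqF.
    by rewrite -[LHS]mul1r -e; ring.
  have l0 : 0 < level k.
    rewrite lt_neqAle level_ge0 andbT; apply/eqP => l0; move: h; rewrite -l0 mulr0.
    by rewrite ltNge level_ge0.
  have kl0 : 0 < kap * level k by rewrite mulr_gt0.
  have kl1 : kap * level k <= level k by rewrite ler_piMl// ltW.
  have := lorentz_integrand_lower kl0 kl1 vk (fun s sl => ltW (level_gt l0 sl)).
  move=> lo; apply: (@le_trans _ _ (c^-1 * fine (IL k))); last first.
    by rewrite lerDl !mulr_ge0// ?powR_ge0.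
  rewrite ler_pdivlMl// -lee_fin fineK//.
  apply: (@le_trans _ _ (\int[lam]_(t in `[(kap * level k)%R, level k[) I t)%E); last first.
    apply: ge0_subset_integral => //; first by apply: mI; exact: level_ge0.
      by move=> t; apply: I_ge0; exact: level_ge0.
    move=> s /=; rewrite !in_itv/= => /andP[h1 h2]; rewrite (ltW h2) andbT.
    exact: lt_le_trans h1.
  apply: le_trans lo; rewrite lee_fin le_eqVlt; apply/orP; left; apply/eqP.
  rewrite powRM ?(ltW k0) ?(ltW l0)// /c -(mulr_powRB1 (ltW l0) q0).
  ring.
move=> n; rewrite -mulr_sumr ler_wpM2l ?invr_ge0 ?(ltW c0)//.
rewrite -lee_fin -sumEFin; apply: le_trans (sum_level_integrals n).
by apply: lee_sum => i _; rewrite fineK.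
Qed.

End MonotoneIntegrand.

Section PowerInequalities.
Context {R : realType}.
Implicit Types (x e q : R).

(** Take s strictly between rho and 1: either e <= (s - rho) x and the sum is at most s x, or x is
    bounded by a multiple of e. This turns a linear contraction into one for q-th powers. *)
Lemma powR_contract (rho q : R) : 0 <= rho < 1 -> 1 <= q ->
  exists r C : R, [/\ 0 <= r < 1, 0 <= C &
    forall x e, 0 <= x -> 0 <= e -> (rho * x + e) `^ q <= r * x `^ q + C * e `^ q].
Proof.
move=> /andP[r0 r1] q1; pose s := (1 + rho) / 2.
have s0 : 0 <= s by rewrite /s; lra.
have s1 : s < 1 by rewrite /s; lra.
have sr : 0 < s - rho by rewrite /s; lra.
have q0 : 0 <= q by lra.
exists (s `^ q), (((s - rho)^-1 + 1) `^ q); split; rewrite ?powR_ge0//=.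
  have <- : 1 `^ q = 1 :> R by rewrite powR1.
  by apply: gt0_ltr_powR; rewrite ?nnegrE//; lra.
move=> x e x0 e0; have [h|h] := leP e ((s - rho) * x).
  apply: (@le_trans _ _ ((s * x) `^ q)); last first.
    by rewrite powRM// lerDl mulr_ge0// powR_ge0.
  apply: ge0_ler_powR => //; rewrite ?nnegrE; [|exact: mulr_ge0|].
    by rewrite addr_ge0// mulr_ge0.
  by move: h; rewrite mulrBl; lra.
have i0 : 0 <= (s - rho)^-1 by rewrite invr_ge0 ltW.
apply: (@le_trans _ _ ((((s - rho)^-1 + 1) * e) `^ q)); last first.
  by rewrite powRM ?addr_ge0// lerDr mulr_ge0// powR_ge0.
apply: ge0_ler_powR => //; rewrite ?nnegrE; [by rewrite addr_ge0// mulr_ge0|by rewrite mulr_ge0// addr_ge0|].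
rewrite mulrDl mul1r lerD2r.
apply: (@le_trans _ _ x); first by rewrite ler_piMl// ltW.
by rewrite ler_pdivlMl// ltW.
Qed.

Lemma powR_add_le x e q : 0 <= x -> 0 <= e -> 1 <= q ->
  (x + e) `^ q <= 2 `^ q * (x `^ q + e `^ q).
Proof.
move=> x0 e0 q1; have q0 : 0 <= q by lra.
have aux (a b : R) : 0 <= a -> a <= b -> (a + b) `^ q <= 2 `^ q * (a `^ q + b `^ q).
  move=> a0 ab; have b0 : 0 <= b by lra.
  apply: (@le_trans _ _ ((2 * b) `^ q)).
    by apply: ge0_ler_powR; rewrite ?nnegrE ?mulr_ge0 ?addr_ge0//; lra.
  by rewrite powRM// ler_wpM2l ?powR_ge0// lerDr powR_ge0.
have [xe|ex] := leP x e; first exact: aux.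
by rewrite addrC [X in _ * X]addrC; apply: aux => //; exact: ltW.
Qed.

Lemma exprn_powR (a s : R) k : 0 <= a -> (a ^+ k) `^ s = (a `^ s) ^+ k.
Proof. by move=> a0; rewrite -powR_mulrn// powRAC powR_mulrn// powR_ge0. Qed.

Lemma sum_geometric_le (r : R) n : 0 <= r < 1 -> \sum_(k < n) r ^+ k <= (1 - r)^-1.
Proof.
move=> /andP[r0 r1].
have := @sum_le_backward _ (fun k => r ^+ k) (fun=> 0) r 0 _ _ _ _ n.
rewrite expr0 add0r div1r; apply.
- by rewrite r0.
- by move=> k; exact: exprn_ge0.
- by move=> k; rewrite exprS addr0.
- by move=> j; rewrite big1.
Qed.

End PowerInequalities.

(** * Levels and square-integrable tails of a Lorentz function *)

Section LorentzLevels.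
Context {R : realType} {d : nat}.
Local Notation T := (Rd R d).
Variable mu : {measure set T -> \bar R}.
Variable G : T -> R.
Hypotheses (mG : measurable_fun setT G) (G0 : forall x, 0 <= G x).

Let mge t : measurable [set x | t <= G x].
Proof.
rewrite (_ : [set _ | _] = G @^-1` [set` `[t, +oo[]).
  by rewrite -[X in measurable X]setTI; exact: mG.
by apply/seteqP; split=> xi /=; rewrite in_itv/= andbT.
Qed.

Let mgt t : measurable [set x | t < G x].
Proof.
rewrite (_ : [set _ | _] = G @^-1` [set` `]t, +oo[]).
  by rewrite -[X in measurable X]setTI; exact: mG.
by apply/seteqP; split=> xi /=; rewrite in_itv/= andbT.
Qed.

Let mlt t : measurable [set x | G x < t].
Proof.
rewrite (_ : [set _ | _] = G @^-1` [set` `]-oo, t[]).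
  by rewrite -[X in measurable X]setTI; exact: mG.
by apply/seteqP; split=> xi /=; rewrite in_itv/=.
Qed.

Lemma distrib_fun_ni s t : s <= t -> (distrib_fun mu G t <= distrib_fun mu G s)%E.
Proof.
move=> st; apply: le_measure; rewrite ?inE; [exact: mge|exact: mge|].
by move=> x /=; exact: le_trans.
Qed.

(** [distrib_fun] uses closed superlevel sets and the truncation strict ones; {G > c} is the
    increasing union of the sets {G >= c + 1 / (n + 1)}. *)
Lemma measure_gt_le (c v : R) : (forall t, c < t -> (distrib_fun mu G t <= v%:E)%E) ->
  (mu [set x | (c < G x)%R] <= v%:E)%E.
Proof.
move=> h; pose F n := [set x | c + n.+1%:R^-1 <= G x].
have FE : \bigcup_n F n = [set x | c < G x].
  apply/seteqP; split=> [x [n _] /=|x /= cx].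
    by apply: lt_le_trans; rewrite ltrDl invr_gt0.
  have h0 : 0 < G x - c by rewrite subr_gt0.
  exists (Num.truncn (G x - c)^-1) => //; rewrite /F /= -lerBrDl.
  by rewrite invf_ple ?posrE// ltW// truncnS_gt.
have mF n : measurable (F n) by exact: mge.
have Fnd : nondecreasing_seq F.
  move=> n n' nn'; apply/subsetPset => x /=; apply: le_trans.
  by rewrite lerD2l lef_pV2 ?posrE// ler_nat.
have := @nondecreasing_cvg_mu _ _ _ mu F mF _ Fnd.
rewrite FE => /(_ (mgt c)) cv; rewrite -(cvg_lim _ cv)//.
apply: lime_le; first by apply: cvgP cv.
by near=> n; apply: h; rewrite ltrDl invr_gt0.
Unshelve. all: by end_near. Qed.

Let trunc c (x : T) : R := G x ^+ 2 * \1_[set x : T | c < G x] x.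

Let mtrunc c : measurable_fun setT (trunc c).
Proof. by apply: measurable_funM; [exact: measurable_funX|exact: measurable_indic]. Qed.

Let trunc_ge0 c x : 0 <= trunc c x.
Proof. by rewrite mulr_ge0 ?sqr_ge0// indicE. Qed.

Let truncT c x : c < G x -> trunc c x = G x ^+ 2.
Proof. by move=> h; rewrite /trunc indicE mem_set// mulr1. Qed.

Let truncF c x : G x <= c -> trunc c x = 0.
Proof. by move=> h; rewrite /trunc indicE memNset/= ?mulr0//; apply/negP; rewrite -leNgt. Qed.

(** Lowering the threshold from c to c' adds at most c^2 v, and h^2 + c^2 v <= (h + c sqrt v)^2.
    Stated with squares, the recursion for h becomes linear. *)
Lemma trunc_sqr_step (c c' v h : R) : c' <= c -> 0 <= v -> 0 <= c -> 0 <= h ->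
  (mu [set x | (c' < G x)%R] <= v%:E)%E ->
  (\int[mu]_x (trunc c x)%:E <= (h ^+ 2)%:E)%E ->
  (\int[mu]_x (trunc c' x)%:E <= ((h + c * Num.sqrt v) ^+ 2)%:E)%E.
Proof.
move=> cc v0 c0 h0 muc ih.
have m1 : measurable_fun setT (\1_[set x | c' < G x] : T -> R) by exact: measurable_indic.
have p1 (x : T) : 0 <= \1_[set x | c' < G x] x :> R by rewrite indicE.
have m2 : measurable_fun setT (fun x : T => c ^+ 2 * \1_[set x | c' < G x] x) by exact: measurable_funM.
have p2 (x : T) : 0 <= c ^+ 2 * \1_[set x | c' < G x] x by rewrite mulr_ge0 ?sqr_ge0.
apply: (@le_trans _ _ (\int[mu]_x (trunc c x + c ^+ 2 * \1_[set x | (c' < G x)%R] x)%:E)%E).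
  apply: eint_le => //; first exact: measurable_funD.
  move=> x _; have [h1|h1] := leP (G x) c'; first by rewrite truncF// addr_ge0.
  rewrite truncT// indicE mem_set// mulr1; have [h2|h2] := leP (G x) c.
    by rewrite truncF// add0r; apply: lerXn2r; rewrite ?nnegrE.
  by rewrite truncT// lerDl sqr_ge0.
rewrite (eintD mu measurableT (mtrunc c) m2 (trunc_ge0 c) p2).
rewrite (eintZ mu measurableT m1 (sqr_ge0 c) p1) integral_indic// setIT.
apply: (@le_trans _ _ ((h ^+ 2)%:E + (c ^+ 2)%:E * v%:E)%E).
  by apply: leeD => //; apply: lee_wpmul2l; rewrite ?lee_fin ?sqr_ge0.
rewrite -EFinM -EFinD lee_fin -{1}(sqr_sqrtr v0).
have : 0 <= h * (c * Num.sqrt v) by rewrite !mulr_ge0 ?sqrtr_ge0.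
move: (Num.sqrt v) => s; nra.
Qed.

(** The part where G < 1 contributes at most v, and the slice 2^j <= G < 2^(j+1) at most 4^(j+1) K
    (r / 4)^j = 4 K r^j. *)
Lemma trunc_sqr_base (c v K r : R) : 0 <= r < 1 -> 0 <= K -> 0 <= v -> 
  (mu [set x | (c < G x)%R] <= v%:E)%E ->
  (forall j, distrib_fun mu G (2 ^+ j) <= (K * (r / 4) ^+ j)%:E)%E ->
  (\int[mu]_x (trunc c x)%:E <= (v + 4 * K / (1 - r))%:E)%E.
Proof.
move=> r01 K0 v0 muc mK; have /andP[r0 r1] := r01.
pose F n := [set x | G x < 2 ^+ n].
have mF n : measurable (F n) by exact: mlt.
apply: (@eint_exhaust _ _ mu F) => //.
- move=> n n' nn'; apply/subsetPset => x /= h; apply: (lt_le_trans h).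
  by rewrite ler_weXn2l//; lra.
- apply/seteqP; split=> // x _; exists (Num.truncn (G x)).+1 => //=.
  apply: lt_le_trans (truncnS_gt _) _.
  by rewrite -natrX ler_nat ltnW// ltn_expl.
suff h n : (\int[mu]_(x in F n) (trunc c x)%:E <= (v + 4 * K * \sum_(j < n) r ^+ j)%:E)%E.
  move=> n; apply: (le_trans (h n)); rewrite lee_fin lerD2l ler_wpM2l ?mulr_ge0//.
  exact: sum_geometric_le.
elim: n => [|n ih].
  rewrite big_ord0 mulr0 addr0.
  apply: (@le_trans _ _ (\int[mu]_(x in F 0%N) (\1_[set x | (c < G x)%R] x)%:E)%E).
    apply: eint_le => //.
    move=> x; rewrite /F/= expr0 => Gx; have [h1|h1] := leP (G x) c; first by rewrite truncF// indicE.
    by rewrite truncT// indicE mem_set// expr_le1// ltW.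
  rewrite integral_indic//; apply: le_trans muc.
  by apply: le_measure; rewrite ?inE//; exact: measurableI.
have := @eint_cover _ _ mu 'I_1 (F n.+1) (F n) (fun=> F n.+1 `&` [set x | 2 ^+ n <= G x]) (trunc c)
  (mF _) (mF _) (fun=> measurableI _ _ (mF _) (mge _)) (mtrunc c) (trunc_ge0 c).
move=> h; apply: le_trans (h _) _.
  move=> x Fx; have [h1|h1] := ltP (G x) (2 ^+ n); first by left.
  by right; exists ord0.
have -> : (v + 4 * K * \sum_(j < n.+1) r ^+ j)%:E =
    ((v + 4 * K * \sum_(j < n) r ^+ j)%:E + (4 * K * r ^+ n)%:E)%E.
  by rewrite -EFinD big_ord_recr/= mulrDr addrA.
rewrite big_ord1; apply: leeD; first exact: ih.
set B := F n.+1 `&` _; have mB : measurable B by exact: measurableI.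
apply: (@le_trans _ _ (\int[mu]_(x in B) ((2 ^+ n.+1) ^+ 2)%:E)%E).
  apply: eint_le => // x [Fx _]; rewrite /trunc -[leRHS]mulr1; apply: ler_pM; rewrite ?sqr_ge0 ?indicE//.
    by apply: lerXn2r; rewrite ?nnegrE ?exprn_ge0// ltW.
  by case: (_ \in _).
rewrite integral_cst//.
apply: (@le_trans _ _ (((2 ^+ n.+1) ^+ 2)%:E * (K * (r / 4) ^+ n)%:E)%E).
  apply: lee_wpmul2l; first by rewrite lee_fin sqr_ge0.
  by apply: le_trans (mK n); apply: le_measure; rewrite ?inE// => x [].
rewrite -EFinM lee_fin le_eqVlt; apply/orP; left; apply/eqP.
have -> : (2 ^+ n.+1) ^+ 2 = 4 * 4 ^+ n :> R.
  by rewrite -exprM mulnC exprM exprS; have -> : 2 ^+ 2 = 4 :> R by rewrite expr2; lra.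
rewrite expr_div_n.
have : (4 : R) ^+ n != 0 by rewrite expf_neq0.
by move=> e4; field.
Qed.

(* The factor [((2^d)^(1/p))^k] is 2^(kd/p). *)
Lemma lorentz_levels (p q : R) : (0 < d)%N -> 2 < p -> 1 <= q ->
  (lorentz_norm_q mu p q G < +oo)%E ->
  exists (t h : nat -> R) (M : R), [/\ forall k, 0 <= t k, forall k, 0 < h k,
    forall k, (\int[mu]_x (G x ^+ 2 * \1_[set x | (t k < G x)%R] x)%:E <= (h k ^+ 2)%:E)%E &
    forall n, \sum_(k < n) (((2 ^+ d) `^ p^-1) ^+ k *
      (t k + h k / Num.sqrt ((2 ^+ k) ^+ d))) `^ q <= M].
Proof.
move=> d0 p2 q1 Lfin; have p0 : 0 < p by lra.
have q0 : 0 < q by lra.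
pose m := distrib_fun mu G.
have m0 t : (0 <= m t)%E by exact: measure_ge0.
have [J IJ] : exists J : R, (\int[@lebesgue_measure R]_(t in `]0%R, +oo[) lorentz_integrand p q m t <= J%:E)%E.
  move: Lfin; rewrite /lorentz_norm_q; set X := (\int[_]_(_ in _) _)%E => Lfin.
  have X0 : (0 <= X)%E.
    by apply: integral_ge0 => t /=; rewrite in_itv/= andbT => t0; exact: lorentz_integrand_ge0.
  have Xf : X \is a fin_num.
    rewrite ge0_fin_numE// ltey; apply/eqP => XE; move: Lfin.
    by rewrite XE gt0_muley ?lte_fin// ltxx.
  by exists (fine X); rewrite fineK.
pose v k : R := (2 ^+ k) ^+ d.
have v1 k : 1 <= v k by rewrite exprn_ege1// exprn_ege1//; lra.
have vD k : v k.+1 = 2 ^+ d * v k by rewrite /v exprS exprMn.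
have D1 : 1 < 2 ^+ d :> R by rewrite exprn_egt1//; [rewrite -lt0n|lra].
have vnd k : v k <= v k.+1 by rewrite vD ler_peMl ?(ltW D1)// (le_trans ler01).
pose t := level m v.
have t0 k : 0 <= t k := level_ge0 p0 q1 m0 distrib_fun_ni IJ v1 k.
have [Ms hMs] := sum_levels p0 q1 m0 distrib_fun_ni IJ v1 vnd D1 vD.
have mut k : (mu [set x | (t k < G x)%R] <= (v k)%:E)%E.
  apply: measure_gt_le => s ts; apply: (level_le p0 q1 m0 distrib_fun_ni IJ v1 _ ts).
  exact: le_lt_trans (t0 k) ts.
have tni k : t k.+1 <= t k := level_ni p0 q1 m0 distrib_fun_ni IJ v1 vnd k.
(* The assumption p > 2 makes r < 1, so the dyadic slices of G^2 are summable. *)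
pose r : R := 4 / 2 `^ p.
have p4 : 4 < 2 `^ p :> R.
  have -> : 4 = 2 `^ 2 :> R by rewrite (powR_mulrn 2) ?expr2; lra.
  by rewrite /powR gt_eqF// ltr_expR ltr_pM2r// ln_gt0//; lra.
have r01 : 0 <= r < 1.
  by rewrite divr_ge0 ?powR_ge0//= ltr_pdivrMr ?powR_gt0// mul1r.
pose K : R := J `^ (p / q) * 2 `^ p.
have K0 : 0 <= K by rewrite mulr_ge0 ?powR_ge0.
have mK j : (distrib_fun mu G (2 ^+ j) <= (K * (r / 4) ^+ j)%:E)%E.
  have j0 : 0 < 2 ^+ j :> R by exact: exprn_gt0.
  apply: (le_trans (weak_type_le p0 q1 m0 distrib_fun_ni IJ j0)); rewrite lee_fin.
  rewrite le_eqVlt; apply/orP; left; apply/eqP.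
  have -> : r / 4 = (2 `^ p)^-1 by rewrite /r; field; rewrite gt_eqF// powR_gt0.
  rewrite powRM ?invr_ge0 ?(ltW j0)// exprn_powR// exprVn.
  have -> : 2^-1 `^ p = (2 `^ p)^-1 :> R by rewrite -powR_inv1// -powRrM mulN1r powRN.
  have P0 : 0 < 2 `^ p :> R by rewrite powR_gt0.
  by rewrite /K; field; rewrite expf_neq0 gt_eqF.
have base := trunc_sqr_base r01 K0 (le_trans ler01 (v1 0%N)) (mut 0%N) mK.
set B := _ + _ in base.
have B0 : 0 < B.
  have /andP[_ r1] := r01; rewrite /B ltr_wpDr ?(lt_le_trans ltr01)//.
  by apply: divr_ge0; [exact: mulr_ge0|rewrite subr_ge0 ltW].
(* The recursion of [trunc_sqr_step] for the step from level t i to level t i.+1, started at the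
   bound [base]. *)
pose h := fix h k := if k is i.+1 then h i + t i * Num.sqrt (v i.+1) else Num.sqrt B.
have h0 k : 0 < h k.
  by elim: k => [|k ih] /=; rewrite ?sqrtr_gt0// ltr_wpDr// mulr_ge0 ?sqrtr_ge0.
have hint k : (\int[mu]_x (trunc (t k) x)%:E <= (h k ^+ 2)%:E)%E.
  elim: k => [|k ih]; first by rewrite /= sqr_sqrtr// ltW.
  by apply: trunc_sqr_step ih; rewrite ?(ltW (h0 k))// (le_trans ler01).
pose w : R := (2 ^+ d) `^ p^-1; pose sg : R := Num.sqrt (2 ^+ d).
have w0 : 0 < w by apply: powR_gt0; apply: lt_trans D1.
have sg0 : 0 < sg by rewrite sqrtr_gt0; apply: lt_trans D1.
have vE k : v k = (2 ^+ d) ^+ k by rewrite /v -!exprM mulnC.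
have sgE k : Num.sqrt (v k) = sg ^+ k.
  by rewrite -[RHS]ger0_norm ?exprn_ge0 ?(ltW sg0)// -sqrtr_sqr -exprM mulnC exprM sqr_sqrtr ?vE// (le_trans ler01)// ltW.
(* Here p > 2 gives 2^(d/p) < 2^(d/2), so the normalized tails [y] contract with ratio w / sg. *)
have wsg : w < sg.
  rewrite /w /sg -powR12_sqrt; last by rewrite (le_trans ler01)// ltW.
  rewrite /powR gt_eqF ?(lt_trans ltr01)// ltr_expR ltr_pM2r ?ln_gt0//.
  by rewrite ltf_pV2 ?posrE//; lra.
pose tau k := w ^+ k * t k; pose y k := w ^+ k * (h k / sg ^+ k).
have tau0 k : 0 <= tau k by rewrite mulr_ge0// exprn_ge0// ltW.
have y0 k : 0 <= y k by rewrite mulr_ge0 ?divr_ge0 ?exprn_ge0// ltW.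
have tauE k : tau k `^ q = v k `^ (q / p) * t k `^ q.
  rewrite /tau powRM ?exprn_ge0 ?(ltW w0)//; congr (_ * _).
  by rewrite vE -exprn_powR ?(ltW (lt_trans ltr01 D1))// -powRrM mulrC.
have yS k : y k.+1 = (w / sg) * y k + w * tau k.
  rewrite /y /tau /= sgE !exprS; field.
  by rewrite expf_neq0 gt_eqF.
have rho01 : 0 <= w / sg < 1.
  by rewrite divr_ge0 ?ltW//= ltr_pdivrMr// mul1r.
have [r' [C [r'01 C0 hC]]] := powR_contract rho01 q1.
have yq k : y k.+1 `^ q <= r' * y k `^ q + C * (w `^ q * tau k `^ q).
  by rewrite yS -(powRM q (ltW w0))//; apply: hC => //; rewrite mulr_ge0// ltW.
have Mt n : \sum_(k < n) tau k `^ q <= Ms.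
  by under eq_bigr do rewrite tauE; exact: hMs.
have Cw0 : 0 <= C * w `^ q by rewrite mulr_ge0// powR_ge0.
have e1 n : \sum_(k < n) C * (w `^ q * tau k `^ q) <= C * w `^ q * Ms.
  by under eq_bigr do rewrite mulrA; rewrite -mulr_sumr ler_wpM2l.
have My := @sum_le_backward _ (fun k => y k `^ q) (fun k => C * (w `^ q * tau k `^ q)) r' _ r'01
  (fun k => powR_ge0 _ _) yq e1.
exists t, h, (2 `^ q * (Ms + (C * w `^ q * Ms + y 0%N `^ q) / (1 - r'))); split => // n.
apply: (@le_trans _ _ (\sum_(k < n) 2 `^ q * (tau k `^ q + y k `^ q))).
  apply: ler_sum => k _; rewrite -/(v k) sgE mulrDr -/w -/(tau k) -/(y k).
  exact: powR_add_le.
by rewrite -mulr_sumr ler_wpM2l ?powR_ge0// big_split lerD// My.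
Qed.

End LorentzLevels.

(** * Decomposition along dyadic covers *)

Section DyadicCubes.
Context {R : realType} {d : nat}.
Local Notation V := 'rV[R]_d.
Implicit Types (x y : V) (n : 'rV[int]_d).

Definition center n : V := \row_i ((n 0 i)%:~R + 1 / 2).

Definition near_center y n := [forall i, `|y 0 i - center n 0 i| <= 19 / 10].

(** Being within 19/10 of n_i + 1/2 forces n_i - floor(y_i) into {-2, ..., 2}: five choices per
    coordinate. Distinctness of the cubes is essential here. *)
Lemma near_center_count y (s : seq 'rV[int]_d) : uniq s ->
  (count (near_center y) s <= 5 ^ d)%N.
Proof.
move=> us; rewrite -size_filter; set s' := [seq n <- s | near_center y n]%SEQ.
have us' : uniq s' by exact: filter_uniq.
pose off (n : 'rV[int]_d) : {ffun 'I_d -> 'I_5} := [ffun i => inord (absz (n 0 i - Num.floor (y 0 i) + 2))].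
have offE n i : n \in s' -> ((off n i : nat)%:Z = n 0 i - Num.floor (y 0 i) + 2)%R.
  rewrite mem_filter => /andP[/forallP/(_ i) + _]; rewrite mxE ler_norml => /andP[h1 h2].
  have f1 := floor_le (y 0 i); have f2 := floorD1_gt (y 0 i).
  have k1 : (-2 - 1 < n 0 i - Num.floor (y 0 i))%R.
    rewrite -(ltr_int R) rmorphB /= rmorphB /= rmorphN /=; move: h1 h2 f1 f2; lra.
  have k2 : (n 0 i - Num.floor (y 0 i) < 2 + 1)%R.
    rewrite -(ltr_int R) rmorphB /= rmorphD /=; move: h1 h2 f1 f2; rewrite rmorphD /=; lra.
  rewrite ffunE inordK; first by rewrite gez0_abs//; lia.
  by lia.
have offI : {in s' &, injective off}.
  move=> n1 n2 h1 h2 e; apply/rowP => i.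
  have := offE _ i h1; rewrite e offE// => /eqP; rewrite !(inj_eq (addIr _)) => /eqP ->//.
have us2 : uniq (map off s') by rewrite map_inj_in_uniq.
rewrite -(size_map off) -(card_uniqP us2); apply: leq_trans (max_card _) _.
by rewrite card_ffun !card_ord.
Qed.

End DyadicCubes.

Section Telescope.
Context {R : realType} {d : nat}.
Local Notation V := 'rV[R]_d.
Local Notation T := (Rd R d).
Implicit Types (x c : V) (i j : 'I_d) (n : 'rV[int]_d).
Local Notation E := (@unit_vec R d).

Variables (lam0 : R) (c0 : V) (F : nat -> seq 'rV[int]_d).
Hypothesis lam00 : 0 < lam0.
Hypothesis uF : forall k, uniq (F k).

Definition scale_compl k x : R := \prod_(n <- F k) (1 - bump (2 ^+ k) (center n) x).
Definition below_compl k x : R := \prod_(l < k) scale_compl l x.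
(** The part of the bump first captured at scale k. It equals the bump times the difference of
    consecutive [below_compl], which is why the pieces telescope. *)
Definition piece k x : R := bump lam0 c0 x * below_compl k x * (1 - scale_compl k x).

Lemma telescope_pieces N x :
  bump lam0 c0 x = bump lam0 c0 x * below_compl N x + \sum_(k < N) piece k x.
Proof.
elim: N => [|N ih]; first by rewrite /below_compl !big_ord0 mulr1 addr0.
rewrite {1}ih big_ord_recr /= [below_compl N.+1 x]big_ord_recr /= -/(below_compl N x) /piece.
ring.
Qed.

Lemma scale_compl_Ck m k : Ck E m (scale_compl k).
Proof. by apply: Ck_prod => n; apply: CkB; [exact: Ck_cst|exact: bump_Ck]. Qed.

Lemma below_compl_Ck m k : Ck E m (below_compl k).
Proof. by apply: Ck_prod => l; exact: scale_compl_Ck. Qed.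

Lemma piece_Ck m k : Ck E m (piece k).
Proof.
apply: CkM; first by apply: CkM; [exact: bump_Ck|exact: below_compl_Ck].
by apply: CkB; [exact: Ck_cst|exact: scale_compl_Ck].
Qed.

Lemma scale_compl_itv k x : 0 <= scale_compl k x <= 1.
Proof.
have h n : 0 <= 1 - bump (2 ^+ k) (center n) x <= 1.
  by have /andP[] := bump_itv (2 ^+ k) (center n) x; lra.
rewrite /scale_compl; apply/andP; split; last by apply: prodr_ile1 => n _.
by apply: prodr_ge0 => n _; case/andP: (h n).
Qed.

Lemma below_compl_itv k x : 0 <= below_compl k x <= 1.
Proof.
rewrite /below_compl; apply/andP; split; last by apply: prodr_ile1 => l _; exact: scale_compl_itv.
by apply: prodr_ge0 => l _; case/andP: (scale_compl_itv l x).
Qed.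

Lemma bump_bmeas lam c : bmeas (bump lam c : T -> R).
Proof.
split; last first.
  exists 1 => x; have /andP[h0 h1] := bump_itv lam c x.
  by rewrite ger0_norm.
apply: measurable_prod => i _.
apply: (measurableT_comp (f := chi)).
  have cc : continuous (@chi R) by exact: (Ck_continuous (chi_C1k 0)).
  exact: continuous_measurable_fun.
by apply: measurable_funB => //; apply: measurable_funM => //; exact: measurable_coord.
Qed.

Lemma bump_bsupp lam c : 0 < lam -> bsupp (bump lam c : T -> R).
Proof.
move=> l0; split; first exact: bump_bmeas.
exists ((2 + \sum_j `|c 0 j|) / lam) => x h; apply/cubeP => j.
have hj : `|lam * (x : V) 0 j - c 0 j| <= 19 / 10.
  by rewrite leNgt; apply/negP => /(bump0 (x := x)) e; rewrite e eqxx in h.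
have cj : `|c 0 j| <= \sum_j `|c 0 j| by rewrite (bigD1 j)//= lerDl sumr_ge0.
have e : (x : V) 0 j = lam * (x : V) 0 j / lam by rewrite mulrAC mulfV ?mul1r// gt_eqF.
have : `|lam * (x : V) 0 j| < 2 + \sum_j `|c 0 j|.
  have := ler_normD (lam * (x : V) 0 j - c 0 j) (c 0 j); rewrite subrK.
  by move: hj cj; lra.
rewrite ltr_norml => /andP[h1 h2].
by rewrite e -mulNr ler_pM2r ?invr_gt0// ltr_pM2r ?invr_gt0// h2 ltW.
Qed.

Lemma scale_compl_bmeas k : bmeas (scale_compl k : T -> R).
Proof. by apply: bmeas_prod => n; apply: bmeasB; [exact: bmeas_cst|exact: bump_bmeas]. Qed.

Lemma below_compl_bmeas k : bmeas (below_compl k : T -> R).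
Proof. by apply: bmeas_prod => l; exact: scale_compl_bmeas. Qed.

Lemma piece_bsupp k : bsupp (piece k : T -> R).
Proof.
apply: bsuppM; first by apply: bsuppM; [exact: bump_bsupp|exact: below_compl_bmeas].
by apply: bmeasB; [exact: bmeas_cst|exact: scale_compl_bmeas].
Qed.

(** At most 5^d factors exceed 1 at x, and each of them is at most 1 + K (t 2^k) <= exp(K (t
    2^k)). *)
Lemma jet_scale_compl i (t M : R) m k x : 0 <= t -> t * 2 ^+ k <= 1 -> 0 <= M ->
  (forall a (y : R), (a <= m)%N -> `|chin a y| <= M) ->
  jet i t m (scale_compl k) x <= expR ((5 ^ d)%:R * (m%:R * (2 ^+ m * M)) * (t * 2 ^+ k)).
Proof.
move=> t0 tk M0 hM.
have p0 : 0 <= t * 2 ^+ k by rewrite mulr_ge0// exprn_ge0.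
set K := m%:R * (2 ^+ m * M); have K0 : 0 <= K by rewrite !mulr_ge0// exprn_ge0.
pose y : V := \row_j (2 ^+ k * x 0 j).
pose a := expR (K * (t * 2 ^+ k)).
have a1 : 1 <= a by rewrite -expR0 ler_expR mulr_ge0.
have h n : jet i t m (fun z => 1 - bump (2 ^+ k) (center n) z) x <= if near_center y n then a else 1.
  case: ifPn => [_|].
    have k0 : 0 <= 2 ^+ k :> R by exact: exprn_ge0.
    have hh := @jet_bump_compl R d i t m _ (center n) x M t0 k0 tk hM.
    by apply: le_trans hh _; exact: expR_ge1Dx.
  rewrite negb_forall => /existsP[j]; rewrite -ltNge mxE => hj.
  by rewrite (@jet_bump_compl_far R d i t m _ _ x j hj).
apply: (@le_trans _ _ (\prod_(n <- F k) (if near_center y n then a else 1))).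
  apply: (le_trans (jet_prod _ _ _ t0 _)).
    by move=> n; apply: CkB; [exact: Ck_cst|exact: bump_Ck].
  by apply: ler_prod => n _; rewrite h jet_ge0.
have -> : \prod_(n <- F k) (if near_center y n then a else 1) = a ^+ count (near_center y) (F k).
  elim: (F k) => [|n s ih]; first by rewrite big_nil expr0.
  by rewrite big_cons ih /=; case: ifP; rewrite ?mul1r// exprS.
apply: (@le_trans _ _ (a ^+ (5 ^ d))).
  by apply: ler_weXn2l => //; exact: near_center_count.
by rewrite /a -expRM_natl mulrA.
Qed.

(** At t = 2^-k the scale l costs an exponent proportional to 2^(l-k), and these sum to at most 1
    over l < k; the bound involves neither k nor the cover. *)
Lemma jet_below_compl i (M : R) m k x : 0 <= M ->
  (forall a (y : R), (a <= m)%N -> `|chin a y| <= M) ->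
  jet i (2 ^- k) m (below_compl k) x <= expR ((5 ^ d)%:R * (m%:R * (2 ^+ m * M))).
Proof.
move=> M0 hM; have t0 : 0 <= 2 ^- k :> R by rewrite invr_ge0 exprn_ge0.
have k0 : 0 < 2 ^+ k :> R by exact: exprn_gt0.
set A := (5 ^ d)%:R * _; have A0 : 0 <= A by rewrite !mulr_ge0// exprn_ge0.
apply: (le_trans (jet_prod _ _ _ t0 _)); first by move=> l; exact: scale_compl_Ck.
apply: (@le_trans _ _ (\prod_(l < k) expR (A * (2 ^- k * 2 ^+ l)))).
  apply: ler_prod => l _; rewrite jet_ge0//=; apply: jet_scale_compl => //.
  rewrite mulrC ler_pdivrMr// mul1r ler_weXn2l//; last exact: ltnW.
  lra.
rewrite -expR_sum ler_expR -mulr_sumr -[leRHS]mulr1 ler_wpM2l//.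
rewrite -mulr_sumr mulrC ler_pdivrMr// mul1r.
elim: (k) => [|n ih]; first by rewrite big_ord0 expr0.
by rewrite big_ord_recr/= exprS; lra.
Qed.

End Telescope.

Section Localization.
Context {R : realType} {d : nat}.
Local Notation V := 'rV[R]_d.
Local Notation T := (Rd R d).
Implicit Types (x c : V) (i j : 'I_d) (n : 'rV[int]_d).
Local Notation E := (@unit_vec R d).

Lemma bump_localized (lam0 : R) c0 : 0 < lam0 -> exists2 C, 0 < C &
  localized d.+1 lam0 C [:: c0] (bump lam0 c0).
Proof.
move=> lam00; have [M M1 hM] := @chin_bounded R d.+1.
exists (2 ^+ d.+1 * M); first by rewrite mulr_gt0 ?exprn_gt0//; lra.
split.
- exact: bump_Ck.
- exact: bump_bsupp.
- by move=> x; have /andP[b0 b1] := bump_itv lam0 c0 x; rewrite ger0_norm.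
- move=> i x; have t0 : 0 <= lam0^-1 by rewrite invr_ge0 ltW.
  have := @jet_Dn _ _ i (lam0^-1) d.+1 (bump lam0 c0) x t0.
  rewrite exprVn mulrC ler_pdivrMr ?exprn_gt0// => h; apply: (le_trans h).
  rewrite ler_pM2r ?exprn_gt0//.
  have := @jet_bump _ _ i _ d.+1 lam0 c0 x M t0 (ltW lam00) hM.
  by rewrite mulVf ?gt_eqF// (_ : 1 + 1 = 2).
- move=> x hx; exists c0; first by rewrite inE.
  move=> j; rewrite leNgt; apply/negP => hj; move/negP: hx; apply; apply/eqP.
  by apply: (@bump0 _ _ _ _ _ j); lra.
Qed.

(** The order of quantifiers is the point: [C] is fixed before the cover [F] and the scale [k]. *)
Lemma piece_localized (lam0 : R) : 0 < lam0 -> exists2 C, 0 < C &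
  forall c0 F, (forall k, uniq (F k)) -> forall k,
  localized d.+1 (2 ^+ k) C [seq center n | n <- F k] (piece lam0 c0 F k).
Proof.
move=> lam00.
have [M M1 hM] := @chin_bounded R d.+1; have M0 : 0 <= M by lra.
pose A : R := (5 ^ d)%:R * (d.+1%:R * (2 ^+ d.+1 * M)).
have A0 : 0 < expR A by exact: expR_gt0.
(* One factor for each factor of [piece]: the bump (where lam0 2^-k <= lam0), the coarser scales,
   and one minus the complement at scale k. *)
pose C := ((1 + lam0) ^+ d.+1 * M) * expR A * (1 + expR A).
have C0 : 0 < C.
  have l1 : 0 < 1 + lam0 by rewrite addr_gt0.
  by rewrite !mulr_gt0 ?exprn_gt0//; lra.
exists C => // c0 F uF k.
have k0 : 0 < 2 ^+ k :> R by exact: exprn_gt0.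
have t0 : 0 <= 2 ^- k :> R by rewrite invr_ge0 ltW.
split.
- exact: piece_Ck.
- exact: piece_bsupp.
- move=> x; have /andP[b0 b1] := bump_itv lam0 c0 x.
  have /andP[q0 q1] := below_compl_itv F k x; have /andP[s0 s1] := scale_compl_itv F k x.
  rewrite /piece !normrM !ger0_norm// ?subr_ge0//.
  by apply: mulr_ile1; rewrite ?mulr_ge0 ?subr_ge0 ?mulr_ile1//; lra.
- move=> i x; have := @jet_Dn _ _ i (2 ^- k) d.+1 (piece lam0 c0 F k) x t0.
  rewrite exprVn mulrC ler_pdivrMr ?exprn_gt0// => h; apply: (le_trans h).
  rewrite ler_pM2r ?exprn_gt0//.
  apply: (le_trans (jet_mul _ _ t0 _ _)); [|by apply: CkB; [exact: Ck_cst|exact: scale_compl_Ck]|].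
    by apply: CkM; [exact: bump_Ck|exact: below_compl_Ck].
  apply: ler_pM; rewrite ?jet_ge0//.
    apply: (le_trans (jet_mul _ _ t0 (bump_Ck _ _ _) (below_compl_Ck _ _ _))).
    apply: ler_pM; rewrite ?jet_ge0//; last exact: (jet_below_compl uF i k x M0 hM).
    apply: (le_trans (@jet_bump _ _ i _ d.+1 lam0 c0 x M t0 (ltW lam00) hM)).
    rewrite ler_wpM2r//; apply: lerXn2r; rewrite ?nnegrE ?addr_ge0 ?mulr_ge0 ?(ltW lam00)//.
    rewrite lerD2l ler_piMl ?(ltW lam00)// invf_le1// exprn_ege1//; lra.
  apply: (le_trans (jet_add _ _ t0 _ _)); [exact: Ck_cst|by apply: CkN; exact: scale_compl_Ck|].
  rewrite jet_cst1 jet_opp; last exact: scale_compl_Ck.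
  rewrite lerD2l.
  have tk : 2 ^- k * 2 ^+ k <= 1 :> R by rewrite mulVf// gt_eqF.
  by have := jet_scale_compl uF i x t0 tk M0 hM; rewrite mulVf ?gt_eqF// mulr1.
- move=> x; rewrite /piece mulf_eq0 negb_or subr_eq0 => /andP[_ sc].
  have [n nF hn] : exists2 n, n \in F k & bump (2 ^+ k) (center n) x != 0.
    apply: contraNP sc => h; rewrite eq_sym /scale_compl big_seq big1// => n nF.
    have [->|hn] := eqVneq (bump (2 ^+ k) (center n) x) 0; first by rewrite subr0.
    by exfalso; apply: h; exists n.
  exists (center n); first by apply/mapP; exists n.
  move=> j; rewrite leNgt; apply/negP => hj; move/negP: hn; apply; apply/eqP.
  by apply: (@bump0 _ _ _ _ _ j); lra.
Qed.

(** The open cube concentric with the dyadic cube n and three times as large: any set of width below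
    2^-k that meets the dyadic cube lies in it. Openness serves both the compactness of S and the
    support of the remainder. *)
Definition plateau k n : set V := [set x | forall i, -1 < 2 ^+ k * x 0 i - (n 0 i)%:~R < 2].

Lemma open_plateau k n : open (plateau k n).
Proof.
pose f i (x : V) : R := 2 ^+ k * x 0 i - (n 0 i)%:~R.
have cf i : continuous (f i).
  by apply: (@Ck_continuous _ _ _ E 0%N); apply: CkB; [apply: CkZ; exact: Ck_coord|exact: Ck_cst].
rewrite (_ : plateau k n = [set y | forall i, (f i @^-1` [set z | z \in `]-1, 2[]) y]).
  rewrite openE => x h; apply: (@filter_forall _ _ (fun i => f i @^-1` [set z | z \in `]-1, 2[]) (nbhs x)) => i.
  apply: cf; apply: open_nbhs_nbhs; split; first exact: interval_open.
  exact: h.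
apply/seteqP; split=> x h i; have := h i; first by rewrite /= in_itv.
by rewrite /= in_itv.
Qed.

Variables (lam0 : R) (c0 : V) (F : nat -> seq 'rV[int]_d).
Hypothesis lam00 : 0 < lam0.

Lemma below_compl_plateau N k n x : (k < N)%N -> n \in F k -> plateau k n x -> below_compl F N x = 0.
Proof.
move=> kN nF h; rewrite /below_compl (bigD1 (Ordinal kN))//= /scale_compl (big_rem n)//=.
rewrite bump1 ?subrr ?mul0r// => i; rewrite mxE.
by have /andP[h1 h2] := h i; rewrite ler_norml; apply/andP; split; lra.
Qed.

(** The product vanishes on open plateaus covering S, so even the closure of its support misses
    S. *)
Lemma remainder_test_fun_off N (S : set V) :
  (forall x, S x -> exists k n, [/\ (k < N)%N, n \in F k & plateau k n x]) ->
  test_fun_off S (fun x => bump lam0 c0 x * below_compl F N x).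
Proof.
move=> cov; split.
  by apply: Ck_smooth => k; apply: CkM; [exact: bump_Ck|exact: below_compl_Ck].
have [_ [r hr]] := bump_bsupp c0 lam00.
split.
  apply: (@subclosed_compact _ _ [set x : V | forall i, `[- r, r]%classic (x 0 i)]).
  - exact: closed_closure.
  - by apply: (@rV_compact R d (fun=> `[- r, r]%classic)) => i; exact: segment_compact.
  rewrite [X in _ `<=` X](_ : _ = closure [set x : V | forall i, `[- r, r]%classic (x 0 i)]).
    apply: closure_subset => x /= /eqP h i; have /hr/cubeP/(_ i)/andP[h1 h2] : bump lam0 c0 x != 0.
      by apply/eqP => e; apply: h; rewrite e mul0r.
    by rewrite in_itv/= h1 ltW.
  apply/closure_id; apply: compact_closed; first exact: norm_hausdorff.
  by apply: (@rV_compact R d (fun=> `[- r, r]%classic)) => i; exact: segment_compact.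
apply/seteqP; split=> // x [clx /cov[k [n [kN nF px]]]].
have ob : open_nbhs x (plateau k n) by split => //; exact: open_plateau.
have [y [/= /eqP hy py]] := clx _ (open_nbhs_nbhs ob).
by apply: hy; rewrite (below_compl_plateau kN nF py) mulr0.
Qed.

End Localization.

(** * Pairing of the distribution with a bump, estimated through a cover *)

Section PairingEstimate.
Context {R : realType} {d : nat}.
Local Notation V := 'rV[R]_d.
Local Notation T := (Rd R d).
Local Notation E := (@unit_vec R d).
Variable mu : {measure set T -> \bar R}.
Hypothesis Hmu : is_lebesgue_measure mu.

Lemma invF_re_D (u w : T -> R) xi : bsupp u -> bsupp w ->
  invF_re mu (fun x => u x + w x) xi = invF_re mu u xi + invF_re mu w xi.
Proof.
move=> bu bw; rewrite /invF_re -int_D//; last 2 first.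
- by apply: bsuppM => //; exact: bmeas_cos.
- by apply: bsuppM => //; exact: bmeas_cos.
by apply: eq_Rintegral => x _; rewrite mulrDl.
Qed.

Lemma invF_im_D (u w : T -> R) xi : bsupp u -> bsupp w ->
  invF_im mu (fun x => u x + w x) xi = invF_im mu u xi + invF_im mu w xi.
Proof.
move=> bu bw; rewrite /invF_im -int_D//; last 2 first.
- by apply: bsuppM => //; exact: bmeas_sin.
- by apply: bsuppM => //; exact: bmeas_sin.
by apply: eq_Rintegral => x _; rewrite mulrDl.
Qed.

Variables (a b G : T -> R).
Hypotheses (ma : measurable_fun setT a) (mb : measurable_fun setT b).
Hypotheses (mG : measurable_fun setT G) (G0 : forall x, 0 <= G x).
Hypothesis abG : forall x, a x ^+ 2 + b x ^+ 2 <= G x ^+ 2.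

(** The real part of (a + i b) F^-1 u. The imaginary part for g1 + i g2 is the same expression with
    a = g2 and b = -g1, so one estimate serves both. *)
Definition pairing (u : T -> R) (xi : T) : R := a xi * invF_re mu u xi - b xi * invF_im mu u xi.

Lemma pairingD (u w : T -> R) : bsupp u -> bsupp w ->
  pairing (fun x => u x + w x) = (fun xi => pairing u xi + pairing w xi).
Proof.
by move=> bu bw; apply/funext => xi; rewrite /pairing invF_re_D// invF_im_D//; ring.
Qed.

Lemma measurable_pairing (u : T -> R) : measurable_fun setT u -> measurable_fun setT (pairing u).
Proof.
move=> mu'; apply: measurable_funB; apply: measurable_funM => //.
  exact: measurable_invF_re.
exact: measurable_invF_im.
Qed.

Lemma pairing_le (u : T -> R) xi : `|pairing u xi| <= G xi * amp mu u xi.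
Proof.
rewrite -[leRHS]ger0_norm ?mulr_ge0 ?amp_ge0//.
rewrite -ler_sqr ?nnegrE// !real_normK ?num_real// exprMn.
rewrite /amp sqr_sqrtr ?spec_ge0//; apply: le_trans (ler_wpM2r (spec_ge0 mu u xi) (abG xi)).
rewrite /pairing /spec -subr_ge0; move: (invF_re _ _ _) (invF_im _ _ _) => p q.
rewrite (_ : _ - _ = (a xi * q + b xi * p) ^+ 2) ?sqr_ge0//; ring.
Qed.

Lemma pairing_integrable lam C s (u : V -> R) (t h : R) :
  0 < lam -> 0 < C -> localized d.+1 lam C s u -> (0 < size s)%N -> 0 <= t -> 0 < h ->
  (\int[mu]_x (G x ^+ 2 * \1_[set x | (t < G x)%R] x)%:E <= (h ^+ 2)%:E)%E ->
  mu.-integrable setT (EFin \o pairing u) /\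
  `|\int[mu]_xi pairing u xi| <=
    Num.sqrt ((size s)%:R * (2 * (d.+1).+2%:R + 2) ^+ d) *
    (2 ^+ d * (1 + 2 * d%:R * C) * t + h / Num.sqrt (lam ^+ d)).
Proof.
move=> l0 C0 Lu s0 t0 h0 hG.
have pb := pairing_bound Hmu l0 C0 Lu s0 mG G0 t0 h0 hG.
have [[mu' _] _] := loc_bsupp Lu.
have mp := measurable_pairing mu'.
have hp : (\int[mu]_xi `|(pairing u xi)%:E| <= \int[mu]_xi (G xi * amp mu u xi)%:E)%E.
  apply: ge0_le_integral => //.
  - by apply: measurableT_comp => //; exact/measurable_EFinP.
  - by apply/measurable_EFinP; apply: measurable_funM => //; exact: measurable_amp.
  by move=> x _; rewrite lee_fin pairing_le.
have ip : mu.-integrable setT (EFin \o pairing u).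
  apply/integrableP; split; first exact/measurable_EFinP.
  by apply: le_lt_trans hp _; apply: le_lt_trans pb _; rewrite ltry.
split => //; rewrite -lee_fin; apply: le_trans pb; apply: le_trans hp.
rewrite /Rintegral -fine_abse; last exact: integrable_fin_num.
rewrite fineK; last by rewrite abse_fin_num; exact: integrable_fin_num.
apply: le_abse_integral => //; exact/measurable_EFinP.
Qed.

Variables (t h : nat -> R).
Hypotheses (t0 : forall k, 0 <= t k) (h0 : forall k, 0 < h k).
Hypothesis hG : forall k,
  (\int[mu]_x (G x ^+ 2 * \1_[set x | (t k < G x)%R] x)%:E <= (h k ^+ 2)%:E)%E.
Variable S : set V.
Hypothesis van : forall u, test_fun_off S u -> \int[mu]_xi pairing u xi = 0.

(** [K] is fixed before the cover, which may therefore be chosen afterwards to make the sum small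
    compared with 1 / K. *)
Lemma pairing_covering (lam0 : R) (c0 : V) : 0 < lam0 -> exists2 K, 0 < K &
  forall (N : nat) (F : nat -> seq 'rV[int]_d), (forall k, uniq (F k)) ->
    (forall x, S x -> exists k n, [/\ (k < N)%N, n \in F k & plateau k n x]) ->
  `|\int[mu]_xi pairing (bump lam0 c0) xi| <=
     K * \sum_(k < N) Num.sqrt (size (F k))%:R * (t k + h k / Num.sqrt ((2 ^+ k) ^+ d)).
Proof.
move=> l0; have [C C0 hC] := @piece_localized R d lam0 l0.
have k1 : 0 < (2 * (d.+1).+2%:R + 2) ^+ d :> R by rewrite exprn_gt0//; lra.
pose kap := Num.sqrt ((2 * (d.+1).+2%:R + 2) ^+ d) : R.
have kap0 : 0 < kap by rewrite sqrtr_gt0.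
pose C1 : R := 1 + 2 ^+ d * (1 + 2 * d%:R * C).
have C10 : 0 <= 2 * d%:R * C by rewrite !mulr_ge0// ltW.
have C11 : 0 <= 2 ^+ d * (1 + 2 * d%:R * C) by rewrite mulr_ge0 ?exprn_ge0// addr_ge0.
exists (kap * C1); first by rewrite mulr_gt0// /C1; lra.
move=> N F uF cov; pose P := piece lam0 c0 F.
have [pint ple] : (forall k, mu.-integrable setT (EFin \o pairing (P k))) /\
    (forall k, `|\int[mu]_xi pairing (P k) xi| <=
       kap * C1 * (Num.sqrt (size (F k))%:R * (t k + h k / Num.sqrt ((2 ^+ k) ^+ d)))).
  suff hk k : mu.-integrable setT (EFin \o pairing (P k)) /\ `|\int[mu]_xi pairing (P k) xi| <=
       kap * C1 * (Num.sqrt (size (F k))%:R * (t k + h k / Num.sqrt ((2 ^+ k) ^+ d))).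
    by split=> k; case: (hk k).
  (* With no cube at scale k the piece is zero; [pairing_integrable] needs a nonempty list. *)
  have [sF|sF] := posnP (size (F k)).
    have e : pairing (P k) = cst 0.
      have Fk : F k = [::] by apply: size0nil.
      have -> : P k = cst 0.
        by apply/funext => x; rewrite /P /piece /scale_compl Fk big_nil subrr mulr0.
      apply/funext => xi; rewrite /pairing /invF_re /invF_im.
      have z (g : T -> R) : \int[mu]_x (cst 0 x * g x) = 0.
        by under eq_Rintegral do rewrite mul0r; rewrite Rintegral_cst// mul0r.
      by rewrite !z !mulr0 subr0.
    rewrite e; split; first by apply: (@integrable0 _ _ _ mu setT).
    by rewrite Rintegral_cst// mul0r normr0 sF sqrtr0 mul0r mulr0.
  have s0 : (0 < size (map (@center R d) (F k)))%N by rewrite size_map.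
  have l2 : 0 < 2 ^+ k :> R by exact: exprn_gt0.
  have [i1 i2] := pairing_integrable l2 C0 (hC c0 F uF k) s0 (t0 k) (h0 k) (hG k).
  split => //; apply: (le_trans i2); rewrite size_map sqrtrM// -/kap.
  have sl0 : 0 <= h k / Num.sqrt ((2 ^+ k) ^+ d) by rewrite divr_ge0 ?sqrtr_ge0// ltW.
  rewrite [leRHS](_ : _ = Num.sqrt (size (F k))%:R * kap * (C1 * (t k + h k / Num.sqrt ((2 ^+ k) ^+ d)))); last by ring.
  rewrite ler_wpM2l ?mulr_ge0 ?sqrtr_ge0//.
  rewrite [leRHS]mulrDr; apply: lerD; first by rewrite ler_wpM2r// /C1; lra.
  by rewrite ler_peMl// /C1; lra.
have bP k : bsupp (P k : T -> R) by exact: piece_bsupp.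
have bR n : bsupp (fun x : T => bump lam0 c0 x * below_compl F n x).
  by apply: bsuppM; [exact: bump_bsupp|exact: below_compl_bmeas].
have iS n : mu.-integrable setT (EFin \o (fun xi => \sum_(k < n) pairing (P k) xi)) /\
    \int[mu]_xi (\sum_(k < n) pairing (P k) xi) = \sum_(k < n) \int[mu]_xi pairing (P k) xi.
  elim: n => [|n [ih1 ih2]].
    split; last by under eq_Rintegral do rewrite big_ord0; rewrite big_ord0 Rintegral_cst// mul0r.
    rewrite (_ : EFin \o _ = cst 0%E); first exact: integrable0.
    by apply/funext => x /=; rewrite big_ord0.
  have e : (fun xi => \sum_(k < n.+1) pairing (P k) xi) =
    (fun xi => \sum_(k < n) pairing (P k) xi + pairing (P n) xi).
    by apply/funext => xi; rewrite big_ord_recr.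
  rewrite e; split; last by rewrite RintegralD// ih2 big_ord_recr.
  by have := integrableD measurableT ih1 (pint n).
have ep : pairing (bump lam0 c0) = (fun xi =>
    pairing (fun x => bump lam0 c0 x * below_compl F N x) xi + \sum_(k < N) pairing (P k) xi).
  have {1}-> : bump lam0 c0 = (fun x => bump lam0 c0 x * below_compl F N x + \sum_(k < N) P k x).
    by apply/funext => x; rewrite [LHS](telescope_pieces _ _ F N).
  have bS n : bsupp (fun x : T => \sum_(k < n) P k x) by apply: bsupp_sum => k; exact: bP.
  rewrite pairingD//; apply/funext => xi; congr (_ + _).
  elim: N {cov} => [|n ih].
    rewrite big_ord0 /pairing /invF_re /invF_im.
    have z (g : T -> R) : \int[mu]_x ((\sum_(k < 0) P k x) * g x) = 0.
      by under eq_Rintegral do rewrite big_ord0 mul0r; rewrite Rintegral_cst// mul0r.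
    by rewrite !z !mulr0 subr0.
  rewrite big_ord_recr/= -ih (_ : (fun x => \sum_(k < n.+1) P k x) =
    (fun x => \sum_(k < n) P k x + P n x)); first by rewrite pairingD.
  by apply/funext => x; rewrite big_ord_recr.
have [C0' C0p L0] := bump_localized c0 l0.
have [i0 _] := pairing_integrable l0 C0p L0 (erefl _) (t0 0%N) (h0 0%N) (hG 0%N).
have [i1 e1] := iS N.
(* Integrability for the remainder is inherited from the bump and the pieces by subtraction. *)
have eR : pairing (fun x => bump lam0 c0 x * below_compl F N x) = (fun xi =>
  pairing (bump lam0 c0) xi - \sum_(k < N) pairing (P k) xi).
  by apply/funext => xi; rewrite ep addrK.
have := van (remainder_test_fun_off c0 l0 cov).
rewrite eR RintegralB// e1 => /eqP; rewrite subr_eq0 => /eqP ->.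
rewrite mulr_sumr; apply: le_trans (ler_norm_sum _ _ _) _.
by apply: ler_sum => k _; exact: ple.
Qed.

End PairingEstimate.

(** * Covers of small capacity *)

Section SeriesTails.
Context {R : realType}.
Implicit Types (x a X : nat -> R).

Lemma small_tail x (M eps : R) : (forall k, 0 <= x k) -> (forall n, \sum_(k < n) x k <= M) ->
  0 < eps -> exists k0, forall n, \sum_(k < n | (k0 <= k)%N) x k <= eps.
Proof.
move=> x0 xM e0; pose A := [set s | exists n, s = \sum_(k < n) x k].
have ubA : has_ubound A by exists M => _ [n ->].
have supA : has_sup A by split => //; exists 0, 0%N; rewrite big_ord0.
have [_ [k0 ->] hk0] := sup_adherent e0 supA.
exists k0 => n; have mono i j : (i <= j)%N -> \sum_(k < i) x k <= \sum_(k < j) x k.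
  by move=> ij; rewrite (big_ord_widen _ x ij) [leRHS](bigID (fun k : 'I_j => (k < i)%N))/= lerDl sumr_ge0.
have le : \sum_(k < maxn n k0) x k <= sup A by apply: ub_le_sup => //; exists (maxn n k0).
have -> : \sum_(k < n | (k0 <= k)%N) x k = \sum_(k < n) x k - \sum_(k < n | (k < k0)%N) x k.
  rewrite [X in _ = X - _](bigID (fun k : 'I_n => (k < k0)%N))/= addrAC subrr add0r.
  by apply: eq_bigl => k; rewrite leqNgt.
have [nk|kn] := leqP n k0.
  rewrite [X in _ - X](eq_bigl xpredT); last by move=> k; rewrite (leq_trans (ltn_ord k)).
  by rewrite subrr ltW.
rewrite -(big_ord_widen _ x (ltnW kn)).
by move: le hk0; rewrite (maxn_idPl (ltnW kn)); lra.
Qed.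

(* X_k stands for the inner sum of the capacity at scale 2^-k; [q / (q - 1) / 2] is q'/2. *)
Definition NH_control (q C : R) X : Prop :=
  if q == 1 then forall k, X k <= C
  else forall n, \sum_(k < n) X k `^ (q / (q - 1) / 2) <= C.

(** [k0] works for every controlled [X] at once, so it can be fixed before the cover that produces
    [X]. *)
Lemma NH_control_tail (q M C eps : R) a : 1 <= q -> (forall k, 0 <= a k) ->
  (forall n, \sum_(k < n) a k `^ q <= M) -> 0 < C -> 0 < eps ->
  exists k0, forall X, (forall k, 0 <= X k) -> NH_control q C X ->
    forall n, \sum_(k < n | (k0 <= k)%N) Num.sqrt (X k) * a k <= eps.
Proof.
move=> q1 a0 aM C0 e0; rewrite /NH_control; have [qE|qN] := eqVneq q 1.
  have sC0 : 0 < Num.sqrt C by rewrite sqrtr_gt0.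
  have aM1 n : \sum_(k < n) a k <= M.
    by have := aM n; rewrite qE; under eq_bigr do rewrite powRr1//.
  have [k0 hk0] := small_tail a0 aM1 (divr_gt0 e0 sC0).
  exists k0 => X X0 XC n.
  apply: (@le_trans _ _ (\sum_(k < n | (k0 <= k)%N) Num.sqrt C * a k)).
    by apply: ler_sum => k _; rewrite ler_wpM2r// ler_sqrt// ltW.
  by rewrite -mulr_sumr -ler_pdivlMl// mulrC.
have q1' : 1 < q by rewrite lt_neqAle eq_sym qN.
have qm : 0 < q - 1 by lra.
(* The weight eta spends half of eps on the capacity bound C; c is then the weight that Young's
   inequality dictates, and the other half is the tail of the q-th powers. *)
pose eta := eps / 2 / C; have eta0 : 0 < eta by rewrite !divr_gt0.
pose c := eta `^ (- (q - 1)); have c0 : 0 < c by rewrite powR_gt0.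
have e20 : 0 < eps / 2 / c by rewrite !divr_gt0.
have [k0 hk0] := small_tail (fun k => powR_ge0 (a k) q) aM e20.
exists k0 => X X0 XC n.
(* Weighted Young inequality for s = sqrt x with exponents q' and q, by comparing y with eta
   s^(1/(q-1)): one of the two terms on the right already dominates. *)
have young (x y : R) : 0 <= x -> 0 <= y -> Num.sqrt x * y <= eta * x `^ (q / (q - 1) / 2) + c * y `^ q.
  move=> x0 y0; have -> : q / (q - 1) / 2 = 2^-1 * (q / (q - 1)) by rewrite mulrC.
  rewrite -powR12_sqrt// powRrM; move: (x `^ 2^-1) (powR_ge0 x 2^-1) => s s0.
  have sE : s * s `^ (q - 1)^-1 = s `^ (q / (q - 1)).
    have e : (q - 1)^-1 = q / (q - 1) - 1 by field; rewrite gt_eqF.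
    by rewrite {1}e mulr_powRB1// divr_gt0//; lra.
  have [h|h] := leP y (eta * s `^ (q - 1)^-1).
    apply: (@le_trans _ _ (eta * s `^ (q / (q - 1)))); last by rewrite lerDl mulr_ge0 ?powR_ge0 ?ltW.
    by rewrite -sE mulrCA ler_wpM2l.
  apply: (@le_trans _ _ (c * y `^ q)); last by rewrite lerDr mulr_ge0 ?powR_ge0 ?ltW.
  have sy : s <= (y / eta) `^ (q - 1).
    have h1 : s `^ (q - 1)^-1 <= y / eta by rewrite ler_pdivlMr// mulrC ltW.
    have := ge0_ler_powR (ltW qm); move/(_ (s `^ (q - 1)^-1) (y / eta)).
    rewrite !nnegrE powR_ge0 divr_ge0 ?(ltW eta0)// -powRrM mulVf ?gt_eqF// powRr1//.
    by apply.
  apply: (le_trans (ler_wpM2r y0 sy)).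
  have ei : 0 <= eta^-1 by rewrite invr_ge0 ltW.
  rewrite powRM// -(powR_inv1 (ltW eta0)) -powRrM mulN1r -/c mulrAC [c * _]mulrC.
  by rewrite ler_wpM2r ?(ltW c0)// mulrC mulr_powRB1//; lra.
apply: (@le_trans _ _ (\sum_(k < n | (k0 <= k)%N) (eta * X k `^ (q / (q - 1) / 2) + c * a k `^ q))).
  by apply: ler_sum => k _; exact: young.
rewrite big_split/= -!mulr_sumr.
have h1 : \sum_(k < n | (k0 <= k)%N) X k `^ (q / (q - 1) / 2) <= C.
  apply: le_trans (XC n); rewrite [leRHS](bigID (fun k : 'I_n => (k0 <= k)%N))/= lerDl.
  by rewrite sumr_ge0// => k _; exact: powR_ge0.
have h2 := hk0 n.
have -> : eps = eta * C + c * (eps / 2 / c) by rewrite /eta; field; rewrite !gt_eqF.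
by apply: lerD; rewrite ler_wpM2l// ltW.
Qed.

End SeriesTails.

Section Covers.
Context {R : realType} {d : nat}.
Local Notation V := 'rV[R]_d.
Implicit Types (x y : V) (A : set V) (B : nat -> set V).

Lemma coord_le_dist x y i : `|x 0 i - y 0 i| <= eucl_dist x y.
Proof.
rewrite /eucl_dist -sqrtr_sqr ler_sqrt; last by apply: sumr_ge0 => j _; exact: sqr_ge0.
by rewrite (bigD1 i)//= lerDl sumr_ge0// => j _; exact: sqr_ge0.
Qed.

Lemma dist_le_diam A x y : A x -> A y -> ((eucl_dist x y)%:E <= diam A)%E.
Proof. by move=> Ax Ay; apply: ereal_sup_ubound; exists x => //; exists y. Qed.

Lemma sub_plateau A k :
  (forall x y i, A x -> A y -> `|x 0 i - y 0 i| < (2 ^+ k)^-1) -> exists n, A `<=` plateau k n.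
Proof.
move=> h; have [[x Ax]|A0] := pselect (A !=set0); last first.
  by exists 0 => y Ay; exfalso; apply: A0; exists y.
have k0 : 0 < 2 ^+ k :> R by exact: exprn_gt0.
exists (\row_i Num.floor (2 ^+ k * x 0 i)) => y Ay i; rewrite mxE.
have := h y x i Ay Ax; rewrite -(ltr_pM2l k0) mulfV ?gt_eqF// -{1}(gtr0_norm k0) -normrM mulrBr.
rewrite ltr_norml => /andP[h1 h2].
have f1 := floor_le (2 ^+ k * x 0 i); have := floorD1_gt (2 ^+ k * x 0 i).
by rewrite rmorphD /= => f2; apply/andP; split; lra.
Qed.

Lemma diam_in_Delta_exists A k0 : (0 < diam A)%E -> (diam A < ((2 ^+ k0)^-1)%:E)%E ->
  exists2 k : nat, (k0 <= k)%N & diam_in_Delta k A.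
Proof.
rewrite /diam_in_Delta; case: (diam A) => // r; rewrite !lte_fin => r0 rk0.
have powE (k : nat) : (2 : R) `^ (- (k%:~R)) = (2 ^+ k)^-1 by rewrite powRN powR_mulrn.
have powE1 (k : nat) : (2 : R) `^ (- (k%:~R + 1)) = (2 ^+ k.+1)^-1.
  by rewrite powRN natr1 powR_mulrn.
have ex : exists k, (2 ^+ k.+1)^-1 <= r.
  exists (Num.truncn r^-1); rewrite invf_ple ?posrE ?exprn_gt0//.
  rewrite (le_trans (ltW (truncnS_gt _)))// -natrX ler_nat ltnW// ltn_expl//.
have [k hk min] := ex_minnP ex.
have kk0 : (k0 <= k)%N.
  have := le_lt_trans hk rk0; rewrite ltf_pV2 ?posrE ?exprn_gt0//.
  by rewrite ltr_eXn2l//; lra.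
exists k => //; rewrite powE powE1 lee_fin lte_fin hk/=.
(* For k = 0 minimality says nothing; the upper bound 1 comes from the hypothesis, as 2^-k0 <= 1. *)
case: k kk0 min {hk} => [|k] kk0 min.
  by apply: lt_le_trans rk0 _; rewrite lef_pV2 ?posrE ?exprn_gt0// expr0 exprn_ege1//; lra.
by rewrite ltNge; apply/negP => /min; rewrite ltnn.
Qed.

Lemma diam_in_Delta_plateau A (k : nat) : diam_in_Delta k A -> exists n, A `<=` plateau k n.
Proof.
move=> /andP[_]; rewrite powRN powR_mulrn// => h; apply: sub_plateau => x y i Ax Ay.
apply: le_lt_trans (coord_le_dist x y i) _.
by rewrite -lte_fin; apply: le_lt_trans h; exact: dist_le_diam.
Qed.

Lemma diam_le0_plateau A k : (diam A <= 0)%E -> exists n, A `<=` plateau k n.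
Proof.
move=> h; apply: sub_plateau => x y i Ax Ay.
apply: le_lt_trans (coord_le_dist x y i) _.
apply: (@le_lt_trans _ _ 0); last by rewrite invr_gt0 exprn_gt0.
by rewrite -lee_fin; apply: le_trans h; exact: dist_le_diam.
Qed.

Lemma esum_ge_seq (T : choiceType) (I : set T) (f : T -> \bar R) (s : seq T) :
  uniq s -> (forall i, i \in s -> I i) -> (\sum_(i <- s) f i <= \esum_(i in I) f i)%E.
Proof.
move=> us sI; apply: esum_ge; exists [set` s].
  by split; [exact: finite_seq|move=> i; exact: sI].
by rewrite fsbig_seq.
Qed.

(** Restricted to the first m sets, so that it is a natural number whatever the cover. *)
Definition scale_count B m (k : nat) : nat :=
  count (fun j => `[< diam_in_Delta k (B j) >]) (iota 0 m).

(** Each set of class k has diameter at least 2^-(k+1), so the inner sum dominates the count times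
    2^(-(k+1) alpha). *)
Lemma NH_cost_control (alpha q C : R) B m : 0 <= alpha -> 1 <= q ->
  (NH_cost alpha (half_dual_exp q) B <= C%:E)%E ->
  NH_control q C (fun k => (scale_count B m k)%:R * ((2 ^+ k.+1)^-1) `^ alpha).
Proof.
move=> al0 q1; set X := (fun k => _); pose inner k :=
  (\esum_(j in [set j | diam_in_Delta k (B j)]) poweR (diam (B j)) alpha)%E.
have powE1 (k : nat) : (2 : R) `^ (- (k%:~R + 1)) = (2 ^+ k.+1)^-1.
  by rewrite powRN natr1 powR_mulrn.
have Xin k : ((X k)%:E <= inner k)%E.
  pose s := [seq j <- iota 0 m | `[< diam_in_Delta k (B j) >]].
  have us : uniq s by rewrite filter_uniq// iota_uniq.
  apply: le_trans (esum_ge_seq _ us _); last first.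
    by move=> j; rewrite mem_filter => /andP[/asboolP].
  apply: (@le_trans _ _ (\sum_(j <- s) (((2 ^+ k.+1)^-1) `^ alpha)%:E)%E).
    rewrite /X /scale_count -size_filter -/s sumEFin lee_fin.
    by rewrite big_const_seq count_predT iter_addr_0 mulr_natl.
  rewrite [leLHS]big_seq [leRHS]big_seq; apply: lee_sum => j.
  rewrite mem_filter => /andP[/asboolP/andP[+ _] _]; rewrite powE1 => h.
  rewrite -poweR_EFin; apply: gt0_ler_poweR => //; rewrite in_itv/= leey andbT ?lee_fin.
    by rewrite invr_ge0 exprn_ge0.
  by apply: le_trans h; rewrite lee_fin invr_ge0 exprn_ge0.
rewrite /half_dual_exp /NH_control /NH_cost -/inner; case: ifPn => [q1'|qn1] hC.
  move=> k; rewrite -lee_fin; apply: le_trans (Xin k) _; apply: le_trans hC.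
  by apply: ereal_sup_ubound; exists k.
move=> n; rewrite -lee_fin; apply: le_trans hC; rewrite -sumEFin.
apply: le_trans (esum_ge_seq (s := [seq Posz k | k <- iota 0 n]) _ _ _); last 2 first.
- by rewrite map_inj_uniq ?iota_uniq// => i j [].
- by [].
rewrite big_map -[X in iota _ X](subn0 n) -/(index_iota 0 n) big_mkord.
apply: lee_sum => k _; rewrite -poweR_EFin; apply: gt0_ler_poweR => //.
- by rewrite !divr_ge0//; lra.
- by rewrite in_itv/= leey andbT lee_fin mulr_ge0// powR_ge0.
- rewrite in_itv/= leey andbT; apply: le_trans (Xin k).
  by rewrite lee_fin mulr_ge0// powR_ge0.
Qed.

Lemma expr_unbounded (w K : R) : 1 < w -> exists k, K <= w ^+ k.
Proof.
move=> w1; have h k : 1 + k%:R * (w - 1) <= w ^+ k.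
  elim: k => [|k ih]; first by rewrite mul0r addr0 expr0.
  rewrite exprS; have : w * (1 + k%:R * (w - 1)) <= w * w ^+ k by rewrite ler_wpM2l//; lra.
  rewrite -natr1; have : 0 <= k%:R * (w - 1) by rewrite mulr_ge0//; lra.
  by move: (w ^+ k) (k%:R) => W n; nra.
exists (Num.truncn (K / (w - 1))).+1; apply: le_trans (h _).
have := truncnS_gt (K / (w - 1)); rewrite ltr_pdivrMr; last by lra.
lra.
Qed.

(* Covering sets of diameter 0 (or empty, with diameter -oo) lie in no class Delta_k; each of them is put in
   one dyadic cube so fine that its total contribution is negligible. *)
Lemma NH_capacity_cover (p q M eps : R) (a : nat -> R) (A : set V) :
  (0 < d)%N -> 0 < p -> 1 <= q -> (forall k, 0 <= a k) ->
  (forall n, \sum_(k < n) a k `^ q <= M) -> 0 < eps ->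
  (NH_capacity (2 * d%:R / p) (half_dual_exp q) A < +oo)%E ->
  exists (kap : nat -> nat) (n : nat -> 'rV[int]_d),
    A `<=` \bigcup_j plateau (kap j) (n j) /\
    forall m N, \sum_(k < N) Num.sqrt (count (fun j => kap j == k) (iota 0 m))%:R
       / ((2 ^+ d) `^ p^-1) ^+ k * a k <= eps.
Proof.
move=> d0 p0 q1 a0 aM e0; set w := (2 ^+ d) `^ p^-1; set al := 2 * d%:R / p => capA.
have wE : w = 2 `^ (d%:R / p) by rewrite /w -powR_mulrn// -powRrM.
have w1 : 1 < w.
  rewrite wE -[ltLHS](powRr0 2) /powR gt_eqF// ltr_expR ltr_pM2r ?divr_gt0 ?ltr0n//.
  by rewrite ln_gt0//; lra.
have w0 : 0 < w by lra.
have wk0 k : 0 < w ^+ k by exact: exprn_gt0.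
have al0 : 0 <= al by rewrite !divr_ge0 ?mulr_ge0// ltW.
pose cap := NH_capacity al (half_dual_exp q) A.
have [C C0 hC] : exists2 C : R, 0 < C & (cap < C%:E)%E.
  move: capA; rewrite -/cap; case: cap => [c _| //|_].
    by exists (`|c| + 1); [rewrite ltr_wpDl|rewrite lte_fin ltr_pwDr// ler_norm].
  by exists 1 => //; rewrite ltNyr.
(* The extra division by w pays for the lower end 2^-(k+1) of Delta_k: the root of the controlled
   quantity is the root of the count over w^(k+1), not over w^k. *)
have e20 : 0 < eps / 2 / w by rewrite !divr_gt0.
have [k0 hk0] := NH_control_tail q1 a0 aM C0 e20.
have dl0 : 0 < (2 ^+ k0)^-1 :> R by rewrite invr_gt0 exprn_gt0.
have : (NH_delta al (half_dual_exp q) A (2 ^+ k0)^-1 < C%:E)%E.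
  by apply: le_lt_trans hC; apply: ereal_sup_ubound; exists (2 ^+ k0)^-1.
move=> /ereal_inf_lt[_ [B [covB diamB] <-] costB].
have ctl m := NH_cost_control m al0 q1 (ltW costB).
pose eta j : R := eps / 2 / 2 ^+ j.+1.
have eta0 j : 0 < eta j by rewrite !divr_gt0// exprn_gt0.
have M0 : 0 <= M by have := aM 0%N; rewrite big_ord0.
have aB k : a k <= 1 + M.
  have [h|h] := leP (a k) 1; first by lra.
  have : a k `^ q <= M.
    apply: le_trans (aM k.+1); rewrite big_ord_recr/= lerDr sumr_ge0// => j _; exact: powR_ge0.
  by have := le1r_powR (ltW h) q1; lra.
(* Either the j-th set is counted by the capacity at a scale k >= k0, or its own contribution is
   below the j-th share of the remaining eps / 2. *)
pose good (j k : nat) := (diam_in_Delta k (B j) /\ (k0 <= k)%N) \/ a k / w ^+ k <= eta j.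
have [f hf] : exists f : nat -> nat * 'rV[int]_d, forall j,
    good j (f j).1 /\ B j `<=` plateau (f j).1 (f j).2.
  suff h j : exists kn : nat * 'rV[int]_d, good j kn.1 /\ B j `<=` plateau kn.1 kn.2.
    by exists (fun j => proj1_sig (cid (h j))) => j; exact: (proj2_sig (cid (h j))).
  have [h|h] := leP (diam (B j)) 0%E; last first.
    have [k kk0 hk] := diam_in_Delta_exists h (diamB j).
    have [n hn] := diam_in_Delta_plateau hk.
    by exists (k, n); split => //; left.
  have [k hk] := expr_unbounded ((1 + M) / eta j) w1.
  have [n hn] := diam_le0_plateau k h.
  exists (k, n); split => //; right => /=.
  rewrite ler_pdivrMr//; apply: (le_trans (aB k)).
  by rewrite mulrC -ler_pdivrMr.
exists (fun j => (f j).1), (fun j => (f j).2); split.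
  by move=> x /covB[j _ Bx]; exists j => //; have [_] := hf j; exact.
move=> m N; pose D j := `[< diam_in_Delta (f j).1 (B j) /\ (k0 <= (f j).1)%N >].
pose cD k := count (fun j => D j && ((f j).1 == k)) (iota 0 m).
pose cN k := count (fun j => ~~ D j && ((f j).1 == k)) (iota 0 m).
have cE k : count (fun j => (f j).1 == k) (iota 0 m) = (cD k + cN k)%N.
  rewrite /cD /cN; elim: (iota 0 m) => //= j s ->.
  by case: (D j) => /=; [rewrite add0n addnA|rewrite add0n addnCA].
(* The negligible sets may be counted linearly: sqrt (a + n) <= sqrt a + n for natural n, and their
   shares are then summed over j. *)
have sq k : Num.sqrt (count (fun j => (f j).1 == k) (iota 0 m))%:R <= Num.sqrt (cD k)%:R + (cN k)%:R :> R.
  rewrite cE natrD; move: (cN k) => n.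
  have sn : 0 <= Num.sqrt (cD k)%:R :> R by exact: sqrtr_ge0.
  rewrite -[leRHS]ger0_norm ?addr_ge0// -sqrtr_sqr ler_sqrt ?sqr_ge0//.
  rewrite sqrrD sqr_sqrtr// -addrA lerD2l.
  apply: (@le_trans _ _ (n%:R ^+ 2)); first by rewrite -natrX ler_nat; case: (n) => // i; rewrite expnS expn1 leq_pmulr.
  by rewrite lerDr mulrn_wge0// mulr_ge0.
apply: (@le_trans _ _ (\sum_(k < N) (Num.sqrt (cD k)%:R / w ^+ k * a k) + \sum_(k < N) ((cN k)%:R / w ^+ k * a k))).
  rewrite -big_split/=; apply: ler_sum => k _; rewrite -!mulrA -mulrDl ler_wpM2r//.
  by rewrite mulr_ge0// invr_ge0 ltW.
have -> : eps = eps / 2 + eps / 2 by lra.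
apply: lerD.
  pose X k : R := (scale_count B m k)%:R * ((2 ^+ k.+1)^-1) `^ al.
  have XE k : Num.sqrt (X k) = Num.sqrt (scale_count B m k)%:R / w ^+ k / w.
    rewrite /X; have -> : ((2 ^+ k.+1)^-1) `^ al = ((w ^+ k * w)^-1) ^+ 2.
      have w2 : w ^+ 2 = 2 `^ al.
        by rewrite wE -powR_mulrn ?powR_ge0// -powRrM; congr (_ `^ _); rewrite /al; ring.
      rewrite -powR_inv1 ?exprn_ge0// -powRrM mulN1r powRN exprn_powR// -w2.
      by rewrite -exprSr exprVn -!exprM mulnC.
    by rewrite sqrtrM// sqrtr_sqr ger0_norm ?invr_ge0 ?mulr_ge0 ?(ltW w0) ?(ltW (wk0 k))// invfM mulrA.
  apply: (@le_trans _ _ (w * \sum_(k < N | (k0 <= k)%N) Num.sqrt (X k) * a k)); last first.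
    by rewrite mulrC -ler_pdivlMr//; apply: hk0 (ctl m) N => k; rewrite mulr_ge0// powR_ge0.
  rewrite (bigID (fun k : 'I_N => (k0 <= k)%N))/= [X in _ + X]big1 ?addr0; last first.
    move=> k kk; rewrite (_ : cD k = 0%N) ?sqrtr0 ?mul0r//.
    apply/eqP; rewrite -leqn0 leqNgt -has_count; apply/hasP => -[j _ /andP[/asboolP[_ h] /eqP e]].
    by rewrite e (negbTE kk) in h.
  rewrite mulr_sumr; apply: ler_sum => k kk; rewrite XE mulrA ler_wpM2r//.
  rewrite [leRHS]mulrC divfK ?gt_eqF// ler_wpM2r ?invr_ge0 ?(ltW (wk0 k))//.
  rewrite ler_sqrt ?ler0n// ler_nat; apply: sub_count => j /andP[/asboolP[h _] /eqP e].
  by apply/asboolP; rewrite -e.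
apply: (@le_trans _ _ (\sum_(j <- iota 0 m) eta j)).
  have -> : \sum_(k < N) (cN k)%:R / w ^+ k * a k =
     \sum_(k < N) \sum_(j <- iota 0 m | ~~ D j && ((f j).1 == k)) (a k / w ^+ k).
    apply: eq_bigr => k _; rewrite big_const_seq iter_addr_0 -/(cN k).
    by rewrite -[RHS]mulr_natl mulrCA mulrC mulrA [_ * (cN k)%:R]mulrC.
  under eq_bigr do rewrite big_mkcond.
  rewrite exchange_big /=; apply: ler_sum => j _; rewrite -big_mkcond/=.
  have [Dj|nD] := boolP (D j); first by rewrite big_pred0 ?(ltW (eta0 j)).
  have hj : a (f j).1 / w ^+ (f j).1 <= eta j.
    by have [[hD|//] _] := hf j; move/asboolPn: nD => /(_ hD).
  have [fN|fN] := ltnP (f j).1 N.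
    rewrite (big_pred1 (Ordinal fN)) => [|k]; first exact: hj.
    by rewrite [LHS]/= [LHS]eq_sym.
  rewrite big_pred0 ?(ltW (eta0 j))// => k /=; apply/eqP => e.
  by have := ltn_ord k; rewrite -e ltnNge fN.
rewrite -[X in iota _ X](subn0 m) -/(index_iota 0 m) big_mkord /eta -mulr_sumr ler_piMr//; first by lra.
suff -> : \sum_(j < m) (2 ^+ j.+1)^-1 = 1 - (2 ^+ m)^-1 :> R.
  by rewrite gerBl invr_ge0 exprn_ge0.
elim: (m) => [|i ih]; first by rewrite big_ord0 expr0 invr1 subrr.
by rewrite big_ord_recr/= ih exprS; field; rewrite expf_neq0.
Qed.

Lemma sqrt_sum_le (f : nat -> nat) n :
  Num.sqrt (\sum_(i < n) f i)%N%:R <= \sum_(i < n) Num.sqrt (f i)%:R :> R.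
Proof.
elim: n => [|n ih]; first by rewrite !big_ord0 sqrtr0.
rewrite !big_ord_recr/= natrD; apply: (@le_trans _ _ (Num.sqrt (\sum_(i < n) f i)%N%:R + Num.sqrt (f n)%:R)).
  move: (\sum_(i < n) f i)%N (f n) => x y.
  have [sx sy] : 0 <= Num.sqrt x%:R :> R /\ 0 <= Num.sqrt y%:R :> R by rewrite !sqrtr_ge0.
  rewrite -[leRHS]ger0_norm ?addr_ge0// -sqrtr_sqr ler_sqrt ?sqr_ge0//.
  by rewrite sqrrD !sqr_sqrtr// lerD2r lerDl mulrn_wge0// mulr_ge0.
by rewrite lerD2r.
Qed.

(** Each S_i gets the share eps / 2^(i+1), and compactness extracts finitely many plateaus.
    Subadditivity of the square root recombines the counts of the different S_i. *)
Lemma compact_NH_cover (p q M eps : R) (a : nat -> R) (S : set V) :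
  (0 < d)%N -> 0 < p -> 1 <= q -> (forall k, 0 <= a k) ->
  (forall n, \sum_(k < n) a k `^ q <= M) -> 0 < eps -> compact S ->
  sigma_finite_NH (2 * d%:R / p) (half_dual_exp q) S ->
  exists (N : nat) (F : nat -> seq 'rV[int]_d), [/\ forall k, uniq (F k),
    forall x, S x -> exists k n, [/\ (k < N)%N, n \in F k & plateau k n x] &
    \sum_(k < N) Num.sqrt (size (F k))%:R / ((2 ^+ d) `^ p^-1) ^+ k * a k <= eps].
Proof.
move=> d0 p0 q1 a0 aM e0 cS [Si [SE fin]]; set w := (2 ^+ d) `^ p^-1.
have w0 : 0 < w by apply: powR_gt0; exact: exprn_gt0.
pose eta i : R := eps / 2 ^+ i.+1.
have eta0 i : 0 < eta i by rewrite divr_gt0// exprn_gt0.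
have [f hf] : exists f : nat -> (nat -> nat) * (nat -> 'rV[int]_d), forall i,
    Si i `<=` \bigcup_j plateau ((f i).1 j) ((f i).2 j) /\
    forall m N, \sum_(k < N) Num.sqrt (count (fun j => (f i).1 j == k) (iota 0 m))%:R
       / w ^+ k * a k <= eta i.
  have h i : exists f : (nat -> nat) * (nat -> 'rV[int]_d),
    Si i `<=` \bigcup_j plateau (f.1 j) (f.2 j) /\
    forall m N, \sum_(k < N) Num.sqrt (count (fun j => f.1 j == k) (iota 0 m))%:R
       / w ^+ k * a k <= eta i.
    by have [kap [n hn]] := NH_capacity_cover d0 p0 q1 a0 aM (eta0 i) (fin i); exists (kap, n).
  by exists (fun i => proj1_sig (cid (h i))) => i; exact: (proj2_sig (cid (h i))).
move: cS; rewrite compact_cover => /(_ (nat * nat)%type setT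
  (fun ij => plateau ((f ij.1).1 ij.2) ((f ij.1).2 ij.2))) [].
- by move=> ij _; exact: open_plateau.
- rewrite SE => x [i _ /(proj1 (hf i))[j _ px]]; by exists (i, j).
move=> D _ covD.
pose m := (\max_(ij <- finmap.enum_fset D) maxn ij.1 ij.2).+1.
have Dm (ij : nat * nat) : ij \in finmap.enum_fset D -> (ij.1 < m)%N && (ij.2 < m)%N.
  move=> ijD; rewrite !ltnS -geq_max; exact: (@leq_bigmax_seq _ _ xpredT (fun ij : nat * nat => maxn ij.1 ij.2)).
pose N := (\max_(i < m) \max_(j < m) (f i).1 j).+1.
(* All pairs of indices below m are kept, not only those of the finite subcover, because the
   estimates concern initial segments. Duplicates are removed for the sake of the overlap bound. *)
pose F k := undup (flatten [seq [seq (f i).2 j | j <- iota 0 m & (f i).1 j == k] | i <- iota 0 m]).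
exists N, F; split.
- by move=> k; exact: undup_uniq.
- move=> x /covD[ij ijD px]; exists ((f ij.1).1 ij.2), ((f ij.1).2 ij.2).
  have /andP[im jm] := Dm ij ijD.
  split => //.
    rewrite ltnS; apply: leq_trans (leq_bigmax (Ordinal im)) => /=.
    exact: (leq_bigmax (F := fun j : 'I_m => (f ij.1).1 j) (Ordinal jm)).
  rewrite mem_undup; apply/flattenP; eexists.
    by apply/mapP; exists ij.1; [rewrite mem_iota|].
  by apply/mapP; exists ij.2 => //; rewrite mem_filter eqxx mem_iota.
pose c i k := count (fun j => (f i).1 j == k) (iota 0 m).
have sF k : (size (F k) <= \sum_(i < m) c i k)%N.
  apply: leq_trans (size_undup _) _; rewrite size_flatten /shape -map_comp sumnE big_map.
  rewrite -[X in iota _ X](subn0 m) -/(index_iota 0 m) big_mkord.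
  by apply: leq_sum => i _; rewrite [leqLHS]/= size_map /c -size_filter ?subn0.
apply: (@le_trans _ _ (\sum_(k < N) \sum_(i < m) Num.sqrt (c i k)%:R / w ^+ k * a k)).
  apply: ler_sum => k _; rewrite -mulr_suml -mulr_suml ler_wpM2r// ler_wpM2r//.
    by rewrite invr_ge0 exprn_ge0// ltW.
  apply: le_trans (sqrt_sum_le (c^~ k) m).
  by rewrite ler_sqrt ?ler0n// ler_nat sF.
rewrite exchange_big/=; apply: (@le_trans _ _ (\sum_(i < m) eta i)).
  by apply: ler_sum => i _; exact: (proj2 (hf i)).
rewrite /eta -mulr_sumr ler_piMr// ?(ltW e0)//.
suff -> : \sum_(i < m) (2 ^+ i.+1)^-1 = 1 - (2 ^+ m)^-1 :> R.
  by rewrite gerBl invr_ge0 exprn_ge0.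
elim: (m) => [|i ih]; first by rewrite big_ord0 expr0 invr1 subrr.
by rewrite big_ord_recr/= ih exprS; field; rewrite expf_neq0.
Qed.

End Covers.

(** * Conclusion *)

Section BumpTransform.
Context {R : realType} {d : nat}.
Local Notation V := 'rV[R]_d.
Local Notation T := (Rd R d).
Variable mu : {measure set T -> \bar R}.
Hypothesis Hmu : is_lebesgue_measure mu.
Variable lam : R.
Hypothesis lam0 : 0 < lam.

Lemma bump_translate (b x : V) : bump lam (lam *: b) (x + b) = bump lam 0 x.
Proof. by apply: eq_bigr => i _; congr chi; rewrite !mxE; ring. Qed.

Let brho : bsupp (bump lam 0 : T -> R). Proof. exact: bump_bsupp. Qed.

Let bump_translate_int (b : V) (w : T -> R) : bmeas w ->
  \int[mu]_x (bump lam (lam *: b) x * w x) = \int[mu]_x (bump lam 0 x * w (translate b x)).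
Proof.
move=> bw; have bb : bsupp (fun x : T => bump lam (lam *: b) x * w x).
  exact: (bsuppM (bump_bsupp (lam *: b) lam0) bw).
rewrite -(int_translate Hmu b bb); apply: eq_Rintegral => x _.
by rewrite /translate bump_translate.
Qed.

Lemma invF_bump_translate (b : V) (xi : T) :
  let c := cos (2 * pi * dotp (xi : V) b) in let s := sin (2 * pi * dotp (xi : V) b) in
  invF_re mu (bump lam (lam *: b)) xi = c * invF_re mu (bump lam 0) xi - s * invF_im mu (bump lam 0) xi /\
  invF_im mu (bump lam (lam *: b)) xi = c * invF_im mu (bump lam 0) xi + s * invF_re mu (bump lam 0) xi.
Proof.
move=> c s.
have ph (x : T) : 2 * pi * dotp (translate b x) xi = 2 * pi * dotp (x : V) xi + 2 * pi * dotp (xi : V) b.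
  by rewrite /translate dotpDl mulrDr; congr (_ + _ * _); apply: eq_bigr => i _; rewrite mulrC.
have bc : bsupp (fun x : T => bump lam 0 x * cos (2 * pi * dotp x xi)).
  by apply: bsuppM => //; exact: bmeas_cos.
have bs : bsupp (fun x : T => bump lam 0 x * sin (2 * pi * dotp x xi)).
  by apply: bsuppM => //; exact: bmeas_sin.
split.
  rewrite [LHS](bump_translate_int b (bmeas_cos xi)) /invF_re.
  rewrite /invF_im -!(int_Z Hmu)// -(int_B Hmu); [|exact: bsuppZ|exact: bsuppZ].
  by apply: eq_Rintegral => x _; rewrite ph cosD -/c -/s; ring.
rewrite [LHS](bump_translate_int b (bmeas_sin xi)) /invF_im.
rewrite /invF_re -!(int_Z Hmu)// -(int_D Hmu); [|exact: bsuppZ|exact: bsuppZ].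
by apply: eq_Rintegral => x _; rewrite ph sinD -/c -/s; ring.
Qed.

(** The bump lives in |x_i| <= 2 / lam, so the phase is at most 4 pi d L / lam <= 1/2 there. The
    transform is therefore at least cos(1/2) times the volume of a cube on which the bump is 1. *)
Lemma invF_re_bump_gt0 (L : R) (xi : V) : 0 <= L -> 8 * pi * d%:R * L <= lam ->
  (forall i, `|xi 0 i| <= L) -> 0 < invF_re mu (bump lam 0) xi.
Proof.
move=> L0 lamL hxi; have p2 := pi_ge2 R.
have c1 : 0 < cos (2^-1 : R) by apply: cos_gt0_pihalf; apply/andP; split; lra.
have i0 : 0 < lam^-1 by rewrite invr_gt0.
apply: (@lt_le_trans _ _ (\int[mu]_x (cos 2^-1 * (\1_(cube lam^-1) x : R)))).
  rewrite (int_Z Hmu); last exact: bsupp_cube.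
  by rewrite (int_cube Hmu) ?(ltW i0)// mulr_gt0// exprn_gt0// mulr_gt0.
rewrite /invF_re; apply: (int_le Hmu).
- by apply: bsuppZ; exact: bsupp_cube.
- by apply: bsuppM => //; exact: bmeas_cos.
move=> x; have [b0|bN0] := eqVneq (bump lam 0 (x : V)) 0.
  rewrite b0 mul0r indicE; case: (boolP (x \in cube lam^-1)); rewrite ?mulr0// inE => /cubeP h.
  exfalso; move: b0; rewrite bump1; first by move/eqP; rewrite oner_eq0.
  move=> i; rewrite mxE subr0 normrM (gtr0_norm lam0).
  have := h i; rewrite -[X in X -> _]/(is_true _) => /andP[h1 h2].
  have : `|(x : V) 0 i| <= lam^-1 by rewrite ler_norml h1 ltW.
  by rewrite -(ler_pM2l lam0) mulfV ?gt_eqF//; lra.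
have hx i : `|(x : V) 0 i| <= 2 / lam.
  have : `|lam * (x : V) 0 i - (0 : V) 0 i| <= 19 / 10.
    by rewrite leNgt; apply/negP => /(bump0 (x := x)) e; rewrite e eqxx in bN0.
  by rewrite mxE subr0 normrM (gtr0_norm lam0) => h; rewrite ler_pdivlMr// mulrC; lra.
have dx : `|2 * pi * dotp (x : V) xi| <= 2^-1.
  rewrite normrM ger0_norm; last by lra.
  have : `|dotp (x : V) xi| <= d%:R * (2 / lam * L).
    apply: le_trans (ler_norm_sum _ _ _) _.
    apply: (@le_trans _ _ (\sum_(i < d) (2 / lam * L))); last by rewrite sumr_const card_ord -[leLHS]mulr_natl.
    by apply: ler_sum => i _; rewrite normrM; apply: ler_pM.
  move=> h; apply: (@le_trans _ _ (2 * pi * (d%:R * (2 / lam * L)))).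
    by rewrite ler_wpM2l//; lra.
  rewrite (_ : _ * _ = 4 * pi * d%:R * L / lam); last by field; rewrite gt_eqF.
  rewrite ler_pdivrMr//; move: lamL.
  by rewrite (_ : 8 * pi * d%:R * L = 2 * (4 * pi * d%:R * L)); [lra|ring].
have cx : cos 2^-1 <= cos (2 * pi * dotp (x : V) xi).
  rewrite -(cos_norm (2 * pi * _)) leNgt ltr_cos -?leNgt// in_itv/= ?normr_ge0/=; lra.
have /andP[b0 b1] := bump_itv lam 0 (x : V).
have [bE|bl] := eqVneq (\1_(cube lam^-1) x : R) 0.
  by rewrite bE mulr0 mulr_ge0// (le_trans (ltW c1)).
have xc : cube lam^-1 x.
  by move: bl; rewrite indicE; case: (boolP (x \in _)); rewrite ?inE// eqxx.
rewrite indicE mem_set// mulr1 bump1 ?mul1r// => i.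
rewrite mxE subr0 normrM (gtr0_norm lam0).
have /cubeP/(_ i)/andP[h1 h2] := xc.
have : `|(x : V) 0 i| <= lam^-1 by rewrite ler_norml h1 ltW.
by rewrite -(ler_pM2l lam0) mulfV ?gt_eqF//; lra.
Qed.

End BumpTransform.

Theorem theorem1p7 (R : realType) (d : nat) (p q : R)
  (mu : {measure set (Rd R d) -> \bar R}) (S : set 'rV[R]_d) (g1 g2 : Rd R d -> R) :
  (1 <= d)%N -> 2 < p -> 1 <= q ->
  is_lebesgue_measure mu ->
  compact S ->
  sigma_finite_NH (2 * d%:R / p) (half_dual_exp q) S ->
  in_lorentz mu p q g1 g2 ->
  support_in mu g1 g2 S ->
  {ae mu, forall xi, g1 xi = 0 /\ g2 xi = 0}.
Proof.
move=> d1 p2 q1 Hmu cS sS [mg1 [mg2 Lfin]] supp.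
have p0 : 0 < p by lra.
pose G := cabs g1 g2.
have mG : measurable_fun setT G.
  apply: (measurableT_comp (g := fun x => g1 x ^+ 2 + g2 x ^+ 2)).
    by apply: continuous_measurable_fun; exact: sqrt_continuous.
  by apply: measurable_funD; exact: measurable_funX.
have G0 x : 0 <= G x by exact: sqrtr_ge0.
have GE x : G x ^+ 2 = g1 x ^+ 2 + g2 x ^+ 2 by rewrite sqr_sqrtr// addr_ge0// sqr_ge0.
have [t [h [M [t0 h0 hG aM]]]] := lorentz_levels mG G0 d1 p2 q1 Lfin.
set w := (2 ^+ d) `^ p^-1 in aM.
have w0 : 0 < w by apply: powR_gt0; exact: exprn_gt0.
pose a k : R := w ^+ k * (t k + h k / Num.sqrt ((2 ^+ k) ^+ d)).
have a0 k : 0 <= a k.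
  by rewrite mulr_ge0 ?exprn_ge0 ?(ltW w0)// addr_ge0// divr_ge0 ?sqrtr_ge0// ltW.
(* The cover is chosen after K with budget eps / K; the factor w^k in [a] cancels the w^-k of the
   covering lemma. *)
have zero (u v : Rd R d -> R) lam c : measurable_fun setT u -> measurable_fun setT v ->
    (forall x, u x ^+ 2 + v x ^+ 2 <= G x ^+ 2) ->
    (forall f, test_fun_off S f -> \int[mu]_xi pairing mu u v f xi = 0) -> 0 < lam ->
    \int[mu]_xi pairing mu u v (bump lam c) xi = 0.
  move=> mu_ mv uvG van lam0.
  have [K K0 hK] := pairing_covering Hmu mu_ mv mG G0 uvG t0 h0 hG van c lam0.
  apply/eqP; rewrite -normr_eq0 eq_le normr_ge0 andbT; apply/ler_addgt0Pr => eps e0.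
  rewrite add0r; have [N [F [uF cov le]]] := compact_NH_cover d1 p0 q1 a0 aM (divr_gt0 e0 K0) cS sS.
  apply: (le_trans (hK N F uF cov)); rewrite -ler_pdivlMl// mulrC.
  apply: le_trans le; rewrite le_eqVlt; apply/orP; left; apply/eqP.
  by apply: eq_bigr => k _; rewrite /a mulrA divfK// expf_neq0// gt_eqF.
have intg (u v : Rd R d -> R) lam c : measurable_fun setT u -> measurable_fun setT v ->
    (forall x, u x ^+ 2 + v x ^+ 2 <= G x ^+ 2) -> 0 < lam ->
    mu.-integrable setT (EFin \o pairing mu u v (bump lam c)).
  move=> mu_ mv uvG lam0; have [C C0 hC] := bump_localized c lam0.
  by have [] := pairing_integrable Hmu mu_ mv mG G0 uvG lam0 C0 hC (erefl _) (t0 0%N) (h0 0%N) (hG 0%N).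
have mNg1 : measurable_fun setT (fun x => - g1 x) by exact/measurable_funN.
have G1 x : g1 x ^+ 2 + g2 x ^+ 2 <= G x ^+ 2 by rewrite GE.
have G2 x : g2 x ^+ 2 + (- g1 x) ^+ 2 <= G x ^+ 2 by rewrite GE sqrrN addrC.
have van1 f : test_fun_off S f -> \int[mu]_xi pairing mu g1 g2 f xi = 0.
  by move=> /supp[].
have van2 f : test_fun_off S f -> \int[mu]_xi pairing mu g2 (fun x => - g1 x) f xi = 0.
  by move=> /supp[_ <-]; apply: eq_Rintegral => x _; rewrite /pairing; ring.
have ae lam : 0 < lam -> {ae mu, forall xi,
    pairing mu g1 g2 (bump lam 0) xi = 0 /\ pairing mu g2 (fun x => - g1 x) (bump lam 0) xi = 0}.
  move=> lam0; set H1 := pairing mu g1 g2 (bump lam 0).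
  set H2 := pairing mu g2 (fun x => - g1 x) (bump lam 0).
  have i1 : mu.-integrable setT (EFin \o H1) by exact: intg.
  have i2 : mu.-integrable setT (EFin \o H2) by exact: intg.
  pose c b xi := cos (2 * pi * dotp (xi : 'rV[R]_d) b).
  pose s b xi := sin (2 * pi * dotp (xi : 'rV[R]_d) b).
  have ic (H : Rd R d -> R) b : mu.-integrable setT (EFin \o H) ->
     mu.-integrable setT (EFin \o (fun xi => H xi * c b xi)).
    by move=> iH; apply: integrable_mul_bmeas => //; exact: bmeas_cos.
  have is_ (H : Rd R d -> R) b : mu.-integrable setT (EFin \o H) ->
     mu.-integrable setT (EFin \o (fun xi => H xi * s b xi)).
    by move=> iH; apply: integrable_mul_bmeas => //; exact: bmeas_sin.
  (* H1 + i H2 is g times the transform of the bump. The pairings with the bump translated by b are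
     the real and imaginary parts of its integral against the character c + i s. *)
  have z1 b : \int[mu]_xi (H1 xi * c b xi) - \int[mu]_xi (H2 xi * s b xi) = 0.
    rewrite -RintegralB//; [|exact: ic|exact: is_].
    rewrite -(zero g1 g2 lam (lam *: b) mg1 mg2 G1 van1 lam0); apply: eq_Rintegral => xi _.
    have [e1 e2] := invF_bump_translate Hmu lam0 b xi.
    apply: etrans (esym (congr2 (fun k l => g1 xi * k - g2 xi * l) e1 e2)).
    rewrite /H1 /H2 /pairing /c /s.
    by move: (cos _) (sin _) (invF_re _ _ _) (invF_im _ _ _) (g1 xi) (g2 xi) => *; ring.
  have z2 b : \int[mu]_xi (H2 xi * c b xi) + \int[mu]_xi (H1 xi * s b xi) = 0.
    rewrite -RintegralD//; [|exact: ic|exact: is_].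
    rewrite -(zero g2 _ lam (lam *: b) mg2 mNg1 G2 van2 lam0); apply: eq_Rintegral => xi _.
    have [e1 e2] := invF_bump_translate Hmu lam0 b xi.
    apply: etrans (esym (congr2 (fun k l => g2 xi * k - - g1 xi * l) e1 e2)).
    rewrite /H1 /H2 /pairing /c /s.
    by move: (cos _) (sin _) (invF_re _ _ _) (invF_im _ _ _) (g1 xi) (g2 xi) => *; ring.
  have cN (H : Rd R d -> R) b : \int[mu]_xi (H xi * c (- b) xi) = \int[mu]_xi (H xi * c b xi).
    by apply: eq_Rintegral => xi _; rewrite /c dotpNr mulrN cosN.
  have sN (H : Rd R d -> R) b : mu.-integrable setT (EFin \o H) ->
      \int[mu]_xi (H xi * s (- b) xi) = - \int[mu]_xi (H xi * s b xi).
    move=> iH; rewrite -[RHS]mulN1r -RintegralZl//; last exact: is_.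
    by apply: eq_Rintegral => xi _; rewrite /s dotpNr mulrN sinN; ring.
  (* Using b and -b together separates the cosine and sine integrals of H1 and H2, since one is even
     and the other odd in b. *)
  have u1 : {ae mu, forall xi, H1 xi = 0}.
    apply: (fourier_unique i1) => b.
    have := z1 b; have := z1 (- b); have := z2 b; have := z2 (- b).
    by rewrite !cN !sN// /c /s; split; lra.
  have u2 : {ae mu, forall xi, H2 xi = 0}.
    apply: (fourier_unique i2) => b.
    have := z1 b; have := z1 (- b); have := z2 b; have := z2 (- b).
    by rewrite !cN !sN// /c /s; split; lra.
  by apply: filterS2 u1 u2 => xi e1 e2; split.
have pi2 := pi_ge2 R.
(* Bumps so narrow that their transform is positive on the cube of half-side n; countably many
   suffice, hence one null set serves all n. *)
pose lam n : R := 8 * pi * d%:R * n%:R + 1.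
have lam0 n : 0 < lam n by rewrite ltr_wpDl// !mulr_ge0//; lra.
have : {ae mu, forall xi, forall n, pairing mu g1 g2 (bump (lam n) 0) xi = 0 /\
    pairing mu g2 (fun x => - g1 x) (bump (lam n) 0) xi = 0}.
  by apply: ae_foralln => n; exact: ae.
apply: filterS => xi hxi.
have [n hn] : exists n : nat, forall i, `|(xi : 'rV[R]_d) 0 i| <= n%:R.
  have : (\bigcup_n cube n%:R) (xi : Rd R d) by rewrite cubes_cover.
  by move=> [n _ /cubeP cx]; exists n => i; have /andP[c1 c2] := cx i; rewrite ler_norml c1 ltW.
have ln : 8 * pi * d%:R * n%:R <= lam n by rewrite /lam; lra.
have := invF_re_bump_gt0 Hmu (lam0 n) (ler0n _ n) ln hn.
have [] := hxi n; rewrite /pairing; move: (invF_re _ _ _) (invF_im _ _ _) => k1 k2 e1 e2 k10.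
(* |g K|^2 = |g|^2 |K|^2 for complex numbers, with K the transform of the bump at xi. *)
have e3 : (g1 xi ^+ 2 + g2 xi ^+ 2) * (k1 ^+ 2 + k2 ^+ 2) = 0.
  rewrite (_ : _ * _ = (g1 xi * k1 - g2 xi * k2) ^+ 2 + (g2 xi * k1 - - g1 xi * k2) ^+ 2); last by ring.
  by rewrite e1 e2 expr0n addr0.
have k0 : k1 ^+ 2 + k2 ^+ 2 != 0 by rewrite gt_eqF// ltr_pwDl ?sqr_ge0// exprn_gt0.
move/eqP: e3; rewrite mulf_eq0 (negbTE k0) orbF paddr_eq0 ?sqr_ge0// !sqrf_eq0.
by move=> /andP[/eqP-> /eqP->].
Qed.
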